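(* Let $\ell$ be a field and $E$ a finite graph such that the Leavitt path algebra $L(E)$ over $\ell$ is simple. Then there is an isomorphism of groups $$\mathcal{E}xt(L(E),\ell)\cong\mathrm{Coker}(I-A_E:\mathbb Z^{E^0}\to\mathbb Z^{\mathrm{reg}(E)}).$$
   Context: Algebras are associative, not necessarily unital $\ell$-algebras; homomorphisms need not be unital. A graph $E$ is a directed graph with vertex set $E^0$, edge set $E^1$ and source and range maps $s,r:E^1\to E^0$; it is finite if $E^0$ and $E^1$ are. The Leavitt path algebra $L(E)$ is the $\ell$-algebra generated by $E^0\cup E^1\cup\{e^*:e\in E^1\}$ subject to: $vw=\delta_{v,w}v$ for $v,w\in E^0$; $s(e)e=e=er(e)$ and $r(e)e^*=e^*=e^*s(e)$; $e^*f=\delta_{e,f}r(e)$; and $v=\sum_{s(e)=v}ee^*$ for every $v$ with $0<\#s^{-1}(v)<\infty$. For finite $E$, $\mathrm{reg}(E)=E^0\setminus\mathrm{sink}(E)$ is the set of vertices emitting at least one edge. $A_E\in\mathbb Z^{\mathrm{reg}(E)\times E^0}$ is the incidence matrix with rows of sinks removed, $(A_E)_{v,w}=\#\{e\in E^1:s(e)=v,\ r(e)=w\}$, and $I\in\mathbb Z^{\mathrm{reg}(E)\times E^0}$ is the identity matrix with the rows of sinks removed. Homomorphisms $f,g:A\to B$ are elementarily homotopic if there is a homomorphism $H:A\to B[t]$ with $\mathrm{ev}_0H=f$, $\mathrm{ev}_1H=g$; homotopy $\approx$ is the equivalence relation generated by this. With $\iota_2:B\to M_2B$ the upper left corner inclusion,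 $f,g$ are $M_2$-homotopic if $\iota_2f\approx\iota_2g$; $[A,B]_{M_2}$ is the set of $M_2$-homotopy classes. For a unital algebra $R$, let $\Gamma R$ be the algebra of $\mathbb N\times\mathbb N$ matrices over $R$ all of whose rows and columns are finitely supported, $M_\infty R\triangleleft\Gamma R$ the ideal of matrices with finitely many nonzero entries, and $\Sigma R=\Gamma R/M_\infty R$. Choose $x_1,x_2,y_1,y_2\in\Sigma R$ with $y_ix_j=\delta_{i,j}$ (e.g. the classes of $x_1=\sum_n\epsilon_{2n,n}$, $x_2=\sum_n\epsilon_{2n+1,n}$ and their transposes). Then $[A,\Sigma R]_{M_2}$ is an abelian monoid under the operation induced by $(f\boxplus g)(a)=x_1f(a)y_1+x_2g(a)y_2$, and $\mathcal{E}xt(A,R)$ is its group completion. *)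

(* Defs.v *)
From HB Require Import structures.
From Stdlib Require Import Relations.
From mathcomp Require Import all_boot all_order all_algebra.
From mathcomp Require Import boolp classical_sets functions cardinality fsbigop.

Set Implicit Arguments.
Unset Strict Implicit.
Unset Printing Implicit Defensive.

Import GRing.Theory.
Local Open Scope classical_set_scope.
Local Open Scope quotient_scope.
Local Open Scope ring_scope.

HB.mixin Record Lmodule_isNalgebra (K : comNzRingType) A of GRing.Lmodule K A := {
  nmul : A -> A -> A;
  nmulA : associative nmul;
  nmulDl : left_distributive nmul +%R;
  nmulDr : right_distributive nmul +%R;
  nscalerAl : forall (c : K) (x y : A), c *: nmul x y = nmul (c *: x) y;
  nscalerAr : forall (c : K) (x y : A), c *: nmul x y = nmul x (c *: y)
}.

#[short(type="nalgType")]
HB.structure Definition Nalgebra (K : comNzRingType) :=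
  {A of Lmodule_isNalgebra K A & GRing.Lmodule K A}.

Section Simple.
Variables (K : comNzRingType) (A : nalgType K).

Definition two_sided_ideal (I : set A) : Prop :=
  [/\ I 0,
      forall (c : K) x y, I x -> I y -> I (c *: x + y),
      forall x y, I y -> I (nmul x y)
    & forall x y, I x -> I (nmul x y)].

Definition simple_algebra : Prop :=
  (exists x y : A, nmul x y != 0) /\
  forall I : set A, two_sided_ideal I -> I = [set 0] \/ I = setT.

End Simple.

(** The codomains that occur below ([B], [B[t]], [M_2 B] for [B] unital) are
    all unital, hence the library's [algType]; the homomorphisms themselves are
    not required to preserve units. *)
Record nhom (K : comNzRingType) (A : nalgType K) (B : algType K) := Nhom {
  nhom_fun :> {linear A -> B};
  nhomM : forall x y, nhom_fun (nmul x y) = nhom_fun x * nhom_fun y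
}.

HB.instance Definition _ K A B := gen_eqMixin (@nhom K A B).
HB.instance Definition _ K A B := gen_choiceMixin (@nhom K A B).

Lemma nhomP K A B (f g : @nhom K A B) : f =1 g -> f = g.
Proof.
case: f g => [f fM] [g gM] /= fg.
have {}fg : f = g.
  case: f g fg {fM gM} => [f [[fD] [fZ]]] [g [[gD] [gZ]]] /= /funext fg.
  case: g / fg gD gZ => gD gZ.
  by rewrite (Prop_irrelevance fD gD) (Prop_irrelevance fZ gZ).
by case: g / fg gM => gM; congr Nhom; exact: Prop_irrelevance.
Qed.

Section HomConstructions.
Variables (K : comNzRingType) (A : nalgType K) (B : algType K).

Section Build.
Variables (f : A -> B) (fL : linear f)
  (fM : forall x y, f (nmul x y) = f x * f y).
HB.instance Definition _ := GRing.isLinear.Build K A B *:%R f fL.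
Definition nhom_of : nhom A B := @Nhom _ _ _ f fM.
End Build.

Lemma nhom0_linear : linear (fun _ : A => 0 : B).
Proof. by move=> c x y; rewrite scaler0 addr0. Qed.

Definition nhom0 : nhom A B :=
  nhom_of nhom0_linear (fun _ _ => esym (mul0r 0)).

Lemma nhomLE (f : nhom A B) c x y : f (c *: x + y) = c *: f x + f y.
Proof. exact: linearP. Qed.

End HomConstructions.

(** The library only makes [{poly B}] and ['M[B]_2] into [B]-modules; here
    [c : K] acts through its image [c%:A] in [B], i.e. coefficientwise. *)
Section PolyAlg.
Variables (K : comNzRingType) (B : algType K).

Definition poly_alg : Type := {poly B}.
HB.instance Definition _ := GRing.NzRing.on poly_alg.

Let scale (c : K) (p : poly_alg) : poly_alg := c%:A *: (p : {poly B}).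

Let scaleA a b p : scale a (scale b p) = scale (a * b) p.
Proof. by rewrite /scale scalerA -scalerAl mul1r scalerA. Qed.
Let scale1 : left_id 1 scale.
Proof. by move=> p; rewrite /scale !scale1r. Qed.
Let scaleDr : right_distributive scale +%R.
Proof. by move=> c p q; exact: scalerDr. Qed.
Let scaleDl p : {morph scale^~ p : a b / a + b}.
Proof. by move=> a b; rewrite /scale !scalerDl. Qed.
HB.instance Definition _ :=
  GRing.Zmodule_isLmodule.Build K poly_alg scaleA scale1 scaleDr scaleDl.

Let scaleAl c (p q : poly_alg) : c *: (p * q) = (c *: p) * q.
Proof. exact: (@scalerAl _ {poly B}). Qed.
HB.instance Definition _ := GRing.Lmodule_isLalgebra.Build K poly_alg scaleAl.

Let scaleAr c (p q : poly_alg) : c *: (p * q) = p * (c *: q).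
Proof.
apply/polyP => i; rewrite [LHS](@coefZ B) !(@coefM B) mulr_sumr.
apply: eq_bigr => j _; rewrite [in RHS](@coefZ B).
by rewrite -!(scalerAl, scalerAr) !mul1r.
Qed.
HB.instance Definition _ := GRing.Lalgebra_isAlgebra.Build K poly_alg scaleAr.

Lemma poly_algZ c (p : poly_alg) : c *: p = c%:A *: (p : {poly B}).
Proof. by []. Qed.

End PolyAlg.

Section Mx2Alg.
Variables (K : comNzRingType) (B : algType K).

Definition mx2_alg : Type := 'M[B]_2.
HB.instance Definition _ := GRing.NzRing.on mx2_alg.

Let scale (c : K) (M : mx2_alg) : mx2_alg := c%:A *: (M : 'M[B]_2).

Let scaleA a b M : scale a (scale b M) = scale (a * b) M.
Proof. by rewrite /scale scalerA -scalerAl mul1r scalerA. Qed.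
Let scale1 : left_id 1 scale.
Proof. by move=> M; rewrite /scale !scale1r. Qed.
Let scaleDr : right_distributive scale +%R.
Proof. by move=> c M N; exact: scalerDr. Qed.
Let scaleDl M : {morph scale^~ M : a b / a + b}.
Proof. by move=> a b; rewrite /scale !scalerDl. Qed.
HB.instance Definition _ :=
  GRing.Zmodule_isLmodule.Build K mx2_alg scaleA scale1 scaleDr scaleDl.

Let scaleAl c (M N : mx2_alg) : c *: (M * N) = (c *: M) * N.
Proof. exact: (@scalerAl _ 'M[B]_2). Qed.
HB.instance Definition _ := GRing.Lmodule_isLalgebra.Build K mx2_alg scaleAl.

Let scaleAr c (M N : mx2_alg) : c *: (M * N) = M * (c *: N).
Proof.
apply/matrixP => i j; rewrite !mxE mulr_sumr.
apply: eq_bigr => k _; rewrite mxE.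
by rewrite -!(scalerAl, scalerAr) !mul1r.
Qed.
HB.instance Definition _ := GRing.Lalgebra_isAlgebra.Build K mx2_alg scaleAr.

Lemma mx2_algZ c (M : mx2_alg) : c *: M = c%:A *: (M : 'M[B]_2).
Proof. by []. Qed.

Definition corner (b : B) : mx2_alg := b *: (delta_mx 0 0 : 'M[B]_2).

Lemma corner_linear : linear corner.
Proof.
move=> c x y; rewrite /corner mx2_algZ scalerDl scalerA.
by rewrite -scalerAl mul1r.
Qed.

Lemma cornerM x y : corner (x * y) = corner x * corner y.
Proof.
apply/matrixP => i j; rewrite /corner !mxE big_ord_recl big_ord1 !mxE /=.
rewrite -!mulrA; case: (i == 0); case: (j == 0) => /=;
  by rewrite ?(mulr0, mul0r, mulr1, mul1r, addr0).
Qed.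

Variable A : nalgType K.

Section Iota2.
Variable f : nhom A B.

Let corner_comp_linear : linear (corner \o f).
Proof. by move=> c x y /=; rewrite nhomLE corner_linear. Qed.

Let corner_compM x y : (corner \o f) (nmul x y) = corner (f x) * corner (f y).
Proof. by rewrite /= nhomM cornerM. Qed.

Definition iota2 : nhom A mx2_alg := nhom_of corner_comp_linear corner_compM.

End Iota2.

End Mx2Alg.

Section Homotopy.
Variables (K : comNzRingType) (A : nalgType K).

Definition elem_homotopic (B : algType K) (f g : nhom A B) : Prop :=
  exists H : nhom A (poly_alg B),
    (forall a, (H a : {poly B}).[0] = f a) /\
    (forall a, (H a : {poly B}).[1] = g a).

Definition homotopic (B : algType K) : relation (nhom A B) :=
  clos_refl_sym_trans _ (@elem_homotopic B).

Definition M2_homotopic (B : algType K) (f g : nhom A B) : Prop :=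
  homotopic (iota2 f) (iota2 g).

End Homotopy.

Lemma finite_natP (A : set nat) :
  finite_set A <-> exists N, forall k, (N <= k)%N -> ~ A k.
Proof.
split=> [/finite_seqP[X ->]|[N AN]]; last first.
  apply: (sub_finite_set _ (finite_II N)) => k Ak /=.
  by rewrite ltnNge; apply/negP => /AN.
exists (\max_(x <- X) x.+1)%N => k Nk /= kX.
by have := leq_trans (leq_bigmax_seq (P := xpredT) (F := succn) k kX isT) Nk; rewrite ltnn.
Qed.

Lemma fsum_ord (V : nmodType) (F : nat -> V) N :
  (forall k, (N <= k)%N -> F k = 0) ->
  \sum_(k \in [set: nat]) F k = \sum_(k < N) F k.
Proof.
move=> F0; rewrite fsbig_ord; apply/esym/fsbig_widen => // k [_ /= kN].
by apply: F0; rewrite leqNgt; apply/negP.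
Qed.

Section Gamma.
Variables (K : comNzRingType) (R : algType K).

Definition rcfinite (a : nat -> nat -> R) : bool :=
  `[< (forall i, finite_set [set j | a i j != 0]) /\
      (forall j, finite_set [set i | a i j != 0]) >].

Lemma rcfiniteP a : reflect
  ((forall i, exists N, forall j, (N <= j)%N -> a i j = 0) /\
   (forall j, exists N, forall i, (N <= i)%N -> a i j = 0)) (rcfinite a).
Proof.
apply: (iffP (asboolP _)) => -[ar ac]; split=> i.
- have /finite_natP[N aN] := ar i; exists N => j /aN /= /negP.
  by rewrite negbK => /eqP.
- have /finite_natP[N aN] := ac i; exists N => j /aN /= /negP.
  by rewrite negbK => /eqP.
- have [N aN] := ar i; apply/finite_natP; exists N => j /aN /= ->.
  by rewrite eqxx.
- have [N aN] := ac i; apply/finite_natP; exists N => j /aN /= ->.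
  by rewrite eqxx.
Qed.

Lemma rcfinite_submod : submod_closed rcfinite.
Proof.
split; first by apply/rcfiniteP; split=> i; exists 0%N.
move=> c a b /rcfiniteP[ar ac] /rcfiniteP[br bc].
apply/rcfiniteP; split=> i.
- have [[M aM] [N bN]] := (ar i, br i); exists (maxn M N) => j.
  by rewrite geq_max => /andP[/aM aj /bN bj]; rewrite !fctE aj bj scaler0 addr0.
- have [[M aM] [N bN]] := (ac i, bc i); exists (maxn M N) => j.
  by rewrite geq_max => /andP[/aM aj /bN bj]; rewrite !fctE aj bj scaler0 addr0.
Qed.

HB.instance Definition _ := GRing.isSubmodClosed.Build K _ rcfinite rcfinite_submod.

Record Gamma := MkGamma { gval :> nat -> nat -> R; gvalP : rcfinite gval }.

HB.instance Definition _ := [isSub for gval].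
HB.instance Definition _ := [Choice of Gamma by <:].
HB.instance Definition _ := [SubChoice_isSubLmodule of Gamma by <:].

Lemma gammaP (a b : Gamma) : (forall i j, a i j = b i j) -> a = b.
Proof. by move=> ab; apply/val_inj/funext => i; apply/funext => j; exact: ab. Qed.

Lemma gamma_row (a : Gamma) i : exists N, forall j, (N <= j)%N -> a i j = 0.
Proof. by case: a => a /= /rcfiniteP[]. Qed.

Lemma gamma_col (a : Gamma) j : exists N, forall i, (N <= i)%N -> a i j = 0.
Proof. by case: a => a /= /rcfiniteP[]. Qed.

Definition gmul_fun (a b : nat -> nat -> R) i j : R :=
  \sum_(k \in [set: nat]) a i k * b k j.

Lemma gmul_ord (a b : nat -> nat -> R) i j N :
  (forall k, (N <= k)%N -> a i k = 0) ->
  gmul_fun a b i j = \sum_(k < N) a i k * b k j.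
Proof. by move=> aN; apply: fsum_ord => k /aN ->; rewrite mul0r. Qed.

Lemma bound_upto (P : nat -> nat -> Prop) M :
  (forall k, exists N, forall j, (N <= j)%N -> P k j) ->
  exists N, forall k j, (k < M)%N -> (N <= j)%N -> P k j.
Proof.
move=> h; elim: M => [|M [N hN]]; first by exists 0%N.
have [N' hN'] := h M; exists (maxn N N') => k j.
rewrite ltnS leq_eqVlt geq_max => /orP[/eqP -> /andP[_ /hN' //]|kM /andP[Nj _]].
exact: hN.
Qed.

Lemma gmul_subproof (a b : Gamma) : rcfinite (gmul_fun a b).
Proof.
apply/rcfiniteP; split=> i.
- have [M aM] := gamma_row a i.
  have [N bN] := bound_upto M (gamma_row b).
  exists N => j Nj; rewrite (gmul_ord _ _ aM) big1 // => k _.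
  by rewrite bN ?mulr0.
- have [M bM] := gamma_col b i.
  have [N aN] := bound_upto M (gamma_col a).
  exists N => j Nj; rewrite /gmul_fun fsbig1 // => k _.
  by have [/bM ->|kM] := leqP M k; rewrite ?mulr0 // aN ?mul0r.
Qed.

Definition gmul (a b : Gamma) : Gamma := MkGamma (gmul_subproof a b).

Lemma gone_subproof : rcfinite (fun i j => (i == j)%:R).
Proof.
by apply/rcfiniteP; split=> i; exists i.+1 => j ij;
  [rewrite ltn_eqF|rewrite gtn_eqF].
Qed.

Definition gone : Gamma := MkGamma gone_subproof.

Lemma gmulE (a b : Gamma) i j : gmul a b i j = gmul_fun a b i j.
Proof. by []. Qed.

Lemma gaddE (a b : Gamma) i j : (a + b) i j = a i j + b i j.
Proof. by []. Qed.

Lemma gscaleE c (a : Gamma) i j : (c *: a) i j = c *: a i j.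
Proof. by []. Qed.

Lemma gmulA : associative gmul.
Proof.
move=> a b c; apply: gammaP => i j.
have [M aM] := gamma_row a i.
have [N bN] := bound_upto M (gamma_row b).
have abN k : (N <= k)%N -> gmul a b i k = 0.
  move=> Nk; rewrite gmulE (gmul_ord _ _ aM) big1 // => l _.
  by rewrite bN ?mulr0.
rewrite !gmulE (gmul_ord _ _ aM) (gmul_ord _ _ abN).
under [RHS]eq_bigr do rewrite gmulE (gmul_ord _ _ aM) mulr_suml.
rewrite exchange_big; apply: eq_bigr => k _.
rewrite gmulE (@gmul_ord _ _ _ _ N) => [|l Nl]; last exact: bN.
by rewrite mulr_sumr; apply: eq_bigr => l _; rewrite mulrA.
Qed.

Lemma gmul1 : left_id gone gmul.
Proof.
move=> a; apply: gammaP => i j; rewrite gmulE (@gmul_ord _ _ _ _ i.+1).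
  rewrite (bigD1 ord_max) //= eqxx mul1r big1 ?addr0 // => k.
  by rewrite -val_eqE /= eq_sym => /negPf ->; rewrite mul0r.
by move=> k ik; rewrite /= ltn_eqF.
Qed.

Lemma gmulr1 : right_id gone gmul.
Proof.
move=> a; apply: gammaP => i j; have [N aN] := gamma_row a i.
rewrite gmulE (@gmul_ord _ _ _ _ (maxn N j.+1)); last first.
  by move=> k; rewrite geq_max => /andP[/aN].
have jM : (j < maxn N j.+1)%N by rewrite leq_max leqnn orbT.
rewrite (bigD1 (Ordinal jM)) //= eqxx mulr1 big1 ?addr0 // => k.
by rewrite -val_eqE /= => /negPf ->; rewrite mulr0.
Qed.

Lemma gmulDl : left_distributive gmul +%R.
Proof.
move=> a b c; apply: gammaP => i j; rewrite gaddE !gmulE.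
have [[M aM] [N bN]] := (gamma_row a i, gamma_row b i).
have {}aM k : (maxn M N <= k)%N -> a i k = 0.
  by rewrite geq_max => /andP[/aM].
have {}bN k : (maxn M N <= k)%N -> b i k = 0.
  by rewrite geq_max => /andP[_ /bN].
have abMN k : (maxn M N <= k)%N -> (a + b) i k = 0.
  by move=> Nk; rewrite gaddE aM ?bN ?addr0.
rewrite (gmul_ord _ _ aM) (gmul_ord _ _ bN) (gmul_ord _ _ abMN).
by rewrite -big_split; apply: eq_bigr => k _; rewrite gaddE mulrDl.
Qed.

Lemma gmulDr : right_distributive gmul +%R.
Proof.
move=> a b c; apply: gammaP => i j; rewrite gaddE !gmulE.
have [M aM] := gamma_row a i; rewrite !(gmul_ord _ _ aM).
by rewrite -big_split; apply: eq_bigr => k _; rewrite gaddE mulrDr.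
Qed.

Lemma gone_neq0 : gone != 0.
Proof.
apply/eqP => /(congr1 (fun a : Gamma => a 0%N 0%N)) /eqP.
by rewrite /= oner_eq0.
Qed.

HB.instance Definition _ := GRing.Zmodule_isNzRing.Build Gamma
  gmulA gmul1 gmulr1 gmulDl gmulDr gone_neq0.

Lemma gmul_valE (a b : Gamma) i j : (a * b) i j = gmul_fun a b i j.
Proof. by []. Qed.

Lemma gscaleAl c (a b : Gamma) : c *: (a * b) = (c *: a) * b.
Proof.
apply: gammaP => i j; rewrite gscaleE [in LHS]gmul_valE [RHS]gmul_valE.
have [M aM] := gamma_row a i.
rewrite (gmul_ord _ _ aM) (@gmul_ord _ _ _ _ M) => [|k /aM ak].
  by rewrite scaler_sumr; apply: eq_bigr => k _; rewrite scalerAl.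
by rewrite gscaleE ak scaler0.
Qed.

Lemma gscaleAr c (a b : Gamma) : c *: (a * b) = a * (c *: b).
Proof.
apply: gammaP => i j; rewrite gscaleE [in LHS]gmul_valE [RHS]gmul_valE.
have [M aM] := gamma_row a i.
rewrite (gmul_ord _ _ aM) (gmul_ord _ _ aM).
by rewrite scaler_sumr; apply: eq_bigr => k _; rewrite scalerAr.
Qed.

HB.instance Definition _ := GRing.Lmodule_isLalgebra.Build K Gamma gscaleAl.
HB.instance Definition _ := GRing.Lalgebra_isAlgebra.Build K Gamma gscaleAr.

Definition Minfty : {pred Gamma} :=
  fun a => `[< finite_set [set ij : nat * nat | a ij.1 ij.2 != 0] >].

Lemma MinftyP (a : Gamma) : reflect
  (exists N, forall i j, ((N <= i) || (N <= j))%N -> a i j = 0) (a \in Minfty).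
Proof.
apply: (iffP (asboolP _)) => [afin|[N aN]]; last first.
  apply: (sub_finite_set _ (finite_setX (finite_II N) (finite_II N))).
  move=> [i j] /= aij; split; rewrite /= ltnNge; apply: contra aij => Nij;
    by rewrite aN ?Nij ?orbT.
have /finite_natP[M aM] := finite_image fst afin.
have /finite_natP[N aN] := finite_image snd afin.
exists (maxn M N) => i j h; apply: contrapT => /eqP aij.
case/orP: h; rewrite geq_max => /andP[Mi Ni].
  by apply: (aM i) => //; exists (i, j).
by apply: (aN j) => //; exists (i, j).
Qed.

Lemma Minfty_zmod : zmod_closed Minfty.
Proof.
split; first by apply/MinftyP; exists 0%N.
move=> a b /MinftyP[M aM] /MinftyP[N bN].
apply/MinftyP; exists (maxn M N) => i j; rewrite !geq_max => h.
rewrite -scaleN1r gaddE gscaleE aM ?bN ?scaler0 ?addr0 //.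
  by case/orP: h => /andP[_ ->]; rewrite ?orbT.
by case/orP: h => /andP[-> _]; rewrite ?orbT.
Qed.

HB.instance Definition _ := GRing.isZmodClosed.Build Gamma Minfty Minfty_zmod.

Lemma Minfty_mull (a b : Gamma) : b \in Minfty -> a * b \in Minfty.
Proof.
move=> /MinftyP[N bN]; have [M aM] := bound_upto N (gamma_col a).
apply/MinftyP; exists (maxn M N) => i j h.
rewrite [LHS]fsbig1 // => k _; have [Nk|kN] := leqP N k.
  by rewrite bN ?Nk ?mulr0.
case/orP: h; rewrite geq_max => /andP[Mi Ni]; first by rewrite aM ?mul0r.
by rewrite bN ?Ni ?orbT ?mulr0.
Qed.

Lemma Minfty_mulr (a b : Gamma) : a \in Minfty -> a * b \in Minfty.
Proof.
move=> /MinftyP[N aN]; have [M bM] := bound_upto N (gamma_row b).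
apply/MinftyP; exists (maxn M N) => i j h.
rewrite [LHS]fsbig1 // => k _; have [Nk|kN] := leqP N k.
  by rewrite aN ?Nk ?orbT ?mul0r.
case/orP: h; rewrite geq_max => /andP[Mi Ni]; last by rewrite bM ?mulr0.
by rewrite aN ?Ni ?mul0r.
Qed.

Lemma Minfty_scale c (a : Gamma) : a \in Minfty -> c *: a \in Minfty.
Proof. by move=> aM; rewrite -[a]mul1r scalerAl Minfty_mull. Qed.

Lemma Minfty1 : (1 : Gamma) \notin Minfty.
Proof.
apply/MinftyP => -[N /(_ N N)]; rewrite leqnn => /(_ isT) /eqP.
by rewrite /= eqxx oner_eq0.
Qed.

End Gamma.

Section Sigma.
Variables (K : comNzRingType) (R : algType K).

Definition Sigma : Type := {ideal_quot (@Minfty K R)}.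
HB.instance Definition _ := GRing.Zmodule.on Sigma.

Definition to_Sigma (a : Gamma R) : Sigma := \pi_{ideal_quot (@Minfty K R)} a.

Lemma to_SigmaP (a b : Gamma R) :
  to_Sigma a = to_Sigma b <-> a - b \in @Minfty K R.
Proof.
by split=> [ab|]; [rewrite Quotient.idealrBE; apply/eqP|
  rewrite Quotient.idealrBE => /eqP].
Qed.

Lemma to_SigmaD a b : to_Sigma (a + b) = to_Sigma a + to_Sigma b.
Proof. exact: Quotient.pi_add. Qed.

Definition sigma_repr (x : Sigma) : Gamma R := repr (x : {ideal_quot (@Minfty K R)}).

Lemma sigma_reprK x : to_Sigma (sigma_repr x) = x.
Proof. exact: reprK. Qed.

Lemma to_Sigma_surj x : exists a, x = to_Sigma a.
Proof. by exists (sigma_repr x); rewrite sigma_reprK. Qed.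

Definition sone : Sigma := to_Sigma 1.
Definition smul (x y : Sigma) : Sigma := to_Sigma (sigma_repr x * sigma_repr y).
Definition sscale (c : K) (x : Sigma) : Sigma := to_Sigma (c *: sigma_repr x).

Lemma to_SigmaM a b : to_Sigma (a * b) = smul (to_Sigma a) (to_Sigma b).
Proof.
have /to_SigmaP a0 := esym (sigma_reprK (to_Sigma a)).
have /to_SigmaP b0 := esym (sigma_reprK (to_Sigma b)).
apply/to_SigmaP; set a' := sigma_repr _ in a0 *; set b' := sigma_repr _ in b0 *.
have -> : a * b - a' * b' = (a - a') * b + a' * (b - b').
  by rewrite mulrBl mulrBr addrA subrK.
by apply: rpredD; [exact: Minfty_mulr|exact: Minfty_mull].
Qed.

Lemma to_SigmaZ c a : to_Sigma (c *: a) = sscale c (to_Sigma a).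
Proof.
have /to_SigmaP a0 := esym (sigma_reprK (to_Sigma a)).
by apply/to_SigmaP; rewrite -scalerBr Minfty_scale.
Qed.

Let smulA : associative smul.
Proof.
move=> x y z; have [a ->] := to_Sigma_surj x; have [b ->] := to_Sigma_surj y.
have [c ->] := to_Sigma_surj z.
by rewrite -!to_SigmaM mulrA.
Qed.
Let smul1 : left_id sone smul.
Proof. by move=> x; have [a ->] := to_Sigma_surj x; rewrite -!to_SigmaM mul1r. Qed.
Let smulr1 : right_id sone smul.
Proof. by move=> x; have [a ->] := to_Sigma_surj x; rewrite -!to_SigmaM mulr1. Qed.
Let smulDl : left_distributive smul +%R.
Proof.
move=> x y z; have [a ->] := to_Sigma_surj x; have [b ->] := to_Sigma_surj y.
have [c ->] := to_Sigma_surj z.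
by rewrite -to_SigmaD -!to_SigmaM -to_SigmaD mulrDl.
Qed.
Let smulDr : right_distributive smul +%R.
Proof.
move=> x y z; have [a ->] := to_Sigma_surj x; have [b ->] := to_Sigma_surj y.
have [c ->] := to_Sigma_surj z.
by rewrite -to_SigmaD -!to_SigmaM -to_SigmaD mulrDr.
Qed.
Let sone_neq0 : sone != 0.
Proof.
apply/eqP => h; have /to_SigmaP : to_Sigma 1 = to_Sigma 0.
  by rewrite [to_Sigma 1]h -[RHS]/(\pi_{ideal_quot (@Minfty K R)} 0) piE.
by rewrite subr0 (negPf (Minfty1 R)).
Qed.
HB.instance Definition _ := GRing.Zmodule_isNzRing.Build Sigma
  smulA smul1 smulr1 smulDl smulDr sone_neq0.

Let sscaleA a b x : sscale a (sscale b x) = sscale (a * b) x.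
Proof. by have [x' ->] := to_Sigma_surj x; rewrite -!to_SigmaZ scalerA. Qed.
Let sscale1 : left_id 1 sscale.
Proof. by move=> x; have [a ->] := to_Sigma_surj x; rewrite -!to_SigmaZ scale1r. Qed.
Let sscaleDr : right_distributive sscale +%R.
Proof.
move=> c x y; have [a ->] := to_Sigma_surj x; have [b ->] := to_Sigma_surj y.
by rewrite -to_SigmaD -!to_SigmaZ -to_SigmaD scalerDr.
Qed.
Let sscaleDl x : {morph sscale^~ x : a b / a + b}.
Proof.
by move=> a b; have [x' ->] := to_Sigma_surj x;
  rewrite -!to_SigmaZ -to_SigmaD scalerDl.
Qed.
HB.instance Definition _ :=
  GRing.Zmodule_isLmodule.Build K Sigma sscaleA sscale1 sscaleDr sscaleDl.

Let sscaleAl c (x y : Sigma) : c *: (x * y) = (c *: x) * y.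
Proof.
have [a ->] := to_Sigma_surj x; have [b ->] := to_Sigma_surj y.
by rewrite -[RHS]/(smul (sscale _ _) _) -[LHS]/(sscale _ (smul _ _))
  -!(to_SigmaM, to_SigmaZ) scalerAl.
Qed.
HB.instance Definition _ := GRing.Lmodule_isLalgebra.Build K Sigma sscaleAl.

Let sscaleAr c (x y : Sigma) : c *: (x * y) = x * (c *: y).
Proof.
have [a ->] := to_Sigma_surj x; have [b ->] := to_Sigma_surj y.
by rewrite -[RHS]/(smul _ (sscale _ _)) -[LHS]/(sscale _ (smul _ _))
  -!(to_SigmaM, to_SigmaZ) scalerAr.
Qed.
HB.instance Definition _ := GRing.Lalgebra_isAlgebra.Build K Sigma sscaleAr.

End Sigma.

Record iso_pair (K : comNzRingType) (B : algType K) := IsoPair {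
  iso_x1 : B;
  iso_x2 : B;
  iso_y1 : B;
  iso_y2 : B;
  iso_y1x1 : iso_y1 * iso_x1 = 1;
  iso_y1x2 : iso_y1 * iso_x2 = 0;
  iso_y2x1 : iso_y2 * iso_x1 = 0;
  iso_y2x2 : iso_y2 * iso_x2 = 1
}.

Section Boxplus.
Variables (K : comNzRingType) (A : nalgType K) (B : algType K) (p : iso_pair B).
Variables f g : nhom A B.

Definition boxplus_fun (a : A) : B :=
  iso_x1 p * f a * iso_y1 p + iso_x2 p * g a * iso_y2 p.

Let boxplus_linear : linear boxplus_fun.
Proof.
move=> c a b; rewrite /boxplus_fun !nhomLE !mulrDr !mulrDl.
by rewrite -!scalerAr -!scalerAl scalerDr addrACA.
Qed.

Let boxplusM a b : boxplus_fun (nmul a b) = boxplus_fun a * boxplus_fun b.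
Proof.
rewrite /boxplus_fun !nhomM mulrDl !mulrDr -!mulrA.
rewrite ![iso_y1 p * (_ * _)]mulrA ![iso_y2 p * (_ * _)]mulrA.
by rewrite iso_y1x1 iso_y1x2 iso_y2x1 iso_y2x2 !mul1r !mul0r !mulr0 add0r addr0.
Qed.

Definition boxplus : nhom A B := nhom_of boxplus_linear boxplusM.

End Boxplus.

Section HomotopyLemmas.
Variables (K : comNzRingType) (A : nalgType K).

Lemma homotopic_refl (B : algType K) (f : nhom A B) : homotopic f f.
Proof. exact: rst_refl. Qed.

Lemma homotopic_sym (B : algType K) (f g : nhom A B) :
  homotopic f g -> homotopic g f.
Proof. exact: rst_sym. Qed.

Lemma homotopic_trans (B : algType K) (f g h : nhom A B) :
  homotopic f g -> homotopic g h -> homotopic f h.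
Proof. exact: rst_trans. Qed.

Section Polynomials.
Variable B : algType K.

Lemma horner0M (q r : {poly B}) : (q * r).[0] = q.[0] * r.[0].
Proof. by apply: hornerM_comm; rewrite /comm_poly mul0r mulr0. Qed.

Lemma horner1M (q r : {poly B}) : (q * r).[1] = q.[1] * r.[1].
Proof. by apply: hornerM_comm; rewrite /comm_poly mul1r mulr1. Qed.

Lemma poly_algC_linear : linear (fun b : B => b%:P : poly_alg B).
Proof.
move=> c x y; rewrite poly_algZ -mul_polyC -[LHS]/(c *: x + y)%:P.
by rewrite polyCD -polyCM -scalerAl mul1r.
Qed.

Definition poly_algX : poly_alg B := ('X : {poly B}).

Lemma poly_alg_commX (b : poly_alg B) : poly_algX * b = b * poly_algX.
Proof. exact: esym (commr_polyX _). Qed.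

Section Const.
Variable f : nhom A B.

Let const_linear : linear (fun a => (f a)%:P : poly_alg B).
Proof. by move=> c a b; rewrite nhomLE poly_algC_linear. Qed.

Let constM a b :
  ((f (nmul a b))%:P : poly_alg B) = ((f a)%:P : poly_alg B) * (f b)%:P.
Proof. by rewrite nhomM polyCM. Qed.

Definition nhom_const : nhom A (poly_alg B) := nhom_of const_linear constM.

End Const.

Let polyC1 (x y : B) : x * y = 1 -> (x%:P : poly_alg B) * y%:P = 1.
Proof. by move=> xy; rewrite -[LHS]polyCM xy. Qed.

Let polyC0 (x y : B) : x * y = 0 -> (x%:P : poly_alg B) * y%:P = 0.
Proof. by move=> xy; rewrite -[LHS]polyCM xy. Qed.

Definition iso_pair_poly (p : iso_pair B) : iso_pair (poly_alg B) :=
  IsoPair (polyC1 (iso_y1x1 p)) (polyC0 (iso_y1x2 p))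
          (polyC0 (iso_y2x1 p)) (polyC1 (iso_y2x2 p)).

Lemma boxplus_homotopicl (p : iso_pair B) (f f' g : nhom A B) :
  homotopic f f' -> homotopic (boxplus p f g) (boxplus p f' g).
Proof.
elim=> {f f'} [f f' [H [H0 H1]]|f|f f' _|f f' f'' _ + _]; last first.
- exact: homotopic_trans.
- exact: homotopic_sym.
- exact: homotopic_refl.
apply: rst_step; exists (boxplus (iso_pair_poly p) H (nhom_const g)).
split=> a; rewrite -[X in horner X _]/(_ + _ : {poly B}) hornerD.
  by rewrite !horner0M !hornerC H0.
by rewrite !horner1M !hornerC H1.
Qed.

Lemma boxplus_homotopicr (p : iso_pair B) (f g g' : nhom A B) :
  homotopic g g' -> homotopic (boxplus p f g) (boxplus p f g').
Proof.
elim=> {g g'} [g g' [H [H0 H1]]|g|g g' _|g g' g'' _ + _]; last first.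
- exact: homotopic_trans.
- exact: homotopic_sym.
- exact: homotopic_refl.
apply: rst_step; exists (boxplus (iso_pair_poly p) (nhom_const f) H).
split=> a; rewrite -[X in horner X _]/(_ + _ : {poly B}) hornerD.
  by rewrite !horner0M !hornerC H0.
by rewrite !horner1M !hornerC H1.
Qed.

End Polynomials.

Section Conjugation.
Variables (B : algType K) (u v : B) (f : nhom A B).
Hypothesis vuf : forall a b, f a * (v * u) * f b = f a * f b.

Let conj_linear : linear (fun a => u * f a * v).
Proof.
move=> c a b; rewrite nhomLE mulrDr mulrDl.
by rewrite -!scalerAr -!scalerAl.
Qed.

Let conjM a b : u * f (nmul a b) * v = (u * f a * v) * (u * f b * v).
Proof. by rewrite nhomM -vuf !mulrA. Qed.

Definition nhom_conj : nhom A B := nhom_of conj_linear conjM.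

End Conjugation.

Lemma elem_conj (B : algType K) (n : B) (f g : nhom A B) :
    n * n = 0 -> (forall a, g a = (1 + n) * f a * (1 - n)) ->
  homotopic f g.
Proof.
move=> nn fg; apply: rst_step.
pose N : poly_alg B := (n%:P : poly_alg B) * poly_algX B.
have NN : N * N = 0.
  rewrite /N mulrA -[_ * _ * n%:P]mulrA poly_alg_commX !mulrA.
  by rewrite -[_%:P * _%:P]polyCM nn !mul0r.
have unit_N : (1 - N) * (1 + N) = 1.
  by rewrite mulrDr mulr1 mulrBl mul1r NN subr0 subrK.
have NuN a b : nhom_const f a * ((1 - N) * (1 + N)) * nhom_const f b =
    nhom_const f a * nhom_const f b by rewrite unit_N mulr1.
exists (nhom_conj NuN); split=> a.
  rewrite -[X in horner X _]/((1 + n%:P * 'X) * (f a)%:P * (1 - n%:P * 'X)).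
  by rewrite !horner0M !(hornerD, hornerN, horner0M, hornerC, hornerX)
    !mulr0 subr0 addr0 mulr1 mul1r.
rewrite -[X in horner X _]/((1 + n%:P * 'X) * (f a)%:P * (1 - n%:P * 'X)).
by rewrite !horner1M !(hornerD, hornerN, horner1M, hornerC, hornerX)
  !mulr1 fg.
Qed.

Section Corner.
Variable B : algType K.
Implicit Types (i j k l : 'I_2) (b c : B).

Definition mxat i j b : mx2_alg B := b *: (delta_mx i j : 'M[B]_2).

Lemma mxatM i j k l b c :
  mxat i j b * mxat k l c = (if j == k then mxat i l (b * c) else 0).
Proof.
apply/matrixP => r s; rewrite !mxE (bigD1 j) //= big1 => [|t tj]; last first.
  by rewrite !mxE (negPf tj) andbF mulr0 mul0r.
rewrite !mxE eqxx andbT addr0; case: (j == k); rewrite !mxE ?mulr0 //.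
case: (r == i); case: (s == l);
  by rewrite ?(mulr0, mul0r, mulr1, mul1r, addr0, mulrA).
Qed.

Lemma mxatN i j b : mxat i j (- b) = - mxat i j b.
Proof. by rewrite /mxat scaleNr. Qed.

Lemma mxat_nilp i j b : i != j -> mxat i j b * mxat i j b = 0.
Proof. by move=> ij; rewrite mxatM eq_sym (negPf ij). Qed.

Lemma elem_mxP i j b (f : nhom A (mx2_alg B)) (ij : i != j) x y :
  f x * ((1 - mxat i j b) * (1 + mxat i j b)) * f y = f x * f y.
Proof.
by rewrite mulrDr mulr1 mulrBl mul1r mxat_nilp // subr0 subrK mulr1.
Qed.

Definition elem_mx i j b f (ij : i != j) := nhom_conj (elem_mxP b f ij).

Lemma elem_mx_homotopic i j b f (ij : i != j) : homotopic f (elem_mx b f ij).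
Proof. exact: (elem_conj (mxat_nilp b ij)). Qed.

Lemma elem_mxE i j b f (ij : i != j) a :
  elem_mx b f ij a = f a + mxat i j b * f a - f a * mxat i j b
                     - mxat i j b * f a * mxat i j b.
Proof.
rewrite -[LHS]/((1 + mxat i j b) * f a * (1 - mxat i j b)).
by rewrite mulrDl mul1r mulrBr mulr1 mulrDl opprD addrA.
Qed.

Section Corner11.
Variable f : nhom A B.

Let c11_linear : linear (fun a => mxat 1 1 (f a)).
Proof.
move=> c x y; rewrite nhomLE /mxat mx2_algZ scalerDl scalerA.
by rewrite -scalerAl mul1r.
Qed.

Let c11M x y : mxat 1 1 (f (nmul x y)) = mxat 1 1 (f x) * mxat 1 1 (f y).
Proof. by rewrite mxatM nhomM. Qed.

Definition corner11 : nhom A (mx2_alg B) := nhom_of c11_linear c11M.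

End Corner11.

Lemma corner11_homotopic (u v : B) (f g : nhom A B) :
    (forall a, v * u * f a = f a) -> (forall a, f a * (v * u) = f a) ->
    (forall a, g a = u * f a * v) ->
  homotopic (corner11 f) (iota2 g).
Proof.
move=> vuf fvu gE.
have n01 : (0 : 'I_2) != 1 by []. have n10 : (1 : 'I_2) != 0 by [].
have h1 := elem_mx_homotopic u (corner11 f) n01; set f1 := elem_mx _ _ _ in h1.
have h2 := elem_mx_homotopic (- v) f1 n10; set f2 := elem_mx _ _ _ in h2.
have h3 := elem_mx_homotopic u f2 n01; set f3 := elem_mx _ _ _ in h3.
apply: (homotopic_trans h1); apply: (homotopic_trans h2).
apply: (homotopic_trans h3); suff -> : f3 = iota2 g by exact: homotopic_refl.
apply: nhomP => a; rewrite -[RHS]/(mxat 0 0 (g a)) gE.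
have f1E : f1 a = mxat 1 1 (f a) + mxat 0 1 (u * f a).
  by rewrite elem_mxE -[corner11 f a]/(mxat 1 1 (f a)) !mxatM /= !subr0.
have f2E : f2 a = mxat 0 1 (u * f a) + mxat 0 0 (u * f a * v).
  rewrite elem_mxE f1E !(mulrDl, mulrDr) !mxatM /= !mulrN !mulNr !mxatN.
  rewrite mulrA vuf add0r mul0r add0r opprK opprD !opprK.
  set x := mxat 1 1 _; set y := mxat 0 1 _.
  set z := mxat 1 0 _; set t := mxat 0 0 _.
  by rewrite [x + y]addrC addrK [z + t]addrC addrA addrK.
rewrite elem_mxE f2E !(mulrDl, mulrDr) !mxatM /= !mul0r !addr0 subr0 add0r.
by rewrite -!mulrA fvu addrAC subrr add0r.
Qed.

Lemma corner_conj (u v : B) (f g : nhom A B) :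
    (forall a, v * u * f a = f a) -> (forall a, f a * (v * u) = f a) ->
    (forall a, g a = u * f a * v) ->
  M2_homotopic f g.
Proof.
move=> vuf fvu gE; apply: (@homotopic_trans _ _ (corner11 f)).
  by apply: homotopic_sym; apply: (@corner11_homotopic 1 1) => a;
    rewrite !(mulr1, mul1r).
exact: corner11_homotopic gE.
Qed.

Let scalar1 (x y : B) : x * y = 1 -> (x%:M : mx2_alg B) * y%:M = 1.
Proof. by move=> xy; rewrite -[LHS]scalar_mxM xy. Qed.

Let scalar0 (x y : B) : x * y = 0 -> (x%:M : mx2_alg B) * y%:M = 0.
Proof. by move=> xy; rewrite -[LHS]scalar_mxM xy raddf0. Qed.

Definition iso_pair_mx (p : iso_pair B) : iso_pair (mx2_alg B) :=
  IsoPair (scalar1 (iso_y1x1 p)) (scalar0 (iso_y1x2 p))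
          (scalar0 (iso_y2x1 p)) (scalar1 (iso_y2x2 p)).

Lemma corner_scalar x y b :
  (x%:M : mx2_alg B) * corner b * y%:M = corner (x * b * y).
Proof.
rewrite -[LHS]/(x%:M *m (b *: delta_mx 0 0) *m y%:M) mul_scalar_mx scalerA.
apply/matrixP => i j; rewrite mxE big_ord_recl big_ord1 !mxE.
by case: i => -[|[|//]] ?; case: j => -[|[|//]] ? /=;
  rewrite ?(mulr0, mul0r, mulr1, mul1r, addr0, add0r, mulr0n, mulr1n).
Qed.

Lemma iota2_boxplus p (f g : nhom A B) :
  iota2 (boxplus p f g) = boxplus (iso_pair_mx p) (iota2 f) (iota2 g).
Proof.
apply: nhomP => a; rewrite -[LHS]/(corner (_ + _)) -[RHS]/(_ + _).
rewrite -[iota2 f a]/(corner (f a)) -[iota2 g a]/(corner (g a)).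
by rewrite !corner_scalar /corner scalerDl.
Qed.

Lemma boxplus_M2 p (f f' g g' : nhom A B) :
  M2_homotopic f f' -> M2_homotopic g g' ->
  M2_homotopic (boxplus p f g) (boxplus p f' g').
Proof.
move=> ff' gg'; rewrite /M2_homotopic !iota2_boxplus.
apply: (homotopic_trans (boxplus_homotopicl _ _ ff')).
exact: boxplus_homotopicr.
Qed.

Variable p : iso_pair B.
Local Notation x1 := (iso_x1 p).
Local Notation x2 := (iso_x2 p).
Local Notation y1 := (iso_y1 p).
Local Notation y2 := (iso_y2 p).

Lemma iso_y1x1K b : y1 * (x1 * b) = b.
Proof. by rewrite mulrA iso_y1x1 mul1r. Qed.
Lemma iso_y1x2K b : y1 * (x2 * b) = 0.
Proof. by rewrite mulrA iso_y1x2 mul0r. Qed.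
Lemma iso_y2x1K b : y2 * (x1 * b) = 0.
Proof. by rewrite mulrA iso_y2x1 mul0r. Qed.
Lemma iso_y2x2K b : y2 * (x2 * b) = b.
Proof. by rewrite mulrA iso_y2x2 mul1r. Qed.

Definition iso_simp :=
  (mulrDl, mulrDr, =^~ mulrA, iso_y1x1K, iso_y1x2K, iso_y2x1K, iso_y2x2K,
   iso_y1x1, iso_y1x2, iso_y2x1, iso_y2x2,
   mulr0, mul0r, mulr1, mul1r, addr0, add0r).

Lemma boxplusE (f g : nhom A B) a : boxplus p f g a = x1 * f a * y1 + x2 * g a * y2.
Proof. by []. Qed.

Lemma boxplus0 (f : nhom A B) : M2_homotopic (boxplus p (nhom0 A B) f) f.
Proof.
apply: homotopic_sym; apply: (@corner_conj x2 y2) => a.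
- by rewrite iso_y2x2 mul1r.
- by rewrite iso_y2x2 mulr1.
- by rewrite boxplusE /= !iso_simp.
Qed.

Lemma boxplusC (f g : nhom A B) : M2_homotopic (boxplus p f g) (boxplus p g f).
Proof.
apply: (@corner_conj (x2 * y1 + x1 * y2) (x2 * y1 + x1 * y2)) => a;
  by rewrite !boxplusE !iso_simp // addrC.
Qed.

Lemma boxplusA (f g h : nhom A B) :
  M2_homotopic (boxplus p f (boxplus p g h)) (boxplus p (boxplus p f g) h).
Proof.
apply: (@corner_conj (x1 * x1 * y1 + x1 * x2 * y1 * y2 + x2 * y2 * y2)
                     (x1 * y1 * y1 + x2 * x1 * y2 * y1 + x2 * x2 * y2)) => a;
  by rewrite !boxplusE !iso_simp // !addrA.
Qed.

End Corner.

End HomotopyLemmas.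

Section M2Classes.
Variables (K : comNzRingType) (A : nalgType K) (B : algType K).

Definition M2_rel (f g : nhom A B) : bool := `[< M2_homotopic f g >].

Let M2_rel_refl : reflexive M2_rel.
Proof. by move=> f; apply/asboolP; exact: homotopic_refl. Qed.
Let M2_rel_sym : symmetric M2_rel.
Proof. by move=> f g; apply/asboolP/asboolP; exact: homotopic_sym. Qed.
Let M2_rel_trans : transitive M2_rel.
Proof.
move=> g f h /asboolP fg /asboolP gh; apply/asboolP; exact: homotopic_trans gh.
Qed.

Canonical M2_equiv := EquivRel M2_rel M2_rel_refl M2_rel_sym M2_rel_trans.

Definition M2_classes : Type := {eq_quot M2_rel}.
HB.instance Definition _ := Choice.on M2_classes.

Definition M2_class (f : nhom A B) : M2_classes := \pi_{eq_quot M2_rel} f.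

Definition M2_repr (x : M2_classes) : nhom A B := repr (x : {eq_quot M2_rel}).

Lemma M2_reprK x : M2_class (M2_repr x) = x.
Proof. exact: reprK. Qed.

Lemma M2_classP f g : M2_class f = M2_class g <-> M2_homotopic f g.
Proof.
split=> [/eqmodP/asboolP //|fg]; exact/eqmodP/asboolP.
Qed.

Lemma M2_class_surj x : exists f, x = M2_class f.
Proof. by exists (M2_repr x); rewrite M2_reprK. Qed.

(** The monoid structure on the set of classes induced by [boxplus p]. *)
Definition M2_monoid (p : iso_pair B) : Type := M2_classes.

Section Monoid.
Variable p : iso_pair B.
HB.instance Definition _ := Choice.on (M2_monoid p).

Definition M2_add (x y : M2_monoid p) : M2_monoid p :=
  M2_class (boxplus p (M2_repr x) (M2_repr y)).

Lemma M2_addE f g :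
  M2_add (M2_class f) (M2_class g) = M2_class (boxplus p f g).
Proof. by apply/M2_classP/boxplus_M2; apply/M2_classP; exact: M2_reprK. Qed.

Let M2_addA : associative M2_add.
Proof.
move=> x y z; have [f ->] := M2_class_surj x; have [g ->] := M2_class_surj y.
have [h ->] := M2_class_surj z; rewrite !M2_addE.
exact/M2_classP/boxplusA.
Qed.
Let M2_addC : commutative M2_add.
Proof.
move=> x y; have [f ->] := M2_class_surj x; have [g ->] := M2_class_surj y.
by rewrite !M2_addE; exact/M2_classP/boxplusC.
Qed.
Let M2_add0 : left_id (M2_class (nhom0 A B)) M2_add.
Proof.
move=> x; have [f ->] := M2_class_surj x.
by rewrite M2_addE; exact/M2_classP/boxplus0.
Qed.
HB.instance Definition _ :=
  GRing.isNmodule.Build (M2_monoid p) M2_addA M2_addC M2_add0.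

Lemma M2_classD f g : (M2_class f : M2_monoid p) + (M2_class g : M2_monoid p) =
  M2_class (boxplus p f g).
Proof. exact: M2_addE. Qed.

End Monoid.
End M2Classes.

Section GroupCompletion.
Variable M : nmodType.

(* [(a, b)] stands for the formal difference [a - b] *)
Definition gc_rel (u v : M * M) : bool :=
  `[< exists k, u.1 + v.2 + k = v.1 + u.2 + k >].

Let gc_rel_refl : reflexive gc_rel.
Proof. by move=> u; apply/asboolP; exists 0. Qed.
Let gc_rel_sym : symmetric gc_rel.
Proof. by move=> u v; apply/asboolP/asboolP => -[k h]; exists k. Qed.
Let gc_rel_trans : transitive gc_rel.
Proof.
move=> v u w /asboolP[k uv] /asboolP[l vw]; apply/asboolP.
exists (v.1 + v.2 + k + l).
have -> : u.1 + w.2 + (v.1 + v.2 + k + l) =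
    (u.1 + v.2 + k) + (v.1 + w.2 + l) by rewrite (AC (2*4) ((1*4*5)*(3*2*6))).
by rewrite uv vw (AC (3*3) ((4*2)*(1*5*3*6))).
Qed.

Canonical gc_equiv := EquivRel gc_rel gc_rel_refl gc_rel_sym gc_rel_trans.

Definition group_completion : Type := {eq_quot gc_rel}.
HB.instance Definition _ := Choice.on group_completion.

Definition gc_diff (a b : M) : group_completion := \pi_{eq_quot gc_rel} (a, b).

Definition gc_repr (x : group_completion) : M * M := repr (x : {eq_quot gc_rel}).

Lemma gc_diffP a b c d :
  gc_diff a b = gc_diff c d <-> exists k, a + d + k = c + b + k.
Proof. by split=> [/eqmodP/asboolP //|abcd]; exact/eqmodP/asboolP. Qed.

Lemma gc_reprK x : gc_diff (gc_repr x).1 (gc_repr x).2 = x.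
Proof. by rewrite /gc_diff -surjective_pairing; exact: reprK. Qed.

Lemma gc_diff_surj x : exists a b, x = gc_diff a b.
Proof. by exists (gc_repr x).1, (gc_repr x).2; rewrite gc_reprK. Qed.

Definition gc_add (x y : group_completion) : group_completion :=
  gc_diff ((gc_repr x).1 + (gc_repr y).1) ((gc_repr x).2 + (gc_repr y).2).
Definition gc_opp (x : group_completion) : group_completion :=
  gc_diff (gc_repr x).2 (gc_repr x).1.

Lemma gc_addE a b c d :
  gc_add (gc_diff a b) (gc_diff c d) = gc_diff (a + c) (b + d).
Proof.
have /gc_diffP[k hk] := gc_reprK (gc_diff a b).
have /gc_diffP[l hl] := gc_reprK (gc_diff c d).
apply/gc_diffP; exists (k + l); move: hk hl.
set u := gc_repr _; set v := gc_repr _ => hk hl.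
rewrite (AC ((2*2)*2) ((1*3*5)*(2*4*6))) /=.
by rewrite hk hl (AC (3*3) ((1*4)*(2*5)*(3*6))).
Qed.

Lemma gc_oppE a b : gc_opp (gc_diff a b) = gc_diff b a.
Proof.
have /gc_diffP[k] := gc_reprK (gc_diff a b); set u := gc_repr _ => hk.
apply/gc_diffP; exists k; rewrite [_ + a]addrC [b + _]addrC.
exact: esym hk.
Qed.

Let gc_addA : associative gc_add.
Proof.
move=> x y z; have [a [b ->]] := gc_diff_surj x.
have [c [d ->]] := gc_diff_surj y; have [e [f ->]] := gc_diff_surj z.
by rewrite !gc_addE !addrA.
Qed.
Let gc_addC : commutative gc_add.
Proof.
move=> x y; have [a [b ->]] := gc_diff_surj x.
have [c [d ->]] := gc_diff_surj y.
by rewrite !gc_addE [a + c]addrC [b + d]addrC.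
Qed.
Let gc_add0 : left_id (gc_diff 0 0) gc_add.
Proof.
by move=> x; have [a [b ->]] := gc_diff_surj x; rewrite gc_addE !add0r.
Qed.
Let gc_addN : left_inverse (gc_diff 0 0) gc_opp gc_add.
Proof.
move=> x; have [a [b ->]] := gc_diff_surj x; rewrite gc_oppE gc_addE.
by apply/gc_diffP; exists 0; rewrite !add0r !addr0 addrC.
Qed.
HB.instance Definition _ :=
  GRing.isZmodule.Build group_completion gc_addA gc_addC gc_add0 gc_addN.

End GroupCompletion.

Definition Ext (K : comNzRingType) (A : nalgType K) (R : algType K)
    (p : iso_pair (Sigma R)) : zmodType :=
  group_completion (M2_monoid A p).

Arguments Ext {K} A R p.

(* the classes of sum_n e_(2n, n), sum_n e_(2n+1, n) and of their transposes *)
Section StandardPair.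
Variables (K : comNzRingType) (R : algType K) (s t : nat -> nat).
Hypotheses (s_ge : forall n, (n <= s n)%N) (t_ge : forall n, (n <= t n)%N).
Hypotheses (sI : injective s) (tI : injective t) (st : forall m n, s m != t n).

Let shift_subproof (f : nat -> nat) : (forall n, (n <= f n)%N) ->
  rcfinite (fun i j => (i == f j)%:R : R) /\
  rcfinite (fun i j => (j == f i)%:R : R).
Proof.
move=> f_ge; split; apply/rcfiniteP; split=> i.
- exists i.+1 => j ij; rewrite ltn_eqF //; exact: leq_trans ij (f_ge j).
- by exists (f i).+1 => j ij; rewrite gtn_eqF.
- by exists (f i).+1 => j ij; rewrite gtn_eqF.
- exists i.+1 => j ij; rewrite ltn_eqF //; exact: leq_trans ij (f_ge j).
Qed.

Definition shift_mx f (f_ge : forall n, (n <= f n)%N) : Gamma R :=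
  MkGamma (proj1 (shift_subproof f_ge)).
Definition shift_tr f (f_ge : forall n, (n <= f n)%N) : Gamma R :=
  MkGamma (proj2 (shift_subproof f_ge)).

Let shiftM f g (f_ge : forall n, (n <= f n)%N) (g_ge : forall n, (n <= g n)%N)
  i j : (shift_tr f_ge * shift_mx g_ge) i j = (f i == g j)%:R.
Proof.
rewrite gmul_valE (@gmul_ord _ _ _ _ _ _ (f i).+1) => [|k fk]; last first.
  by rewrite /= gtn_eqF.
rewrite (bigD1 ord_max) //= eqxx mul1r big1 ?addr0 // => k.
by rewrite -val_eqE /= => /negPf ->; rewrite mul0r.
Qed.

Let shift1 f (f_ge : forall n, (n <= f n)%N) : injective f ->
  to_Sigma (shift_tr f_ge) * to_Sigma (shift_mx f_ge) = 1.
Proof.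
move=> fI; rewrite -[LHS]to_SigmaM; congr to_Sigma; apply: gammaP => i j.
by rewrite shiftM (inj_eq fI).
Qed.

Let shift0 f g (f_ge : forall n, (n <= f n)%N) (g_ge : forall n, (n <= g n)%N) :
  (forall m n, f m != g n) -> to_Sigma (shift_tr f_ge) * to_Sigma (shift_mx g_ge) = 0.
Proof.
move=> fg; rewrite -[LHS]to_SigmaM; transitivity (to_Sigma (0 : Gamma R)).
  by congr to_Sigma; apply: gammaP => i j; rewrite shiftM (negPf (fg i j)).
by rewrite -[LHS]/(\pi_{ideal_quot (@Minfty K R)} 0) piE.
Qed.

Let ts m n : t m != s n. Proof. by rewrite eq_sym st. Qed.

Definition shift_pair : iso_pair (Sigma R) :=
  IsoPair (shift1 s_ge sI) (shift0 s_ge t_ge st)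
          (shift0 t_ge s_ge ts) (shift1 t_ge tI).

End StandardPair.

Section StandardPair2.
Let ge0 n : (n <= n.*2)%N. Proof. by rewrite -addnn leq_addr. Qed.
Let ge1 n : (n <= n.*2.+1)%N. Proof. exact: leqW. Qed.
Let inj0 : injective double. Proof. exact: double_inj. Qed.
Let inj1 : injective (fun n => n.*2.+1).
Proof. by move=> m n [] /double_inj. Qed.
Let even_odd m n : m.*2 != n.*2.+1.
Proof. by apply/eqP => /(congr1 odd); rewrite /= !odd_double. Qed.

Definition std_iso_pair (K : comNzRingType) (R : algType K) :
  iso_pair (Sigma R) := shift_pair R ge0 ge1 inj0 inj1 even_odd.

End StandardPair2.

Record digraph := DiGraph {
  vtx : finType;
  edg : finType;
  src : edg -> vtx;
  rng : edg -> vtx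
}.

Definition is_reg (E : digraph) (v : vtx E) : bool := [exists e, src e == v].

Section Leavitt.
Variables (K : comNzRingType) (E : digraph).

(** [L(E)] is the quotient of the terms in the generators by the smallest
    congruence containing the axioms of (non-unital) [K]-algebras and the
    defining relations. *)
Inductive lterm :=
  | LVtx of vtx E
  | LEdge of edg E
  | LGhost of edg E
  | LZero
  | LAdd of lterm & lterm
  | LScale of K & lterm
  | LMul of lterm & lterm.

Definition lsum_out (v : vtx E) : lterm :=
  foldr LAdd LZero [seq LMul (LEdge e) (LGhost e) | e <- enum (edg E) & src e == v].

Inductive lpa_eq : lterm -> lterm -> Prop :=
  | lpa_refl t : lpa_eq t t
  | lpa_sym t u : lpa_eq t u -> lpa_eq u t
  | lpa_trans t u w : lpa_eq t u -> lpa_eq u w -> lpa_eq t w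
  | lpa_add t t' u u' : lpa_eq t t' -> lpa_eq u u' -> lpa_eq (LAdd t u) (LAdd t' u')
  | lpa_scale c t t' : lpa_eq t t' -> lpa_eq (LScale c t) (LScale c t')
  | lpa_mul t t' u u' : lpa_eq t t' -> lpa_eq u u' -> lpa_eq (LMul t u) (LMul t' u')
  | lpa_addA t u w : lpa_eq (LAdd t (LAdd u w)) (LAdd (LAdd t u) w)
  | lpa_addC t u : lpa_eq (LAdd t u) (LAdd u t)
  | lpa_add0 t : lpa_eq (LAdd LZero t) t
  | lpa_addN t : lpa_eq (LAdd (LScale (-1) t) t) LZero
  | lpa_scaleA c d t : lpa_eq (LScale c (LScale d t)) (LScale (c * d) t)
  | lpa_scale1 t : lpa_eq (LScale 1 t) t
  | lpa_scaleDr c t u : lpa_eq (LScale c (LAdd t u)) (LAdd (LScale c t) (LScale c u))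
  | lpa_scaleDl c d t : lpa_eq (LScale (c + d) t) (LAdd (LScale c t) (LScale d t))
  | lpa_mulA t u w : lpa_eq (LMul t (LMul u w)) (LMul (LMul t u) w)
  | lpa_mulDl t u w : lpa_eq (LMul (LAdd t u) w) (LAdd (LMul t w) (LMul u w))
  | lpa_mulDr t u w : lpa_eq (LMul t (LAdd u w)) (LAdd (LMul t u) (LMul t w))
  | lpa_scaleAl c t u : lpa_eq (LScale c (LMul t u)) (LMul (LScale c t) u)
  | lpa_scaleAr c t u : lpa_eq (LScale c (LMul t u)) (LMul t (LScale c u))
  | lpa_vv v w :
      lpa_eq (LMul (LVtx v) (LVtx w)) (if v == w then LVtx v else LZero)
  | lpa_se e : lpa_eq (LMul (LVtx (src e)) (LEdge e)) (LEdge e)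
  | lpa_er e : lpa_eq (LMul (LEdge e) (LVtx (rng e))) (LEdge e)
  | lpa_rg e : lpa_eq (LMul (LVtx (rng e)) (LGhost e)) (LGhost e)
  | lpa_gs e : lpa_eq (LMul (LGhost e) (LVtx (src e))) (LGhost e)
  | lpa_ge e f :
      lpa_eq (LMul (LGhost e) (LEdge f)) (if e == f then LVtx (rng e) else LZero)
  | lpa_ck2 v : is_reg v -> lpa_eq (LVtx v) (lsum_out v).

HB.instance Definition _ := gen_eqMixin lterm.
HB.instance Definition _ := gen_choiceMixin lterm.

Definition lpa_eqb (t u : lterm) : bool := `[< lpa_eq t u >].

Let lpa_eqb_refl : reflexive lpa_eqb.
Proof. by move=> t; apply/asboolP; exact: lpa_refl. Qed.
Let lpa_eqb_sym : symmetric lpa_eqb.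
Proof. by move=> t u; apply/asboolP/asboolP; exact: lpa_sym. Qed.
Let lpa_eqb_trans : transitive lpa_eqb.
Proof.
by move=> u t w /asboolP tu /asboolP uw; apply/asboolP; exact: lpa_trans uw.
Qed.

Canonical lpa_equiv := EquivRel lpa_eqb lpa_eqb_refl lpa_eqb_sym lpa_eqb_trans.

Definition leavitt : Type := {eq_quot lpa_eqb}.
HB.instance Definition _ := Choice.on leavitt.

Definition to_leavitt (t : lterm) : leavitt := \pi_{eq_quot lpa_eqb} t.

Definition lrepr (x : leavitt) : lterm := repr (x : {eq_quot lpa_eqb}).

Lemma lreprK x : to_leavitt (lrepr x) = x.
Proof. exact: reprK. Qed.

Lemma to_leavittP t u : to_leavitt t = to_leavitt u <-> lpa_eq t u.
Proof. by split=> [/eqmodP/asboolP //|tu]; exact/eqmodP/asboolP. Qed.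

Lemma lpa_repr t : lpa_eq (lrepr (to_leavitt t)) t.
Proof. by apply/to_leavittP; rewrite lreprK. Qed.

Lemma to_leavitt_surj x : exists t, x = to_leavitt t.
Proof. by exists (lrepr x); rewrite lreprK. Qed.

Definition ladd (x y : leavitt) := to_leavitt (LAdd (lrepr x) (lrepr y)).
Definition lmul (x y : leavitt) := to_leavitt (LMul (lrepr x) (lrepr y)).
Definition lscale c (x : leavitt) := to_leavitt (LScale c (lrepr x)).

Lemma laddE t u : ladd (to_leavitt t) (to_leavitt u) = to_leavitt (LAdd t u).
Proof. by apply/to_leavittP/lpa_add; exact: lpa_repr. Qed.
Lemma lmulE t u : lmul (to_leavitt t) (to_leavitt u) = to_leavitt (LMul t u).
Proof. by apply/to_leavittP/lpa_mul; exact: lpa_repr. Qed.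
Lemma lscaleE c t : lscale c (to_leavitt t) = to_leavitt (LScale c t).
Proof. by apply/to_leavittP/lpa_scale; exact: lpa_repr. Qed.

Local Ltac lift x := have [? ->] := to_leavitt_surj x.
Local Ltac lconstr :=
  rewrite ?(laddE, lmulE, lscaleE); apply/to_leavittP; constructor.

Let laddA : associative ladd.
Proof. by move=> x y z; lift x; lift y; lift z; lconstr. Qed.
Let laddC : commutative ladd.
Proof. by move=> x y; lift x; lift y; lconstr. Qed.
Let ladd0 : left_id (to_leavitt LZero) ladd.
Proof. by move=> x; lift x; lconstr. Qed.
Let laddN : left_inverse (to_leavitt LZero) (lscale (-1)) ladd.
Proof. by move=> x; lift x; lconstr. Qed.
HB.instance Definition _ := GRing.isZmodule.Build leavitt laddA laddC ladd0 laddN.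

Let lscaleA c d x : lscale c (lscale d x) = lscale (c * d) x.
Proof. by lift x; lconstr. Qed.
Let lscale1 : left_id 1 lscale.
Proof. by move=> x; lift x; lconstr. Qed.
Let lscaleDr : right_distributive lscale ladd.
Proof. by move=> c x y; lift x; lift y; lconstr. Qed.
Let lscaleDl x : {morph lscale^~ x : c d / c + d >-> ladd c d}.
Proof. by move=> c d; lift x; lconstr. Qed.
HB.instance Definition _ :=
  GRing.Zmodule_isLmodule.Build K leavitt lscaleA lscale1 lscaleDr lscaleDl.

Let lmulA : associative lmul.
Proof. by move=> x y z; lift x; lift y; lift z; lconstr. Qed.
Let lmulDl : left_distributive lmul ladd.
Proof. by move=> x y z; lift x; lift y; lift z; lconstr. Qed.
Let lmulDr : right_distributive lmul ladd.
Proof. by move=> x y z; lift x; lift y; lift z; lconstr. Qed.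
Let lscaleAl c x y : lscale c (lmul x y) = lmul (lscale c x) y.
Proof. by lift x; lift y; lconstr. Qed.
Let lscaleAr c x y : lscale c (lmul x y) = lmul x (lscale c y).
Proof. by lift x; lift y; lconstr. Qed.
HB.instance Definition _ :=
  Lmodule_isNalgebra.Build K leavitt lmulA lmulDl lmulDr lscaleAl lscaleAr.

End Leavitt.

Section Coker.
Variable E : digraph.

Definition reg_vtx : finType := {v : vtx E | is_reg v}.

Definition incidence (v : reg_vtx) (w : vtx E) : int :=
  #|[set e : edg E | (src e == val v) && (rng e == w)]|%:Z.

Definition identity_reg (v : reg_vtx) (w : vtx E) : int := (val v == w)%:R.

Definition I_minus_A (x : {ffun vtx E -> int}) : {ffun reg_vtx -> int} :=
  [ffun v => \sum_(w : vtx E) (identity_reg v w - incidence v w) * x w].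

Definition im_I_minus_A : {pred {ffun reg_vtx -> int}} :=
  fun y => `[< exists x, y = I_minus_A x >].

Lemma im_zmod : zmod_closed im_I_minus_A.
Proof.
split; first apply/asboolP.
  by exists 0; apply/ffunP => v; rewrite !ffunE big1 // => w; rewrite ffunE mulr0.
move=> _ _ /asboolP[x ->] /asboolP[y ->]; apply/asboolP; exists (x - y).
apply/ffunP => v; rewrite !ffunE -sumrB; apply: eq_bigr => w _.
by rewrite !ffunE mulrBr.
Qed.

HB.instance Definition _ := GRing.isZmodClosed.Build _ im_I_minus_A im_zmod.

Definition Coker : zmodType := Quotient.quot im_I_minus_A.

End Coker.

(* Main.v *)
From HB Require Import structures.
From Stdlib Require Import Relations.
Require Import Defs.
From mathcomp Require Import all_boot all_order all_algebra.
From mathcomp Require Import boolp classical_sets functions cardinality fsbigop.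
From mathcomp Require Import ring zify.

Set Implicit Arguments.
Unset Strict Implicit.
Unset Printing Implicit Defensive.

Import GRing.Theory.
Local Open Scope ring_scope.

(** After adding a fixed standard homomorphism, any f : L(E) -> Sigma has all its
    vertex idempotents equivalent to 1, say f(v) = t_v s_v with s_v t_v = 1.  Then for
    v regular, c_v = sum_(s(e) = v) s_v f(e) t_(r e) z_e^* is a unit of Sigma, where
    the z_e are fixed isometries with sum_(s(e) = v) z_e z_e^* = 1.  Its index is an
    integer, and another choice of (s, t) changes the vector of indices by (I - A)x,
    which gives a class in the cokernel.

    The index of a unit u is read off a determinant: if W in GL(Gamma) lifts
    diag(u, u^-1, 1), the commutator of W with diag(lam, 1, 1) is a finite
    perturbation of 1, of determinant lam^(ind u).  For a polynomial loop of units,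
    this determinant is a unit of F[t], F = ell(lam), hence constant; since moreover
    the idempotents of Sigma(ell[t]) lift to Gamma(ell[t]) and are absorbed by 1
    (Eilenberg swindle), the class is a homotopy invariant.

    Conversely, if two homomorphisms have the same class, then after conjugation they
    agree on vertices and differ on edges by units of index 0.  These lift to
    GL(Gamma), where they are stably elementary by another swindle, hence
    polynomially homotopic to 1, so that the two homomorphisms are stably homotopic.
    Surjectivity holds because units of every index exist. *)

(** The index is carried by powers of a variable because a trace over a field of characteristic p
    would see it only modulo p, and because the multiplicativity of a commutator determinant is a
    formal identity.

    A homotopy is a polynomial over Sigma(ell), while idempotents are lifted and absorbed over
    Sigma(ell[t]); the ring map sending t to the scalar t joins the two. M_2-homotopies return to
    Sigma through the isomorphism of M_2 Sigma with Sigma given by two isometries whose ranges add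
    up to 1. Such complete systems of isometries turn every matrix argument (Whitehead, swindles)
    into an identity in a single ring. The pair defining the sum of homomorphisms need not be
    complete, so two pairs occur side by side.

    A unit of index 0 lifts, and becomes elementary, only after being extended by 1 on a
    complementary corner. The standard homomorphism provides this room, so it is added twice when
    two homomorphisms are compared: once to trivialize the vertices, once to deform the edges. The
    group completion cancels both copies. *)

Notation Gam R := (@Gamma R R^o).
Notation Sig R := (@Sigma R R^o).

(** * Infinite matrices *)

Section Entries.
Variable R : comNzRingType.
Implicit Types (a b : Gam R).

Lemma gam_mul_ord a b i j N : (forall k, (N <= k)%N -> a i k * b k j = 0) ->
  (a * b) i j = \sum_(k < N) a i k * b k j.
Proof. exact: fsum_ord. Qed.

Lemma gam_mul1 a b i j m : (forall k, k != m -> a i k * b k j = 0) ->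
  (a * b) i j = a i m * b m j.
Proof.
move=> ab0; rewrite (@gam_mul_ord a b i j m.+1) => [|k mk]; last first.
  by apply: ab0; rewrite gtn_eqF.
by rewrite big_ord_recr big1 /= ?add0r // => k _; apply: ab0; rewrite ltn_eqF.
Qed.

Lemma gam_mul0 a b i j : (forall k, a i k * b k j = 0) -> (a * b) i j = 0.
Proof.
by move=> ab0; rewrite (@gam_mul_ord a b i j 0) ?big_ord0 // => k _; exact: ab0.
Qed.

Lemma gam1E i j : (1 : Gam R) i j = (i == j)%:R.
Proof. by []. Qed.

Lemma gamBE a b i j : (a - b) i j = a i j - b i j.
Proof. by []. Qed.

Lemma gam_sumE (I : Type) (r : seq I) (P : pred I) (F : I -> Gam R) i j :
  (\sum_(k <- r | P k) F k) i j = \sum_(k <- r | P k) F k i j.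
Proof. by apply: (big_morph (fun a : Gam R => a i j)). Qed.

Lemma fan_subproof k (i : 'I_k.+1) :
  rcfinite (fun r c => (r == k.+1 * c + i)%N%:R : R^o).
Proof.
apply/rcfiniteP; split=> m.
- exists m.+1 => c mc; rewrite ltn_eqF // (leq_trans mc) //.
  by rewrite mulSn -addnA leq_addr.
- by exists (k.+1 * m + i).+1 => r rm; rewrite gtn_eqF.
Qed.

(** The isometry sending the basis vector c to (k+1)c + i. With the [fan_tr] as adjoints, these k+1
    isometries identify Gamma with its own matrices of size k+1; indexing by [k.+1] keeps the
    modulus positive. *)
Definition fan k (i : 'I_k.+1) : Gam R := MkGamma (fan_subproof i).

Lemma fan_tr_subproof k (i : 'I_k.+1) :
  rcfinite (fun r c => (c == k.+1 * r + i)%N%:R : R^o).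
Proof. by have /rcfiniteP[h h'] := fan_subproof i; apply/rcfiniteP. Qed.

Definition fan_tr k (i : 'I_k.+1) : Gam R := MkGamma (fan_tr_subproof i).

Lemma eq_fan_idx k (i j : 'I_k.+1) m n :
  (k.+1 * m + i == k.+1 * n + j)%N = (m == n) && (i == j).
Proof.
apply/eqP/andP => [h|[/eqP -> /eqP -> //]].
have := congr1 (modn^~ k.+1) h; rewrite ![(k.+1 * _)%N]mulnC /= !modnMDl !modn_small //.
have := congr1 (divn^~ k.+1) h; rewrite ![(k.+1 * _)%N]mulnC /= !divnMDl //.
by rewrite !divn_small // !addn0 => -> /val_inj ->.
Qed.

Lemma fan_trK k (i j : 'I_k.+1) : fan_tr i * fan j = (i == j)%:R.
Proof.
apply: gammaP => m n; rewrite (@gam_mul1 _ _ m n (k.+1 * m + i)) => [|r]; last first.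
  by move=> /negPf rE; rewrite /= rE mul0r.
rewrite /= eqxx mul1r eq_fan_idx.
by case: (i == j); rewrite ?andbT ?andbF.
Qed.

Lemma fan_projE k (i : 'I_k.+1) m n :
  (fan i * fan_tr i) m n = ((m == n) && (m %% k.+1 == i)%N)%:R.
Proof.
have mE : m = (k.+1 * (m %/ k.+1) + Ordinal (ltn_pmod m (ltn0Sn k)))%N.
  by rewrite mulnC -divn_eq.
rewrite (@gam_mul1 _ _ m n (m %/ k.+1)%N) => [|r rm] /=; last first.
  by rewrite {1}mE eq_fan_idx eq_sym (negPf rm) mul0r.
rewrite {1}mE eq_fan_idx eqxx /= -val_eqE /=; have [iE|_] := eqVneq; last first.
  by rewrite andbF mul0r.
by rewrite -iE mulnC -divn_eq andbT mul1r eq_sym.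
Qed.

Lemma fan_sum k : \sum_(i < k.+1) fan i * fan_tr i = 1.
Proof.
apply: gammaP => m n; rewrite gam_sumE gam1E.
rewrite (bigD1 (Ordinal (ltn_pmod m (ltn0Sn k)))) // big1 => [|i ik]; last first.
  by rewrite fan_projE eq_sym -[(m %% _)%N]/(val (Ordinal (ltn_pmod m (ltn0Sn k))))
    val_eqE eq_sym [_ == i]eq_sym (negPf ik) andbF.
by rewrite fan_projE eqxx andbT /= addr0.
Qed.

End Entries.

(** * Functoriality of Gamma and Sigma in the coefficients *)

Section MapGamma.
Variables (R R' : comNzRingType) (f : {rmorphism R -> R'}).

Lemma map_gamma_subproof (a : Gam R) : rcfinite (fun i j => f (a i j) : R'^o).
Proof.
apply/rcfiniteP; split=> i.
- by have [N aN] := gamma_row a i; exists N => j /aN ->; rewrite rmorph0.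
- by have [N aN] := gamma_col a i; exists N => j /aN ->; rewrite rmorph0.
Qed.

Definition map_gamma (a : Gam R) : Gam R' := MkGamma (map_gamma_subproof a).

Lemma map_gamma_is_zmod_morphism : zmod_morphism map_gamma.
Proof. by move=> a b; apply: gammaP => i j; rewrite !gamBE -rmorphB. Qed.

Lemma map_gamma_is_monoid_morphism : monoid_morphism map_gamma.
Proof.
split=> [|a b]; first by apply: gammaP => i j; rewrite /= rmorph_nat.
apply: gammaP => i j; have [N aN] := gamma_row a i.
rewrite [RHS](@gam_mul_ord _ _ _ _ _ N) => [|k /aN /= ->]; last first.
  by rewrite rmorph0 mul0r.
rewrite -[LHS]/(f ((a * b) i j)) (@gam_mul_ord _ _ _ _ _ N) => [|k /aN ->]; last first.
  by rewrite mul0r.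
by rewrite rmorph_sum; apply: eq_bigr => k _; rewrite -rmorphM.
Qed.

HB.instance Definition _ := GRing.isZmodMorphism.Build (Gam R) (Gam R') map_gamma
  map_gamma_is_zmod_morphism.
HB.instance Definition _ := GRing.isMonoidMorphism.Build (Gam R) (Gam R') map_gamma
  map_gamma_is_monoid_morphism.

Lemma map_gammaM a b : map_gamma (a * b) = map_gamma a * map_gamma b.
Proof. exact: rmorphM. Qed.
Lemma map_gammaD a b : map_gamma (a + b) = map_gamma a + map_gamma b.
Proof. exact: rmorphD. Qed.
Lemma map_gammaB a b : map_gamma (a - b) = map_gamma a - map_gamma b.
Proof. exact: rmorphB. Qed.
Lemma map_gamma1 : map_gamma 1 = 1. Proof. exact: rmorph1. Qed.
Lemma map_gammaZ c a : map_gamma (c *: a) = f c *: map_gamma a.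
Proof. by apply: gammaP => i j /=; rewrite rmorphM. Qed.

Lemma map_gamma_Minfty a : a \in @Minfty R R^o -> map_gamma a \in @Minfty R' R'^o.
Proof.
move=> /MinftyP[N aN]; apply/MinftyP; exists N => i j /aN /= ->.
by rewrite rmorph0.
Qed.

Lemma map_gamma_fan k (i : 'I_k.+1) : map_gamma (fan R i) = fan R' i.
Proof. by apply: gammaP => r c /=; rewrite rmorph_nat. Qed.

Lemma map_gamma_fan_tr k (i : 'I_k.+1) : map_gamma (fan_tr R i) = fan_tr R' i.
Proof. by apply: gammaP => r c /=; rewrite rmorph_nat. Qed.

End MapGamma.

Section ToSigma.
Variable R : comNzRingType.

Definition sig : Gam R -> Sig R := @to_Sigma R R^o.

Lemma sig_is_zmod_morphism : zmod_morphism sig.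
Proof.
move=> a b; apply: (addIr (sig b)).
by rewrite subrK /sig -to_SigmaD subrK.
Qed.
HB.instance Definition _ := GRing.isZmodMorphism.Build (Gam R) (Sig R) sig
  sig_is_zmod_morphism.

Lemma sig_is_monoid_morphism : monoid_morphism sig.
Proof. by split=> [//|a b]; rewrite /sig to_SigmaM. Qed.
HB.instance Definition _ := GRing.isMonoidMorphism.Build (Gam R) (Sig R) sig
  sig_is_monoid_morphism.

HB.instance Definition _ := GRing.isScalable.Build R (Gam R) (Sig R) *:%R (@sig)
  (fun c a => to_SigmaZ c a).

Lemma sigM a b : sig (a * b) = sig a * sig b. Proof. exact: rmorphM. Qed.
Lemma sigD a b : sig (a + b) = sig a + sig b. Proof. exact: rmorphD. Qed.
Lemma sigB a b : sig (a - b) = sig a - sig b. Proof. exact: rmorphB. Qed.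
Lemma sig1 : sig 1 = 1. Proof. exact: rmorph1. Qed.
Lemma sig0 : sig 0 = 0. Proof. exact: rmorph0. Qed.

Lemma sigP a b : sig a = sig b <-> a - b \in @Minfty R R^o.
Proof. exact: to_SigmaP. Qed.

Lemma sig_surj x : exists a, sig a = x.
Proof. by have [a ->] := to_Sigma_surj x; exists a. Qed.

Lemma sigZ (c : R) a : sig (c *: a) = c *: sig a.
Proof. exact: to_SigmaZ. Qed.

Lemma sig_eq0 a : sig a = 0 <-> a \in @Minfty R R^o.
Proof. by rewrite -[0](rmorph0 sig) sigP subr0. Qed.

End ToSigma.

Section MapSigma.
Variables (R R' : comNzRingType) (f : {rmorphism R -> R'}).

Definition map_sigma (x : Sig R) : Sig R' := sig (map_gamma f (sigma_repr x)).

Lemma map_sigmaE a : map_sigma (sig a) = sig (map_gamma f a).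
Proof.
apply/sigP; rewrite -rmorphB; apply: map_gamma_Minfty; apply/sigP.
exact: sigma_reprK.
Qed.

Lemma map_sigma_is_zmod_morphism : zmod_morphism map_sigma.
Proof.
move=> x y; have [a <-] := sig_surj x; have [b <-] := sig_surj y.
by rewrite -rmorphB !map_sigmaE !rmorphB.
Qed.
Lemma map_sigma_is_monoid_morphism : monoid_morphism map_sigma.
Proof.
split=> [|x y]; first by rewrite -(rmorph1 (@sig R)) map_sigmaE !rmorph1.
have [a <-] := sig_surj x; have [b <-] := sig_surj y.
by rewrite -rmorphM !map_sigmaE !rmorphM.
Qed.
HB.instance Definition _ := GRing.isZmodMorphism.Build (Sig R) (Sig R') map_sigma
  map_sigma_is_zmod_morphism.
HB.instance Definition _ := GRing.isMonoidMorphism.Build (Sig R) (Sig R') map_sigma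
  map_sigma_is_monoid_morphism.

Lemma map_sigmaM x y : map_sigma (x * y) = map_sigma x * map_sigma y.
Proof. exact: rmorphM. Qed.

End MapSigma.

Definition inverses (B : nzRingType) (u u' : B) := u * u' = 1 /\ u' * u = 1.

Lemma inverses_sym (B : nzRingType) (u u' : B) : inverses u u' -> inverses u' u.
Proof. by case. Qed.

Lemma inverses1 (B : nzRingType) : inverses (1 : B) 1.
Proof. by split; rewrite mulr1. Qed.

Lemma inversesM (B : nzRingType) (u u' v v' : B) :
  inverses u u' -> inverses v v' -> inverses (u * v) (v' * u').
Proof.
move=> [uu' u'u] [vv' v'v]; split.
  by rewrite -mulrA [v * (_ * _)]mulrA vv' mul1r.
by rewrite -mulrA [u' * (_ * _)]mulrA u'u mul1r.
Qed.

Lemma inverses_map (B C : nzRingType) (f : {rmorphism B -> C}) (u u' : B) :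
  inverses u u' -> inverses (f u) (f u').
Proof. by case=> uu' u'u; split; rewrite -rmorphM ?uu' ?u'u rmorph1. Qed.

Lemma inverses_unique (B : nzRingType) (u v w : B) :
  inverses u v -> inverses u w -> v = w.
Proof. by move=> [_ vu] [uw _]; rewrite -[v]mulr1 -uw mulrA vu mul1r. Qed.

(** Multiplying [X] by the same unipotent block matrix on the right and on the left clears its upper
    right block; the two block triangular results have the same determinant. *)
Lemma det_1M_comm (R : comPzRingType) m n (A : 'M[R]_(m, n)) (B : 'M[R]_(n, m)) :
  \det (1%:M + A *m B) = \det (1%:M + B *m A).
Proof.
pose X := block_mx 1%:M (- A) B 1%:M.
have XL : X *m block_mx 1%:M A 0 1%:M = block_mx 1%:M 0 B (1%:M + B *m A).
  rewrite /X mulmx_block !mul1mx !mulmx1 !mulmx0 !addr0 subrr.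
  by rewrite [B *m A + _]addrC.
have XR : block_mx 1%:M A 0 1%:M *m X = block_mx (1%:M + A *m B) 0 B 1%:M.
  rewrite /X mulmx_block !mul1mx !mulmx1 !mul0mx !add0r.
  by rewrite addNr.
have := congr1 determinant XL; have := congr1 determinant XR.
by rewrite !det_mulmx !det_ublock !det_lblock !det1 !mul1r !mulr1 => -> ->.
Qed.

(** * Determinants of finite perturbations of the identity *)

Section FiniteDet.
Variable R : comNzRingType.
Implicit Types k g h a : Gam R.

Definition corner_mx (N : nat) k : 'M[R]_N := \matrix_(i, j) k i j.

Definition fin_pert N k := forall i j, (N <= i)%N || (N <= j)%N -> k i j = (i == j)%:R.

Lemma fin_pertP k : (exists N, fin_pert N k) <-> sig k = 1.
Proof.
rewrite -(rmorph1 (@sig R)) sigP; split=> [[N kN]|/MinftyP[N kN]].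
  by apply/MinftyP; exists N => i j /kN; rewrite gamBE => ->; rewrite subrr.
by exists N => i j /kN; rewrite gamBE => /eqP; rewrite subr_eq0 => /eqP.
Qed.

Lemma fin_pertW M N k : (N <= M)%N -> fin_pert N k -> fin_pert M k.
Proof.
move=> NM kN i j /orP[] h; apply: kN; first by rewrite (leq_trans NM h).
by rewrite (leq_trans NM h) orbT.
Qed.

Lemma fin_pert_det M N k : fin_pert N k -> (N <= M)%N ->
  \det (corner_mx M k) = \det (corner_mx N k).
Proof.
move=> kN; elim: M => [|M IH]; first by case: (N) kN => // ? _.
rewrite leq_eqVlt => /orP[/eqP -> //|]; rewrite ltnS => NM; rewrite -IH //.
rewrite (expand_det_row _ ord_max) (bigD1 ord_max) //= big1 => [|j jM]; last first.
  by rewrite mxE /= kN ?NM // eq_sym -[M]/(val (@ord_max M)) val_eqE (negPf jM) mul0r.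
rewrite mxE /= kN ?NM // eqxx mul1r addr0 /cofactor /= addnn -mul2n exprM.
rewrite sqrrN expr1n expr1n mul1r; congr (\det _).
by apply/matrixP => i j; rewrite !mxE !lift_max.
Qed.

(** All corners outside which [k] is the identity give the same determinant, by [fin_pert_det]; 0 is
    a dummy value for the other matrices. *)
Definition fdet k : R :=
  if pselect (exists N, fin_pert N k) is left ex then \det (corner_mx (projT1 (cid ex)) k)
  else 0.

Lemma fdetE N k : fin_pert N k -> fdet k = \det (corner_mx N k).
Proof.
move=> kN; rewrite /fdet; case: pselect => [ex|[]]; last by exists N.
case: cid => M kM /=.
by rewrite -(fin_pert_det kM (leq_maxl M N)) -(fin_pert_det kN (leq_maxr M N)).
Qed.

Lemma fin_pertM N k k' : fin_pert N k -> fin_pert N k' ->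
  fin_pert N (k * k') /\ corner_mx N (k * k') = corner_mx N k *m corner_mx N k'.
Proof.
move=> kN kN'; split=> [i j /orP[Ni|Nj]|].
- rewrite (@gam_mul1 _ _ _ i j i) => [|r ri]; last first.
    by rewrite kN ?Ni // eq_sym (negPf ri) mul0r.
  by rewrite kN ?Ni // eqxx mul1r kN' ?Ni.
- rewrite (@gam_mul1 _ _ _ i j j) => [|r rj]; last first.
    by rewrite kN' ?Nj ?orbT // (negPf rj) mulr0.
  by rewrite kN' ?Nj ?orbT // eqxx mulr1 kN ?Nj ?orbT.
apply/matrixP => i j; rewrite !mxE (@gam_mul_ord _ _ _ _ _ N) => [|r Nr].
  by apply: eq_bigr => r _; rewrite !mxE.
by rewrite kN ?Nr ?orbT // ltn_eqF ?mul0r // (leq_trans (ltn_ord i)).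
Qed.

Lemma fdetM k k' : sig k = 1 -> sig k' = 1 -> fdet (k * k') = fdet k * fdet k'.
Proof.
move=> /fin_pertP[M kM] /fin_pertP[N kN].
have {}kM := fin_pertW (leq_maxl M N) kM.
have {}kN := fin_pertW (leq_maxr M N) kN.
have [kk kkE] := fin_pertM kM kN.
by rewrite (fdetE kk) (fdetE kM) (fdetE kN) kkE det_mulmx.
Qed.

Lemma fdet1 : fdet 1 = 1.
Proof.
rewrite (@fdetE 0) ?det_mx00 // => i j _.
Qed.

Lemma gam_mul_ord2 g k h i j N : (forall r s, (N <= r)%N || (N <= s)%N -> k r s = 0) ->
  (g * k * h) i j = \sum_(s < N) (\sum_(r < N) g i r * k r s) * h s j.
Proof.
move=> kN; rewrite (@gam_mul_ord _ _ _ _ _ N) => [|s Ns]; last first.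
  by rewrite gam_mul0 ?mul0r // => r; rewrite kN ?Ns ?orbT ?mulr0.
apply: eq_bigr => s _; congr (_ * _); apply: gam_mul_ord => r Nr.
by rewrite kN ?Nr ?mulr0.
Qed.

(* On a block large enough to see the first N columns of [g] and the first N
   rows of [h], [g k h] is [1 + A X B] where [B A = 1], so that the
   Weinstein-Aronszajn identity applies. *)
Lemma fdetJ g h k : inverses g h -> sig k = 1 -> fdet (g * k * h) = fdet k.
Proof.
move=> [gh hg] /fin_pertP[N kN].
have [M1 gM] := bound_upto N (gamma_col g); have [M2 hM] := bound_upto N (gamma_row h).
pose M := maxn N (maxn M1 M2).
have xN r s : (N <= r)%N || (N <= s)%N -> (k - 1) r s = 0.
  by move=> rs; rewrite gamBE gam1E kN // subrr.
have kE : g * k * h = 1 + g * (k - 1) * h.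
  by rewrite mulrBr mulr1 mulrBl gh addrC subrK.
have gkh i j : (g * k * h) i j = (i == j)%:R +
    \sum_(s < N) (\sum_(r < N) g i r * (k - 1) r s) * h s j.
  by rewrite kE gaddE gam1E (gam_mul_ord2 _ _ _ _ xN).
have pM : fin_pert M (g * k * h).
  move=> i j /orP[]; rewrite geq_max => /andP[_]; rewrite geq_max => /andP[Mi Mj];
    rewrite gkh big1 ?addr0 // => s _; last by rewrite (hM s) ?mulr0.
  by rewrite big1 ?mul0r // => r _; rewrite gM ?mul0r.
rewrite (fdetE pM) (fdetE kN).
pose A : 'M[R]_(M, N) := \matrix_(i, j) g i j.
pose B : 'M[R]_(N, M) := \matrix_(i, j) h i j.
pose X : 'M[R]_N := corner_mx N (k - 1).
have -> : corner_mx M (g * k * h) = 1%:M + A *m X *m B.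
  apply/matrixP => i j; rewrite !mxE gkh; congr (_ + _); apply: eq_bigr => s _.
  by rewrite !mxE; congr (_ * _); apply: eq_bigr => r _; rewrite !mxE.
have BA : B *m A = 1%:M.
  apply/matrixP => i j; rewrite !mxE; transitivity ((h * g) i j); last by rewrite hg.
  rewrite (@gam_mul_ord _ _ _ _ _ M) => [|r Mr]; first by apply: eq_bigr => r _; rewrite !mxE.
  by rewrite (hM i) ?mul0r // (leq_trans _ Mr) // /M leq_max leq_maxr orbT.
rewrite -mulmxA det_1M_comm -mulmxA BA mulmx1; congr (\det _).
by apply/matrixP => i j; rewrite !mxE gamBE gam1E addrC subrK.
Qed.

End FiniteDet.

Lemma map_fdet (R R' : comNzRingType) (f : {rmorphism R -> R'}) k :
  sig k = 1 -> fdet (map_gamma f k) = f (fdet k).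
Proof.
move=> /fin_pertP[N kN]; have kN' : fin_pert N (map_gamma f k).
  by move=> i j /kN /= ->; rewrite rmorph_nat.
rewrite (fdetE kN) (fdetE kN') -det_map_mx; congr (\det _).
by apply/matrixP => i j; rewrite !mxE.
Qed.

(** * The index as a commutator determinant *)

Section Blocks.
Variables (B : nzRingType) (n : nat).
Implicit Types z w : 'I_n -> B.

Definition is_fan z w :=
  (forall i j, w i * z j = (i == j)%:R) /\ \sum_i z i * w i = 1.

(** The ring isomorphism from matrices over [B] to [B] attached to a fan; its inverse reads off the
    entries, see [blk_corner]. *)
Definition blk z w (M : 'M[B]_n) : B := \sum_i z i * \sum_j M i j * w j.

Lemma fan_pickl z w (r : 'I_n -> B) i : is_fan z w -> w i * (\sum_j z j * r j) = r i.
Proof.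
case=> wz _; rewrite mulr_sumr (bigD1 i) //= mulrA wz eqxx mul1r.
by rewrite big1 ?addr0 // => j ji; rewrite mulrA wz eq_sym (negPf ji) mul0r.
Qed.

Lemma fan_pickr z w (r : 'I_n -> B) j : is_fan z w -> (\sum_i r i * w i) * z j = r j.
Proof.
case=> wz _; rewrite mulr_suml (bigD1 j) //= -mulrA wz eqxx mulr1.
by rewrite big1 ?addr0 // => i ij; rewrite -mulrA wz (negPf ij) mulr0.
Qed.

Lemma blkM z w M N : is_fan z w -> blk z w (M *m N) = blk z w M * blk z w N.
Proof.
move=> zw; rewrite /blk mulr_suml; apply: eq_bigr => i _; rewrite -mulrA.
congr (_ * _); rewrite mulr_suml.
under eq_bigr => j _ do rewrite mxE mulr_suml.
rewrite exchange_big; apply: eq_bigr => k _; rewrite -mulrA (fan_pickl _ _ zw).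
by rewrite mulr_sumr; apply: eq_bigr => j _; rewrite mulrA.
Qed.

Lemma blkD z w M N : blk z w (M + N) = blk z w M + blk z w N.
Proof.
rewrite /blk -big_split; apply: eq_bigr => i _; rewrite /= -mulrDr -big_split.
by congr (_ * _); apply: eq_bigr => j _; rewrite mxE mulrDl.
Qed.

Lemma blkN z w M : blk z w (- M) = - blk z w M.
Proof.
rewrite /blk -sumrN; apply: eq_bigr => i _; rewrite -mulrN -sumrN.
by congr (_ * _); apply: eq_bigr => j _; rewrite mxE mulNr.
Qed.

Lemma blk1 z w : is_fan z w -> blk z w 1%:M = 1.
Proof.
case=> _ zw; rewrite /blk -[RHS]zw; apply: eq_bigr => i _; congr (_ * _).
rewrite (bigD1 i) //= mxE eqxx mulr1n mul1r big1 ?addr0 // => j ji.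
by rewrite mxE eq_sym (negPf ji) mulr0n mul0r.
Qed.

Lemma inverses_blk z w M N : is_fan z w -> M *m N = 1%:M -> N *m M = 1%:M ->
  inverses (blk z w M) (blk z w N).
Proof. by move=> zw MN NM; split; rewrite -blkM ?MN ?NM ?blk1. Qed.

Lemma blk_corner z w M i j : is_fan z w -> w i * blk z w M * z j = M i j.
Proof.
by move=> zw; rewrite /blk (fan_pickl _ _ zw) (fan_pickr (fun j => M i j) _ zw).
Qed.

Lemma is_fan_comp z w (s : 'I_n -> 'I_n) : injective s -> is_fan z w ->
  is_fan (z \o s) (w \o s).
Proof.
move=> s_inj [wz zw]; split=> [i j|] /=; first by rewrite wz (inj_eq s_inj).
by rewrite -zw [RHS](reindex_inj s_inj).
Qed.

End Blocks.

Lemma map_blk (B C : nzRingType) n (f : {rmorphism B -> C}) (z w : 'I_n -> B) M :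
  f (blk z w M) = blk (f \o z) (f \o w) (map_mx f M).
Proof.
rewrite /blk rmorph_sum; apply: eq_bigr => i _; rewrite rmorphM rmorph_sum /=.
by congr (_ * _); apply: eq_bigr => j _; rewrite rmorphM mxE.
Qed.

Lemma map_is_fan (B C : nzRingType) n (f : {rmorphism B -> C}) (z w : 'I_n -> B) :
  is_fan z w -> is_fan (f \o z) (f \o w).
Proof.
case=> wz zw; split=> [i j|] /=; first by rewrite -rmorphM wz rmorph_nat.
by rewrite -(rmorph1 f) -zw rmorph_sum; apply: eq_bigr => i _; rewrite rmorphM.
Qed.

Lemma fan_is_fan (R : comNzRingType) k : is_fan (@fan R k) (@fan_tr R k).
Proof. by split; [exact: fan_trK|exact: fan_sum]. Qed.

Notation o30 := (@Ordinal 3 0 isT).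
Notation o31 := (@Ordinal 3 1 isT).
Notation o32 := (@Ordinal 3 2 isT).

Section Whitehead.
Variable (B : nzRingType).

(** A 2 by 2 block and a third diagonal entry. The third coordinate lets the blocks diag(u, u^-1) of
    two units share the first position while their second positions differ, which is how the index
    is shown to be multiplicative. *)
Definition mx21 (a b c d e : B) : 'M[B]_3 := \matrix_(i, j)
  match val i, val j with
  | 0%N, 0%N => a | 0%N, 1%N => b | 1%N, 0%N => c | 1%N, 1%N => d
  | 2%N, 2%N => e | _, _ => 0
  end.

Lemma blk_mx21 (z w : 'I_3 -> B) a b c d e : blk z w (mx21 a b c d e) =
  z o30 * (a * w o30 + b * w o31) + z o31 * (c * w o30 + d * w o31) + z o32 * (e * w o32).
Proof.
rewrite /blk !big_ord_recl !big_ord0.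
have -> : lift ord0 (lift ord0 ord0) = o32 by exact: val_inj.
have -> : lift ord0 ord0 = o31 by exact: val_inj.
have -> : ord0 = o30 by exact: val_inj.
by rewrite !mxE /= !mul0r !addr0 !add0r addrA.
Qed.

Lemma mx21M a b c d e a' b' c' d' e' : mx21 a b c d e *m mx21 a' b' c' d' e' =
  mx21 (a * a' + b * c') (a * b' + b * d') (c * a' + d * c') (c * b' + d * d') (e * e').
Proof.
apply/matrixP => i j; rewrite !mxE !big_ord_recl !big_ord0 !mxE /=.
by case: i => -[|[|[|//]]] ?; case: j => -[|[|[|//]]] ? /=;
  rewrite !(mul0r, mulr0, addr0, add0r).
Qed.

Lemma mx21_1 : mx21 1 0 0 1 1 = 1%:M.
Proof.
by apply/matrixP => i j; rewrite !mxE; case: i => -[|[|[|//]]] ?; case: j => -[|[|[|//]]] ?.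
Qed.

Lemma mx21D a b c d e a' b' c' d' e' : mx21 a b c d e + mx21 a' b' c' d' e' =
  mx21 (a + a') (b + b') (c + c') (d + d') (e + e').
Proof.
apply/matrixP => i j; rewrite !mxE.
by case: i => -[|[|[|//]]] ?; case: j => -[|[|[|//]]] ? /=; rewrite ?addr0.
Qed.

Variables T S : B.
Definition wh_C := 1 - S * T.
Definition wh_B := T * S - 1.
Definition wh_A := T * (1 + wh_C).

Let BT : wh_B * T = - (T * wh_C).
Proof. by rewrite mulrBl mulrBr mul1r mulr1 opprB mulrA. Qed.
Let SB : S * wh_B = - (wh_C * S).
Proof. by rewrite mulrBl mulrBr mul1r mulr1 opprB mulrA. Qed.
Let ST : S * T = 1 - wh_C.
Proof. by rewrite /wh_C opprB addrC subrK. Qed.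
Let TS : T * S = 1 + wh_B.
Proof. by rewrite /wh_B addrC subrK. Qed.
Let AE : wh_A = (1 - wh_B) * T.
Proof. by rewrite /wh_A mulrDr mulr1 mulrBl mul1r BT opprK. Qed.

(* The block matrix [[2T - TST, TS - 1], [1 - ST, S]] is invertible for all [T]
   and [S], and lifts diag(u, u^-1) when [T] and [S] lift [u] and [u^-1]. *)
Definition wh := mx21 wh_A wh_B wh_C S 1.
Definition wh' := mx21 S wh_C wh_B wh_A 1.

Let AS : wh_A * S + wh_B * wh_B = 1.
Proof. by rewrite AE -mulrA TS mulrDr mulr1 mulrBl mul1r addrA subrK subrK. Qed.
Let SA : S * wh_A + wh_C * wh_C = 1.
Proof. by rewrite /wh_A mulrA ST mulrDr mulr1 mulrBl mul1r addrA subrK subrK. Qed.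
Let AC : wh_A * wh_C + wh_B * wh_A = 0.
Proof.
have CC c : (1 + c) * c = c * (1 + c) :> B by rewrite mulrDl mulrDr mul1r mulr1.
by rewrite /wh_A mulrA BT mulNr -mulrA CC mulrA subrr.
Qed.
Let CS : wh_C * S + S * wh_B = 0.
Proof. by rewrite SB subrr. Qed.

Lemma whK : wh *m wh' = 1%:M.
Proof. by rewrite mx21M AS AC CS (addrC (_ * wh_C)) SA mulr1 mx21_1. Qed.

Lemma wh'K : wh' *m wh = 1%:M.
Proof.
rewrite mx21M SA (addrC (S * _)) CS (addrC (wh_B * wh_A)) AC.
by rewrite (addrC (wh_B * wh_B)) AS mulr1 mx21_1.
Qed.

Lemma wh_sandwich : wh *m mx21 1 0 0 0 0 *m wh' =
  mx21 (wh_A * S) (wh_A * wh_C) (wh_C * S) (wh_C * wh_C) 0.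
Proof. by rewrite !mx21M !(mulr0, mulr1, mul0r, addr0). Qed.

End Whitehead.

Lemma map_mx21 (B C : nzRingType) (f : {rmorphism B -> C}) a b c d e :
  map_mx f (mx21 a b c d e) = mx21 (f a) (f b) (f c) (f d) (f e).
Proof.
apply/matrixP => i j; rewrite !mxE.
by case: i => -[|[|[|//]]] ?; case: j => -[|[|[|//]]] ? /=; rewrite ?rmorph0.
Qed.

Lemma map_wh (B C : nzRingType) (f : {rmorphism B -> C}) (T S : B) :
  map_mx f (wh T S) = wh (f T) (f S) /\ map_mx f (wh' T S) = wh' (f T) (f S).
Proof.
by rewrite /wh /wh' /wh_A /wh_B /wh_C !map_mx21 !(rmorphM, rmorphB, rmorphD, rmorph1).
Qed.

Lemma wh_inverses (B : nzRingType) (u u' : B) : inverses u u' ->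
  wh u u' = mx21 u 0 0 u' 1.
Proof.
by move=> [uu' u'u]; rewrite /wh /wh_A /wh_B /wh_C uu' u'u !subrr addr0 mulr1.
Qed.

(** Precomposing a fan with [s13] or [s23] puts the 2 by 2 block of [wh] in positions 1, 3 or 2, 3.
    The images of the first two indices are what is prescribed, hence a 3-cycle for [s23]. *)
Definition s13 : 'I_3 -> 'I_3 := @ordS 3 \o @rev_ord 3.
Definition s23 : 'I_3 -> 'I_3 := @ordS 3.

Lemma s13_inj : injective s13.
Proof. exact: inj_comp (@ordS_inj 3) (@rev_ord_inj 3). Qed.

Lemma s13E : (s13 o30 = o30) * (s13 o31 = o32) * (s13 o32 = o31).
Proof. by do !split; apply: val_inj. Qed.

Lemma s23E : (s23 o30 = o31) * (s23 o31 = o32) * (s23 o32 = o30).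
Proof. by do !split; apply: val_inj. Qed.

Section Diag3.
Variables (B : nzRingType) (z w : 'I_3 -> B).

Definition diag3 a b c : B := blk z w (mx21 a 0 0 b c).

Lemma diag3E a b c :
  diag3 a b c = z o30 * (a * w o30) + z o31 * (b * w o31) + z o32 * (c * w o32).
Proof. by rewrite /diag3 blk_mx21 !mul0r addr0 add0r. Qed.

Lemma diag3M a b c a' b' c' : is_fan z w ->
  diag3 a b c * diag3 a' b' c' = diag3 (a * a') (b * b') (c * c').
Proof. by move=> zw; rewrite /diag3 -blkM // mx21M !(mulr0, mul0r, addr0, add0r). Qed.

End Diag3.

Section Diag3Perm.
Variables (B : nzRingType) (z w : 'I_3 -> B).

Lemma diag3_s13 a b c : diag3 (z \o s13) (w \o s13) a b c = diag3 z w a c b.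
Proof. by rewrite !diag3E /= !s13E addrAC. Qed.

Lemma diag3_s23 a b c : diag3 (z \o s23) (w \o s23) a b c = diag3 z w c a b.
Proof. by rewrite !diag3E /= !s23E addrC addrA. Qed.

End Diag3Perm.


Lemma inverses_corner (B : nzRingType) (z w X X' : B) : w * z = 1 -> inverses X X' ->
  X * (z * w) = (z * w) * X -> inverses (w * X * z) (w * X' * z).
Proof.
move=> wz [XX X'X] Xe; have Xe' e : X * e = e * X -> e * X' = X' * e.
  by move=> h; rewrite -[LHS]mul1r -X'X -mulrA [X * (e * X')]mulrA h -[e * X * X']mulrA XX mulr1.
split.
  transitivity (w * (X * (z * w)) * X' * z); first by rewrite !mulrA.
  by rewrite Xe !mulrA wz mul1r -[w * X * X']mulrA XX mulr1.
transitivity (w * (X' * (z * w)) * X * z); first by rewrite !mulrA.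
by rewrite -Xe' // !mulrA wz mul1r -[w * X' * X]mulrA X'X mulr1.
Qed.

Section AbstractIndex.
Variables (Q : comNzRingType) (G S : algType Q) (pi : {rmorphism G -> S}).
Hypothesis piZ : forall c, pi c%:A = c%:A.
Variable det : G -> Q.
Hypothesis det1 : det 1 = 1.
Hypothesis detM : forall k k', pi k = 1 -> pi k' = 1 -> det (k * k') = det k * det k'.
Hypothesis detJ : forall g h k, inverses g h -> pi k = 1 -> det (g * k * h) = det k.

Lemma piJ g h k : inverses g h -> pi k = 1 -> pi (g * k * h) = 1.
Proof. by move=> gh k1; rewrite !rmorphM k1 mulr1 -rmorphM gh.1 rmorph1. Qed.

Section CommutatorDet.
Variables D D' : G.
Hypothesis DD' : inverses D D'.

(** The commutator of [W] and [D] is sent to 1 as soon as their images in [S] commute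
    ([fin_comm_pi]). Its determinant is multiplicative in [W] and depends on the image of [W] alone
    ([comm_detM], [comm_det_eq]). *)
Definition comm_det W W' : Q := det (W * D * W' * D').

Definition fin_comm W := pi W * pi D = pi D * pi W.

Lemma fin_comm_pi W W' : inverses W W' -> fin_comm W -> pi (W * D * W' * D') = 1.
Proof.
move=> WW' WD; rewrite !rmorphM WD -[_ * pi W * _]mulrA.
by rewrite -(rmorphM pi W) WW'.1 rmorph1 mulr1 -rmorphM DD'.1 rmorph1.
Qed.

(** [W1 W2, D] = W1 [W2, D] W1^-1 [W1, D], and the determinant ignores the conjugation by [W1]. *)
Lemma comm_detM W1 W1' W2 W2' : inverses W1 W1' -> inverses W2 W2' ->
  fin_comm W1 -> fin_comm W2 ->
  comm_det (W1 * W2) (W2' * W1') = comm_det W1 W1' * comm_det W2 W2'.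
Proof.
move=> h1 h2 c1 c2; rewrite /comm_det.
have -> : W1 * W2 * D * (W2' * W1') * D' =
    (W1 * (W2 * D * W2' * D') * W1') * (W1 * D * W1' * D').
  rewrite !mulrA -[_ * W1' * W1]mulrA h1.2 mulr1.
  by rewrite -[_ * D' * D]mulrA DD'.2 mulr1.
have s1 := fin_comm_pi h1 c1; have s2 := fin_comm_pi h2 c2.
by rewrite (detM (piJ h1 s2) s1) (detJ h1 s2) mulrC.
Qed.

(** The commutator is [k] times a conjugate of its inverse, and both factors are sent to 1. *)
Lemma comm_det_fin k k' : inverses k k' -> pi k = 1 -> comm_det k k' = 1.
Proof.
move=> kk' k1; have k1' : pi k' = 1.
  by rewrite -[pi k']mul1r -k1 -rmorphM kk'.1 rmorph1.
rewrite /comm_det -mulrA -[k * D * _]mulrA [D * _]mulrA.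
by rewrite (detM k1 (piJ DD' k1')) (detJ DD' k1') -detM // kk'.1 det1.
Qed.

Lemma comm_det_comm W W' : inverses W W' -> W * D = D * W -> comm_det W W' = 1.
Proof.
by move=> WW' WD; rewrite /comm_det WD -[D * W * W']mulrA WW'.1 mulr1 DD'.1 det1.
Qed.

(** [W1] is W1 W2^-1 times [W2], and the first factor, being sent to 1, contributes determinant
    1. *)
Lemma comm_det_eq W1 W1' W2 W2' : inverses W1 W1' -> inverses W2 W2' ->
  pi W1 = pi W2 -> fin_comm W1 -> comm_det W1 W1' = comm_det W2 W2'.
Proof.
move=> h1 h2 W12 c1.
have c2 : fin_comm W2 by rewrite /fin_comm -W12.
have k1 : pi (W1 * W2') = 1 by rewrite rmorphM W12 -rmorphM h2.1 rmorph1.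
have hk := inversesM h1 (inverses_sym h2).
have -> : W1 = (W1 * W2') * W2 by rewrite -mulrA h2.2 mulr1.
have -> : W1' = W2' * (W2 * W1') by rewrite mulrA h2.2 mul1r.
by rewrite comm_detM ?(comm_det_fin hk) ?mul1r // /fin_comm k1 mulr1 mul1r.
Qed.

End CommutatorDet.

Variables (lam lam' : Q) (z w : 'I_3 -> G).
Hypotheses (lamK : lam * lam' = 1) (zw : is_fan z w).

Let zw13 : is_fan (z \o s13) (w \o s13).
Proof. exact: is_fan_comp s13_inj zw. Qed.
Let zw23 : is_fan (z \o s23) (w \o s23).
Proof. exact: is_fan_comp (@ordS_inj 3) zw. Qed.

Definition twist3 (c : Q) : G := diag3 z w c%:A 1 1.

Lemma twist3M (c c' : Q) : c * c' = 1 -> twist3 c * twist3 c' = 1.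
Proof.
move=> cc'; rewrite /twist3 (diag3M _ _ _ _ _ _ zw) !mulr1.
by rewrite -scalerAl mul1r scalerA cc' scale1r /diag3 mx21_1 (blk1 zw).
Qed.

Lemma twist3K : inverses (twist3 lam) (twist3 lam').
Proof. by split; apply: twist3M; rewrite // mulrC. Qed.

Lemma twist3E c : twist3 c = 1 + (c - 1) *: diag3 z w 1 0 0.
Proof.
have -> : twist3 c = diag3 z w 1 1 1 + diag3 z w (c - 1)%:A 0 0.
  rewrite /twist3 /diag3 -blkD mx21D !addr0 scalerBl scale1r.
  by rewrite [1 + _]addrC subrK.
rewrite {1}/diag3 mx21_1 (blk1 zw); congr (_ + _).
by rewrite !diag3E !mul0r !mulr0 !addr0 -scalerAl -scalerAr.
Qed.

Definition wh_lift s T T' : G := blk (z \o s) (w \o s) (wh T T').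
Definition wh_lift' s T T' : G := blk (z \o s) (w \o s) (wh' T T').

Let wh_liftK s T T' : is_fan (z \o s) (w \o s) ->
  inverses (wh_lift s T T') (wh_lift' s T T').
Proof. by move=> zws; apply: inverses_blk => //; [exact: whK|exact: wh'K]. Qed.

Let Z := pi \o z.
Let W := pi \o w.
Let ZW : is_fan Z W. Proof. exact: map_is_fan zw. Qed.

Let pi_wh_lift s T T' : inverses (pi T) (pi T') ->
  pi (wh_lift s T T') = diag3 (Z \o s) (W \o s) (pi T) (pi T') 1.
Proof. by move=> TT'; rewrite /wh_lift map_blk (map_wh pi T T').1 wh_inverses. Qed.

Let pi_twist3 c : pi (twist3 c) = diag3 Z W c%:A 1 1.
Proof.
by rewrite /twist3 /diag3 map_blk map_mx21 piZ rmorph1 rmorph0.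
Qed.

Let fin_comm_diag3 X a b c : pi X = diag3 Z W a b c -> fin_comm (twist3 lam) X.
Proof.
move=> XE; rewrite /fin_comm XE pi_twist3 !diag3M //.
by rewrite -scalerAl -scalerAr !mulr1 !mul1r.
Qed.

Definition whdet s T T' : Q :=
  comm_det (twist3 lam) (twist3 lam') (wh_lift s T T') (wh_lift' s T T').

Let pi_wh12 T T' : inverses (pi T) (pi T') ->
  pi (wh_lift id T T') = diag3 Z W (pi T) (pi T') 1.
Proof. exact: pi_wh_lift. Qed.
Let pi_wh13 T T' : inverses (pi T) (pi T') ->
  pi (wh_lift s13 T T') = diag3 Z W (pi T) 1 (pi T').
Proof. by move=> TS; rewrite pi_wh_lift // diag3_s13. Qed.
Let pi_wh23 T T' : inverses (pi T) (pi T') ->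
  pi (wh_lift s23 T T') = diag3 Z W 1 (pi T) (pi T').
Proof. by move=> TS; rewrite pi_wh_lift // diag3_s23. Qed.

Let whdet23 T T' : whdet s23 T T' = 1.
Proof.
apply: (comm_det_comm twist3K (wh_liftK _ _ zw23)).
have -> : twist3 lam = diag3 (z \o s23) (w \o s23) 1 1 lam%:A by rewrite diag3_s23.
rewrite /wh_lift /diag3 -!(blkM _ _ zw23) /wh !mx21M.
by rewrite !(mulr0, mul0r, addr0, add0r, mulr1, mul1r).
Qed.

Lemma whdet_eq T T' U U' : inverses (pi T) (pi T') -> pi T = pi U -> pi T' = pi U' ->
  whdet id T T' = whdet id U U'.
Proof.
move=> TT' TU TU'; have UU' : inverses (pi U) (pi U') by rewrite -TU -TU'.
apply: (comm_det_eq twist3K (wh_liftK _ _ zw) (wh_liftK _ _ zw)).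
  by rewrite !pi_wh12 // TU TU'.
exact: fin_comm_diag3 (pi_wh12 TT').
Qed.

(* diag(u,u',1) diag(v,1,v') = diag(1,v,v') diag(uv,v'u',1), and lifts of the
   third factor that leave position 1 alone contribute nothing. *)
Let whdetM13 T T' U U' : inverses (pi T) (pi T') -> inverses (pi U) (pi U') ->
  whdet id T T' * whdet s13 U U' = whdet id (T * U) (U' * T').
Proof.
move=> TT UU.
have TU : inverses (pi (T * U)) (pi (U' * T')) by rewrite !rmorphM; exact: inversesM.
have h12 := wh_liftK T T' zw; have h13 := wh_liftK U U' zw13.
have h23 := wh_liftK U U' zw23; have h12' := wh_liftK (T * U) (U' * T') zw.
have c12 := fin_comm_diag3 (pi_wh12 TT); have c13 := fin_comm_diag3 (pi_wh13 UU).
have c23 := fin_comm_diag3 (pi_wh23 UU); have c12' := fin_comm_diag3 (pi_wh12 TU).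
rewrite /whdet -(comm_detM twist3K h12 h13) // -[RHS]mul1r -(whdet23 U U') /whdet.
rewrite -(comm_detM twist3K h23 h12') //.
apply: (comm_det_eq twist3K (inversesM h12 h13) (inversesM h23 h12')); last first.
  apply: (@fin_comm_diag3 _ (pi T * pi U) (pi T' * 1) (1 * pi U')).
  by rewrite rmorphM pi_wh12 // pi_wh13 // diag3M.
rewrite [LHS]rmorphM [RHS]rmorphM (pi_wh12 TT) (pi_wh13 UU) (pi_wh23 UU) (pi_wh12 TU).
by rewrite !diag3M // !rmorphM !mul1r !mulr1 mulrA UU.1 mul1r.
Qed.

Lemma whdetM T T' U U' : inverses (pi T) (pi T') -> inverses (pi U) (pi U') ->
  whdet id (T * U) (U' * T') = whdet id T T' * whdet id U U'.
Proof.
move=> TT UU; rewrite -whdetM13 //; congr (_ * _).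
(* The case T = 1 of [whdetM13] moves the block of [U] from positions 1, 3 to positions 1, 2. *)
have h11 : inverses (pi 1) (pi 1) by rewrite rmorph1; exact: inverses1.
have := whdetM13 h11 UU; rewrite mul1r mulr1 => <-.
suff -> : whdet id 1 1 = 1 by rewrite mul1r.
have -> : whdet id 1 1 = comm_det (twist3 lam) (twist3 lam') 1 1.
  rewrite /whdet /wh_lift /wh_lift' /wh /wh' /wh_A /wh_B /wh_C !mulr1 subrr addr0 mulr1.
  by rewrite !mx21_1 (blk1 zw).
by apply: (comm_det_comm twist3K (inverses1 _)); rewrite mulr1 mul1r.
Qed.

(** Genuine inverses make [wh] diagonal, so that it commutes with the twist. *)
Lemma whdet_lift T T' : inverses T T' -> whdet id T T' = 1.
Proof.
move=> TT; apply: (comm_det_comm twist3K (wh_liftK _ _ zw)).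
rewrite /wh_lift wh_inverses // /twist3 /diag3 -!(blkM _ _ zw) !mx21M.
rewrite !(mulr0, mul0r, addr0, add0r, mulr1, mul1r).
by rewrite -scalerAl -scalerAr mulr1 mul1r.
Qed.

Definition wh_idem T T' : G := wh_lift id T T' * diag3 z w 1 0 0 * wh_lift' id T T'.

Lemma wh_idemE T T' : wh_idem T T' =
  blk z w (mx21 (wh_A T T' * T') (wh_A T T' * wh_C T T') (wh_C T T' * T')
                (wh_C T T' * wh_C T T') 0).
Proof. by rewrite -wh_sandwich !(blkM _ _ zw). Qed.

(** The twist is 1 + (lam - 1) e with e the first coordinate projection, and conjugation replaces e
    by [wh_idem]. The index thus becomes the relative rank of two idempotents with the same image
    ([pi_wh_idem]). *)
Lemma whdetE T T' : whdet id T T' =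
  det ((1 + (lam - 1) *: wh_idem T T') * (1 + (lam' - 1) *: diag3 z w 1 0 0)).
Proof.
rewrite /whdet /comm_det -(twist3E lam'); congr (det (_ * _)).
rewrite twist3E mulrDr mulr1 mulrDl (wh_liftK T T' zw).1.
by rewrite -scalerAr -scalerAl.
Qed.

Lemma wh_idem_idem T T' : wh_idem T T' * wh_idem T T' = wh_idem T T'.
Proof.
rewrite /wh_idem; set V := wh_lift _ _ _; set V' := wh_lift' _ _ _; set e := diag3 _ _ _ _ _.
have [_ V'V] := wh_liftK T T' zw.
have ee : e * e = e by rewrite /e diag3M // !mulr1 !mul0r.
by rewrite !mulrA -[_ * V' * V]mulrA V'V mulr1 -[V * e * e]mulrA ee.
Qed.

Lemma pi_wh_idem T T' : inverses (pi T) (pi T') -> pi (wh_idem T T') = pi (diag3 z w 1 0 0).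
Proof.
move=> TT; rewrite /wh_idem !rmorphM pi_wh12 //.
have -> : pi (wh_lift' id T T') = diag3 Z W (pi T') (pi T) 1.
  apply: (inverses_unique (inverses_map pi (wh_liftK T T' zw))); rewrite pi_wh12 //.
  split; rewrite diag3M // ?TT.1 ?TT.2 mulr1 /diag3 mx21_1; exact: blk1.
have -> : pi (diag3 z w 1 0 0) = diag3 Z W 1 0 0.
  by rewrite /diag3 map_blk map_mx21 rmorph1 !rmorph0.
by rewrite !diag3M // !mulr1 !mulr0 !mul0r TT.1.
Qed.

(* A finite unit conjugating [wh_idem] back to the first coordinate projection
   makes the lift block diagonal, and its first block lifts the unit. *)
Lemma whdet_lifted T T' k k' : inverses (pi T) (pi T') -> inverses k k' -> pi k = 1 ->
  k * wh_idem T T' = diag3 z w 1 0 0 * k ->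
  exists g g', inverses g g' /\ pi g = pi T.
Proof.
move=> TT kk' k1 ke; set e := diag3 z w 1 0 0 in ke.
have k'1 : pi k' = 1 by rewrite -[pi k']mul1r -k1 -rmorphM kk'.1 rmorph1.
have VV := wh_liftK T T' zw; set V := wh_lift _ _ _ in VV; set V' := wh_lift' _ _ _ in VV.
have eE : e = z o30 * w o30 by rewrite /e diag3E !mul0r !mulr0 !addr0 mul1r.
have [wz _] := zw; have w0z0 : w o30 * z o30 = 1 by rewrite wz eqxx.
have kVe : k * V * (z o30 * w o30) = (z o30 * w o30) * (k * V).
  by rewrite [RHS]mulrA -eE -ke /wh_idem -/V -/V' -/e -!mulrA VV.2 mulr1.
exists (w o30 * (k * V) * z o30), (w o30 * (V' * k') * z o30); split.
  exact: inverses_corner w0z0 (inversesM kk' VV) kVe.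
rewrite !rmorphM k1 mul1r pi_wh12 // -/(Z o30) -/(W o30) /diag3 (blk_corner _ _ _ ZW).
by rewrite mxE.
Qed.

End AbstractIndex.

Lemma map_wh_idem (Q Q' : comNzRingType) (G : algType Q) (G' : algType Q')
    (f : {rmorphism G -> G'}) (z w : 'I_3 -> G) T T' :
  f (wh_idem z w T T') = wh_idem (f \o z) (f \o w) (f T) (f T').
Proof.
rewrite /wh_idem !rmorphM /wh_lift /wh_lift' /diag3 !map_blk map_mx21 rmorph1 !rmorph0.
by rewrite (map_wh f T T').1 (map_wh f T T').2.
Qed.

(** * Ranks of idempotents as exponents of the determinant *)

Lemma idem_pid (K : fieldType) N (E : 'M[K]_N) : E *m E = E ->
  exists2 P, P \in unitmx & P *m E = pid_mx (\rank E) *m P.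
Proof.
move=> EE; set p : 'M_N := pid_mx (\rank E); set L := col_ebase E; set U := row_ebase E.
have EF : L *m p *m U = E by exact: mulmx_ebase.
have Lu : L \in unitmx by exact: col_ebase_unit.
have Uu : U \in unitmx by exact: row_ebase_unit.
have pp : p *m p = p by rewrite pid_mx_id ?rank_leq_row.
have [X XE] : exists X, X = U *m L *m p by eexists.
have UE : U *m E = X *m U by rewrite -EF XE !mulmxA.
have pXp : p *m X = p.
  have h : L *m (p *m X) *m U = L *m p *m U.
    by rewrite EF -[in RHS]EE -{1}EF -!mulmxA UE.
  have /(can_inj (mulKmx Lu)) := can_inj (mulmxK Uu) h.
  by [].
have Xp : X *m p = X by rewrite XE -mulmxA pp.
have XX : X *m X = X by rewrite {1}XE -mulmxA pXp -XE.
(* [X] is [E] conjugated by [U]. From pX = p and Xp = X the difference X - p squares to 0, so [H] is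
   invertible, and it conjugates [X] to [p]. *)
pose H := 1%:M - (X - p).
have HH : H *m (1%:M + (X - p)) = 1%:M.
  rewrite /H mulmxDr mulmx1 mulmxBl mul1mx mulmxBr !mulmxBl XX Xp pXp pp subrr subr0.
  by rewrite subrK.
exists (H *m U).
  by rewrite unitmx_mul Uu andbT; case/mulmx1_unit: HH.
rewrite -mulmxA UE !mulmxA; congr (_ *m U).
by rewrite /H mulmxBl mulmxBr mul1mx mulmx1 mulmxBl mulmxBr XX pXp pp subrr subr0 opprB addrC subrK.
Qed.

Lemma det_pid (F : fieldType) N r (c : F) : (r <= N)%N ->
  \det (1%:M + (c - 1) *: (pid_mx r : 'M_N)) = c ^+ r.
Proof.
move=> rN; have -> : 1%:M + (c - 1) *: pid_mx r = diag_mx (\row_(i < N) if (i < r)%N then c else 1).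
  apply/matrixP => i j; rewrite !mxE; have [->|ij] := eqVneq i j; last first.
    by rewrite !mulr0n val_eqE (negPf ij) mulr0 addr0.
  by rewrite !mulr1n eqxx /=; case: (j < r)%N; rewrite ?mulr1 ?mulr0 ?addr0 // addrC subrK.
rewrite det_diag; under eq_bigr do rewrite mxE.
by rewrite -big_mkcond -(big_ord_widen _ (fun _ => c) rN) prodr_const card_ord.
Qed.

Section BlockGamma.
Variable R : comNzRingType.

Definition block_fun N (P : 'M[R]_N) (i j : nat) : R^o :=
  if insub i is Some i' then if insub j is Some j' then P i' j' else 0
  else (i == j)%:R.

Lemma block_gam_subproof N (P : 'M[R]_N) : rcfinite (block_fun P).
Proof.
rewrite /block_fun; apply/rcfiniteP; split=> m; exists (maxn N m.+1) => k; rewrite geq_max => /andP[Nk mk].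
  by case: insubP => [i _ _|_]; rewrite ?insubF ?ltn_eqF // ltnNge Nk.
by rewrite insubF ?gtn_eqF // ltnNge Nk.
Qed.

Definition block_gam N (P : 'M[R]_N) : Gam R := MkGamma (block_gam_subproof P).

Lemma block_gam_corner N (P : 'M[R]_N) : corner_mx N (block_gam P) = P.
Proof. by apply/matrixP => i j; rewrite mxE /= /block_fun !valK. Qed.

Lemma block_gam_pert N (P : 'M[R]_N) : fin_pert N (block_gam P).
Proof.
move=> i j ij /=; rewrite /block_fun; case: insubP => [i' iN <-|//].
rewrite leqNgt iN /= in ij; rewrite insubF; last by rewrite ltnNge ij.
by rewrite ltn_eqF //; exact: leq_trans (ltn_ord i') ij.
Qed.

Lemma fin_pert_inj N (a b : Gam R) : fin_pert N a -> fin_pert N b ->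
  corner_mx N a = corner_mx N b -> a = b.
Proof.
move=> aN bN /matrixP ab; apply: gammaP => i j.
have [ij|] := boolP ((N <= i)%N || (N <= j)%N); first by rewrite aN ?bN.
rewrite negb_or -!ltnNge => /andP[iN jN].
by have := ab (Ordinal iN) (Ordinal jN); rewrite !mxE.
Qed.

Lemma fin_pert1 N : fin_pert N (1 : Gam R) /\ corner_mx N (1 : Gam R) = 1%:M.
Proof. by split=> //; apply/matrixP => i j; rewrite !mxE gam1E. Qed.

Lemma block_gam_inverses N (P P' : 'M[R]_N) : P *m P' = 1%:M ->
  inverses (block_gam P) (block_gam P').
Proof.
move=> PP'; have P'P := mulmx1C PP'.
by split; apply: (@fin_pert_inj N); rewrite ?(fin_pert1 _).1 ?(fin_pert1 _).2;
  try exact: (fin_pert1 _).1; try exact: (fin_pertM (block_gam_pert _) (block_gam_pert _)).1;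
  rewrite (fin_pertM (block_gam_pert _) (block_gam_pert _)).2 !block_gam_corner.
Qed.

End BlockGamma.

Lemma idem_twistM (Q : comNzRingType) (A : algType Q) (e : A) (a b : Q) : e * e = e ->
  (1 + (a - 1) *: e) * (1 + (b - 1) *: e) = 1 + (a * b - 1) *: e.
Proof.
move=> ee; rewrite mulrDl mul1r mulrDr mulr1 -scalerAl -scalerAr ee scalerA.
rewrite -addrA -!scalerDl; congr (1 + _ *: e).
ring.
Qed.

Section GammaDet.
Variables (Q : comNzRingType) (lam lam' : Q).
Hypothesis lamK : lam * lam' = 1.
Implicit Types T S : Gam Q.

Definition gdet T S : Q :=
  whdet (@fdet Q) lam lam' (@fan Q 2) (@fan_tr Q 2) id T S.

Let sigA c : sig (c%:A : Gam Q) = c%:A.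
Proof. by rewrite sigZ sig1. Qed.

Lemma gdet_eq T S T' S' : inverses (sig T) (sig S) -> sig T = sig T' -> sig S = sig S' ->
  gdet T S = gdet T' S'.
Proof.
exact: (whdet_eq sigA (fdet1 Q) (@fdetM Q) (@fdetJ Q) lamK (fan_is_fan Q 2)).
Qed.

Lemma gdetM T S T' S' : inverses (sig T) (sig S) -> inverses (sig T') (sig S') ->
  gdet (T * T') (S' * S) = gdet T S * gdet T' S'.
Proof.
exact: (whdetM sigA (fdet1 Q) (@fdetM Q) (@fdetJ Q) lamK (fan_is_fan Q 2)).
Qed.

Lemma gdet_lift T S : inverses T S -> gdet T S = 1.
Proof. exact: (whdet_lift (fdet1 Q) lamK (fan_is_fan Q 2)). Qed.

Definition proj3 : Gam Q := diag3 (@fan Q 2) (@fan_tr Q 2) 1 0 0.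
Definition gidem T S : Gam Q := wh_idem (@fan Q 2) (@fan_tr Q 2) T S.

Lemma proj3E i j : proj3 i j = ((i == j) && (i %% 3 == 0)%N)%:R.
Proof.
have -> : proj3 = fan Q o30 * fan_tr Q o30.
  by rewrite /proj3 diag3E !mul0r !mulr0 !addr0 mul1r.
exact: fan_projE.
Qed.

Lemma proj3_idem : proj3 * proj3 = proj3.
Proof. by rewrite /proj3 (diag3M _ _ _ _ _ _ (fan_is_fan Q 2)) !mulr0 mulr1. Qed.

Definition gidem_pert T S : Gam Q :=
  (1 + (lam - 1) *: gidem T S) * (1 + (lam' - 1) *: proj3).

Lemma gdetE T S : gdet T S = fdet (gidem_pert T S).
Proof. exact: (whdetE (@fdet Q) lam lam' (fan_is_fan Q 2)). Qed.

Lemma sig_gidem T S : inverses (sig T) (sig S) -> sig (gidem T S) = sig proj3.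
Proof. exact: (@pi_wh_idem _ _ _ (@sig Q) _ _ (fan_is_fan Q 2)). Qed.

Lemma sig_gidem_pert T S : inverses (sig T) (sig S) -> sig (gidem_pert T S) = 1.
Proof.
move=> TS; rewrite /gidem_pert sigM !sigD !sigZ sig1 sig_gidem //.
rewrite idem_twistM; first by rewrite lamK subrr scale0r addr0.
by rewrite -sigM proj3_idem.
Qed.

End GammaDet.

Section MapDet.
Variables (Q Q' : comNzRingType) (f : {rmorphism Q -> Q'}) (lam lam' : Q).
Hypothesis lamK : lam * lam' = 1.

Lemma map_proj3 : map_gamma f (proj3 Q) = proj3 Q'.
Proof. by apply: gammaP => i j; rewrite proj3E /= proj3E rmorph_nat. Qed.

Lemma map_gidem T S : map_gamma f (gidem T S) = gidem (map_gamma f T) (map_gamma f S).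
Proof.
have zE : map_gamma f \o @fan Q 2 = @fan Q' 2.
  by apply/funext => i; exact: map_gamma_fan.
have wE : map_gamma f \o @fan_tr Q 2 = @fan_tr Q' 2.
  by apply/funext => i; exact: map_gamma_fan_tr.
rewrite /gidem -zE -wE; exact: (map_wh_idem (map_gamma f)).
Qed.

Lemma map_gdet T S : inverses (sig T) (sig S) ->
  gdet (f lam) (f lam') (map_gamma f T) (map_gamma f S) = f (gdet lam lam' T S).
Proof.
move=> TS; rewrite !gdetE -map_fdet ?sig_gidem_pert //; congr fdet.
rewrite /gidem_pert [RHS]map_gammaM !map_gammaD map_gamma1 !map_gammaZ !rmorphB rmorph1.
by rewrite map_gidem map_proj3.
Qed.

End MapDet.

Lemma det_idem (F : fieldType) N (E : 'M[F]_N) (c : F) : E *m E = E ->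
  \det (1%:M + (c - 1) *: E) = c ^+ \rank E.
Proof.
move=> /idem_pid[P Pu PE]; rewrite -(det_pid c (rank_leq_row E)).
apply: (@mulfI _ (\det P)); first by rewrite -unitfE -unitmxE.
rewrite -det_mulmx [RHS]mulrC -det_mulmx mulmxDr mulmxDl mulmx1 mul1mx.
by rewrite -scalemxAr -scalemxAl PE.
Qed.

Section ShiftDet.
Variables (Q : comNzRingType) (lam lam' : Q).
Hypothesis lamK : lam * lam' = 1.

Lemma unit00_subproof : rcfinite (fun i j => ((i == 0) && (j == 0))%N%:R : Q^o).
Proof.
by apply/rcfiniteP; split=> m; exists 1%N => -[] //= n _; rewrite ?andbF.
Qed.

Definition unit00 : Gam Q := MkGamma unit00_subproof.

Lemma fan_unit00 k : fan Q (@Ordinal k.+1 0 isT) * unit00 = unit00.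
Proof.
apply: gammaP => i j; rewrite (@gam_mul1 _ _ _ i j 0%N) => [|[|r] // _]; last first.
  by rewrite /= mulr0.
by rewrite /= muln0 add0n -natrM mulnb.
Qed.

Lemma unit00_fan_tr k : unit00 * fan_tr Q (@Ordinal k.+1 0 isT) = unit00.
Proof.
apply: gammaP => i j; rewrite (@gam_mul1 _ _ _ i j 0%N) => [|[|r] // _]; last first.
  by rewrite /= andbF mul0r.
by rewrite /= muln0 add0n -natrM mulnb andbT.
Qed.

Lemma unit00_proj3 : unit00 * proj3 Q = unit00.
Proof.
apply: gammaP => i j; rewrite (@gam_mul1 _ _ _ i j 0%N) => [|[|r] // _]; last first.
  by rewrite /= andbF mul0r.
rewrite proj3E /= -natrM mulnb mod0n eqxx !andbT.
by rewrite [0%N == j]eq_sym.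
Qed.

(** The index idempotent is here [proj3] minus a rank one projection below it: the relative rank is
    -1, whence the inverse of [lam]. *)
Lemma gdet_shift (T S : Gam Q) : S * T = 1 -> T * S = 1 - unit00 -> gdet lam lam' T S = lam'.
Proof.
move=> ST TS; rewrite gdetE.
have gE : gidem T S = proj3 Q - unit00.
  rewrite /gidem (wh_idemE (fan_is_fan Q 2)) /wh_A /wh_C ST subrr addr0 mulr1 TS.
  rewrite !mulr0 !mul0r blk_mx21 !mul0r !mulr0 !addr0 mulrBl mul1r mulrBr.
  rewrite unit00_fan_tr fan_unit00 !mulr0 addr0; congr (_ - _).
  by rewrite /proj3 diag3E !mul0r !mulr0 !addr0 mul1r.
have -> : gidem_pert lam lam' T S = 1 + (lam' - 1) *: unit00.
  rewrite /gidem_pert gE scalerBr addrA mulrBl idem_twistM ?proj3_idem // lamK subrr scale0r.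
  rewrite addr0 mulrDr mulr1 -scalerAl -scalerAr unit00_proj3 scalerA -scalerDl -scaleNr.
  by congr (_ + _ *: _); rewrite mulrBr mulrBl lamK mulr1; ring.
have p1 : fin_pert 1 (1 + (lam' - 1) *: unit00).
  by case=> [|i] [|j] // _; rewrite gaddE gscaleE /= ?andbF scaler0 addr0.
rewrite (fdetE p1) det_mx11 mxE gaddE gscaleE /= [_ *: _]mulr1.
by rewrite addrC subrK.
Qed.

End ShiftDet.

Lemma map_unit00 (Q Q' : comNzRingType) (f : {rmorphism Q -> Q'}) :
  map_gamma f (unit00 Q) = unit00 Q'.
Proof. by apply: gammaP => i j /=; rewrite rmorph_nat. Qed.

Section FieldDet.
Variables (K F : fieldType) (inc : {rmorphism K -> F}) (lam : F).
Hypothesis lam0 : lam != 0.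

(** The index idempotent agrees with the diagonal matrix [proj3] outside a finite corner, so the
    determinant sees only the ranks of the two idempotent corners. If these coincide, the corners
    are conjugate by an invertible matrix, and its extension by 1 is the [k] that [whdet_lifted]
    asks for. *)
Lemma gdet_field (T S : Gam K) : inverses (sig T) (sig S) -> exists r r' : nat,
  gdet lam lam^-1 (map_gamma inc T) (map_gamma inc S) = lam ^+ r * lam^-1 ^+ r' /\
  (r = r' -> exists g g', inverses g g' /\ sig g = sig T).
Proof.
move=> TS; have [e eE] : exists e, e = gidem T S by eexists.
have ee : e * e = e by rewrite eE; exact: (wh_idem_idem (fan_is_fan K 2)).
have [N eN] : exists N, forall i j, (N <= i)%N || (N <= j)%N -> e i j = proj3 K i j.
  have /sigP/MinftyP[N eN] : sig e = sig (proj3 K) by rewrite eE sig_gidem.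
  exists N => i j /eN.
  by rewrite gamBE => /eqP; rewrite subr_eq0 => /eqP.
have p_off i j : i != j -> proj3 K i j = 0 by rewrite proj3E => /negPf ->.
have e_off i j : (i < N)%N != (j < N)%N -> e i j = 0.
  move=> ij; rewrite eN; last by rewrite (leqNgt N i) (leqNgt N j); move: ij; case: (i < N)%N; case: (j < N)%N.
  by rewrite p_off //; apply: contraNneq ij => ->.
have corner_idem (a : Gam K) : a * a = a -> (forall i j, (i < N)%N != (j < N)%N -> a i j = 0) ->
    corner_mx N a *m corner_mx N a = corner_mx N a.
  move=> aa a_off; apply/matrixP => i j; rewrite !mxE -[RHS](congr1 (fun b : Gam K => b i j) aa).
  rewrite (@gam_mul_ord _ _ _ _ _ N) => [|k Nk]; first by apply: eq_bigr => k _; rewrite !mxE.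
  by rewrite a_off ?mul0r // ltn_ord ltnNge Nk.
pose E := corner_mx N e; pose E1 := corner_mx N (proj3 K).
have EE : E *m E = E by exact: corner_idem.
have EE1 : E1 *m E1 = E1.
  apply: corner_idem; first exact: proj3_idem.
  by move=> i j ij; rewrite p_off //; apply: contraNneq ij => ->.
have [P Pu PE] := idem_pid EE; have [P1 Pu1 PE1] := idem_pid EE1.
exists (\rank E), (\rank E1); split.
  rewrite gdetE /gidem_pert -map_gidem -(map_proj3 inc) -eE.
  set A := 1 + (lam - 1) *: map_gamma inc e.
  set B := 1 + (lam^-1 - 1) *: map_gamma inc (proj3 K).
  have AE i j : A i j = (i == j)%:R + (lam - 1) * inc (e i j) by [].
  have BE i j : B i j = (i == j)%:R + (lam^-1 - 1) * inc (proj3 K i j) by [].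
  have B_off i j : i != j -> B i j = 0.
    by move=> ij; rewrite BE p_off // rmorph0 mulr0 addr0 (negPf ij).
  have ABN : fin_pert N (A * B).
    move=> i j ij; rewrite (@gam_mul1 _ _ _ i j j) => [|r rj]; last by rewrite B_off ?mulr0.
    case: (eqVneq i j) ij => [<-|nij] ij; last first.
      by rewrite AE eN // p_off // rmorph0 mulr0 addr0 (negPf nij) mul0r.
    rewrite AE BE eN; last by case/orP: ij => ->; rewrite ?orbT.
    rewrite proj3E eqxx /=; case: (i %% 3 == 0)%N; rewrite ?rmorph0 ?rmorph1 ?mulr0 ?addr0 ?mul1r //.
    by rewrite !mulr1 ![1 + _]addrC !subrK divff.
  rewrite (fdetE ABN).
  have -> : corner_mx N (A * B) = (1%:M + (lam - 1) *: map_mx inc E) *m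
      (1%:M + (lam^-1 - 1) *: map_mx inc E1).
    apply/matrixP => i j; rewrite !mxE (@gam_mul_ord _ _ _ _ _ N) => [|r Nr].
      by apply: eq_bigr => r _; rewrite AE BE !mxE.
    by rewrite B_off ?mulr0 // gtn_eqF // (leq_trans (ltn_ord j)).
  by rewrite det_mulmx !det_idem ?mxrank_map // -map_mxM ?EE ?EE1.
move=> rEE1.
(* Both corners are conjugate to the same [pid_mx], through [P] and [P1]. *)
pose M := invmx P1 *m P; pose M' := invmx P *m P1.
have MM' : M *m M' = 1%:M by rewrite /M /M' mulmxA mulmxK // mulVmx.
have ME : M *m E = E1 *m M.
  rewrite /M -mulmxA PE rEE1 !mulmxA; congr (_ *m P).
  by rewrite -[LHS](mulmxK Pu1) -[_ *m pid_mx _ *m P1]mulmxA -PE1 mulmxA mulVmx // mul1mx.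
have kk := block_gam_inverses MM'; set k := block_gam M in kk; set k' := block_gam M' in kk.
have kN : fin_pert N k by exact: block_gam_pert.
have k1 : sig k = 1 by apply/fin_pertP; exists N.
have ke : k * e = proj3 K * k.
  apply: gammaP => i j; have [iN|Ni] := ltnP i N; last first.
    rewrite [LHS](@gam_mul1 _ _ _ i j i) => [|r ri]; last first.
      by rewrite kN ?Ni // eq_sym (negPf ri) mul0r.
    rewrite [RHS](@gam_mul1 _ _ _ i j i) => [|r ri]; last by rewrite p_off ?mul0r // eq_sym.
    rewrite [k i i]kN ?Ni // eqxx mul1r eN ?Ni // kN ?Ni //.
    by have [->|ij] := eqVneq i j; rewrite ?mulr1 // mulr0 p_off.
  have [jN|Nj] := ltnP j N; last first.
    rewrite [LHS](@gam_mul1 _ _ _ i j j) => [|r rj]; last first.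
      by rewrite eN ?Nj ?orbT // p_off // mulr0.
    rewrite [RHS](@gam_mul1 _ _ _ i j j) => [|r rj]; last first.
      by rewrite kN ?Nj ?orbT // (negPf rj) mulr0.
    by rewrite kN ?Nj ?orbT // ltn_eqF ?(leq_trans iN) // mul0r p_off ?mul0r // ltn_eqF ?(leq_trans iN).
  rewrite [LHS](@gam_mul_ord _ _ _ _ _ N) => [|r Nr]; last first.
    by rewrite e_off ?mulr0 // jN ltnNge Nr.
  rewrite [RHS](@gam_mul_ord _ _ _ _ _ N) => [|r Nr]; last first.
    by rewrite p_off ?mul0r // ltn_eqF // (leq_trans iN).
  have /matrixP/(_ (Ordinal iN) (Ordinal jN)) := ME.
  rewrite -(block_gam_corner M) -/k !mxE => h.
  transitivity (\sum_j0 corner_mx N k (Ordinal iN) j0 * E j0 (Ordinal jN)).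
    by apply: eq_bigr => r _; rewrite !mxE.
  by rewrite h; apply: eq_bigr => r _; rewrite !mxE.
by apply: (@whdet_lifted _ _ _ (@sig K) _ _ (fan_is_fan K 2) T S k k') => //; rewrite -/(gidem T S) -eE.
Qed.

End FieldDet.

(** * Extension of units by the identity, and determinants of units of Sigma *)

Section Dilation.
Variable B : nzRingType.
Implicit Types x y u v : B.

(** For yx = 1, the unit [u] transported to the corner of the idempotent xy and completed by 1 on
    the complement. *)
Definition dil x y u := x * u * y + (1 - x * y).

Lemma dilM x y u v : y * x = 1 -> dil x y u * dil x y v = dil x y (u * v).
Proof.
move=> yx; rewrite /dil.
have yK b : y * (x * b) = b by rewrite mulrA yx mul1r.
have p1 : (1 - x * y) * (1 - x * y) = 1 - x * y.
  by rewrite mulrBr mulr1 mulrBl mul1r -mulrA yK subrr subr0.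
have p2 b : (1 - x * y) * (x * b * y) = 0.
  by rewrite mulrBl mul1r -!mulrA yK subrr.
have p3 b : (x * b * y) * (1 - x * y) = 0.
  by rewrite mulrBr mulr1 -!mulrA yK subrr.
move: (1 - x * y) p1 p2 p3 => q p1 p2 p3.
by rewrite mulrDl !mulrDr p1 p2 p3 addr0 add0r -!mulrA yK.
Qed.

Lemma dil1 x y : dil x y 1 = 1.
Proof. by rewrite /dil mulr1 addrC subrK. Qed.

Lemma inverses_dil x y u u' : y * x = 1 -> inverses u u' -> inverses (dil x y u) (dil x y u').
Proof. by move=> yx [uu' u'u]; split; rewrite dilM // ?uu' ?u'u dil1. Qed.

Notation o20 := (@Ordinal 2 0 isT).
Notation o21 := (@Ordinal 2 1 isT).

Definition mx2 (a b c d : B) : 'M[B]_2 := \matrix_(i, j)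
  if i == o20 then if j == o20 then a else b else if j == o20 then c else d.

Lemma mx2M a b c d a' b' c' d' : mx2 a b c d *m mx2 a' b' c' d' =
  mx2 (a * a' + b * c') (a * b' + b * d') (c * a' + d * c') (c * b' + d * d').
Proof.
apply/matrixP => i j; rewrite !mxE !big_ord_recl !big_ord0 !mxE addr0.
by case: i => -[|[|//]] ?; case: j => -[|[|//]] ?.
Qed.

Lemma mx2_1 : mx2 1 0 0 1 = 1%:M.
Proof. by apply/matrixP => i j; rewrite !mxE; case: i => -[|[|//]] ?; case: j => -[|[|//]] ?. Qed.

Lemma blk_mx2 (z w : 'I_2 -> B) a b c d : blk z w (mx2 a b c d) =
  z o20 * (a * w o20 + b * w o21) + z o21 * (c * w o20 + d * w o21).
Proof.
rewrite /blk !big_ord_recl !big_ord0.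
have -> : lift ord0 ord0 = o21 by exact: val_inj.
have -> : ord0 = o20 by exact: val_inj.
by rewrite !mxE !addr0.
Qed.

(* In M_2(B), diag(dil x y u, 1) is the conjugate of diag(u, 1) by the unit
   [[x, 1 - xy], [0, y]]. *)
Lemma dil_conj (z w : 'I_2 -> B) x y : is_fan z w -> y * x = 1 ->
  exists V V', inverses V V' /\
    forall u, dil (z o20) (w o20) (dil x y u) = V * dil (z o20) (w o20) u * V'.
Proof.
move=> zw yx.
have yK b : y * (x * b) = b by rewrite mulrA yx mul1r.
pose V := mx2 x (1 - x * y) 0 y; pose V' := mx2 y 0 (1 - x * y) x.
have p1 : (1 - x * y) * (1 - x * y) = 1 - x * y.
  by rewrite mulrBr mulr1 mulrBl mul1r -mulrA yK subrr subr0.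
have p2 : (1 - x * y) * x = 0 by rewrite mulrBl mul1r -mulrA yx mulr1 subrr.
have p3 : y * (1 - x * y) = 0 by rewrite mulrBr mulr1 mulrA yx mul1r subrr.
have VV' : V *m V' = 1%:M.
  by rewrite mx2M p1 p2 p3 !(mul0r, mulr0, add0r) yx addrC subrK mx2_1.
have V'V : V' *m V = 1%:M.
  by rewrite mx2M p1 p2 p3 !(mul0r, mulr0, addr0) yx subrK mx2_1.
have dE u : dil (z o20) (w o20) u = blk z w (mx2 u 0 0 1).
  have [_ /esym zw1] := zw; rewrite !big_ord_recl big_ord0 addr0 in zw1.
  rewrite blk_mx2 !mul0r addr0 add0r mul1r /dil mulrA; congr (_ + _).
  rewrite {1}zw1; have -> : lift ord0 ord0 = o21 by exact: val_inj.
  have -> : ord0 = o20 by exact: val_inj.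
  by rewrite addrC addKr.
exists (blk z w V), (blk z w V'); split; first exact: inverses_blk.
move=> u; rewrite !dE -!(blkM _ _ zw) !mx2M.
by rewrite !(mul0r, mulr0, addr0, add0r, mulr1) yx p1 p2 p3.
Qed.

End Dilation.

Notation o20 := (@Ordinal 2 0 isT).
Notation o21 := (@Ordinal 2 1 isT).

Lemma map_dil (B C : nzRingType) (f : {rmorphism B -> C}) x y u :
  f (dil x y u) = dil (f x) (f y) (f u).
Proof. by rewrite /dil rmorphD rmorphB !rmorphM rmorph1. Qed.

Lemma sig_dil (R : comNzRingType) (x y u : Gam R) :
  sig (dil x y u) = dil (sig x) (sig y) (sig u).
Proof. exact: map_dil. Qed.

Section SigmaFan.
Variable R : comNzRingType.
Definition sfan k (i : 'I_k.+1) : Sig R := sig (fan R i).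
Definition sfan_tr k (i : 'I_k.+1) : Sig R := sig (fan_tr R i).
Lemma sfan_is_fan k : is_fan (@sfan k) (@sfan_tr k).
Proof. exact: (map_is_fan (@sig R) (fan_is_fan R k)). Qed.
Lemma sfan_trK k (i j : 'I_k.+1) : sfan_tr i * sfan j = (i == j)%:R.
Proof. by have [->] := sfan_is_fan k. Qed.
End SigmaFan.

Section MapSigmaFan.
Variables (R R' : comNzRingType) (f : {rmorphism R -> R'}).
Lemma map_sfan k (i : 'I_k.+1) : map_sigma f (sfan R i) = sfan R' i.
Proof. by rewrite /sfan map_sigmaE map_gamma_fan. Qed.
Lemma map_sfan_tr k (i : 'I_k.+1) : map_sigma f (sfan_tr R i) = sfan_tr R' i.
Proof. by rewrite /sfan_tr map_sigmaE map_gamma_fan_tr. Qed.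
End MapSigmaFan.

Section SigmaDet.
Variables (Q Q' : comNzRingType) (f : {rmorphism Q -> Q'}) (lam lam' : Q').
Hypothesis lamK : lam * lam' = 1.
Implicit Types u v : Sig Q.

(** The unit has coefficients in [Q] while [lam] lies in [Q'], so only the lifts are base changed.
    For inverse units the chosen representatives do not matter ([sdetE]). *)
Definition sdet u u' : Q' :=
  gdet lam lam' (map_gamma f (sigma_repr u)) (map_gamma f (sigma_repr u')).

Lemma inverses_map_gamma T S : inverses (sig T) (sig S) ->
  inverses (sig (map_gamma f T)) (sig (map_gamma f S)).
Proof. by move=> TS; rewrite -!map_sigmaE; exact: (inverses_map (map_sigma f)). Qed.

Lemma sdetE T S : inverses (sig T) (sig S) ->
  sdet (sig T) (sig S) = gdet lam lam' (map_gamma f T) (map_gamma f S).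
Proof.
move=> TS; have rT : sig (sigma_repr (sig T)) = sig T by exact: sigma_reprK.
have rS : sig (sigma_repr (sig S)) = sig S by exact: sigma_reprK.
rewrite /sdet; apply: gdet_eq => //; last 2 first.
- by rewrite -!map_sigmaE rT.
- by rewrite -!map_sigmaE rS.
by apply: inverses_map_gamma; rewrite rT rS.
Qed.

Lemma sdetM u u' v v' : inverses u u' -> inverses v v' ->
  sdet (u * v) (v' * u') = sdet u u' * sdet v v'.
Proof.
have [T <-] := sig_surj u; have [T' <-] := sig_surj u'.
have [S <-] := sig_surj v; have [S' <-] := sig_surj v'.
move=> uu vv; have uv := inversesM uu vv.
rewrite -!sigM in uv *.
rewrite !sdetE // !map_gammaM gdetM //; exact: inverses_map_gamma.
Qed.

Lemma sdet_lift T S : inverses T S -> sdet (sig T) (sig S) = 1.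
Proof.
move=> TS; rewrite sdetE; last exact: (inverses_map (@sig Q)).
by apply: gdet_lift => //; exact: (inverses_map (map_gamma f)).
Qed.

Lemma sdetV u u' : inverses u u' -> sdet u u' * sdet u' u = 1.
Proof.
move=> uu; have u'u := inverses_sym uu; rewrite -sdetM // uu.1 -(sig1 Q).
exact: sdet_lift (inverses1 _).
Qed.

End SigmaDet.

(** The square of coefficient rings to keep in mind is evaluation of polynomials over [K] against
    evaluation of polynomials over the field containing lam. *)
Lemma map_sdet (P Q Q' Q'' : comNzRingType) (g : {rmorphism P -> Q}) (f : {rmorphism P -> Q'})
    (h : {rmorphism Q' -> Q''}) (f' : {rmorphism Q -> Q''}) lam lam' u u' :
  lam * lam' = 1 -> (forall x, h (f x) = f' (g x)) -> inverses u u' ->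
  sdet f' (h lam) (h lam') (map_sigma g u) (map_sigma g u') = h (sdet f lam lam' u u').
Proof.
move=> lamK hf; have [T <-] := sig_surj u; have [S <-] := sig_surj u'.
move=> TS; have TS' := inverses_map_gamma g TS; rewrite !map_sigmaE.
have hlam : h lam * h lam' = 1 by rewrite -rmorphM lamK rmorph1.
have mm X : map_gamma f' (map_gamma g X) = map_gamma h (map_gamma f X).
  by apply: gammaP => i j /=; rewrite hf.
have E1 := sdetE f' hlam TS'; have E2 := sdetE f lamK TS.
have E3 := map_gdet h lamK (inverses_map_gamma f TS).
apply: (etrans E1); apply: esym; apply: (etrans (congr1 h E2)); apply: (etrans (esym E3)).
exact: (f_equal2 (gdet (h lam) (h lam')) (esym (mm T)) (esym (mm S))).
Qed.

Lemma poly_mul_eq1 (F : fieldType) (p q : {poly F}) : p * q = 1 -> exists c, p = c%:P.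
Proof.
move=> pq; have /andP[p0 q0] : (p != 0) && (q != 0).
  by rewrite -negb_or -mulf_eq0 pq oner_neq0.
have := congr1 (size : {poly F} -> nat) pq; rewrite size_mul // size_poly1 => s1.
exists p`_0; apply: size1_polyC; move: p0 q0 s1; rewrite -!size_poly_gt0.
by case: (size p) => [|[|m]] //; case: (size q) => [|n] //; rewrite !addSn addnS.
Qed.

(** * The Fredholm index *)

Section FredholmIndex.
Variable K : fieldType.

(** The powers of lam must be pairwise distinct for the exponent to be an integer, and a finite [K]
    has no element of infinite order; a variable has. *)
Definition ratfun : fieldType := {fraction {poly K}}.
Definition to_ratfun : {rmorphism K -> ratfun} := @tofrac {poly K} \o @polyC K.
Definition ratX : ratfun := tofrac 'X.

Lemma ratX_neq0 : ratX != 0.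
Proof. by rewrite tofrac_eq0 polyX_eq0. Qed.

Lemma ratXK : ratX * ratX^-1 = 1.
Proof. exact: divff ratX_neq0. Qed.

Lemma ratX_exp_inj (m n : nat) : ratX ^+ m = ratX ^+ n -> m = n.
Proof.
move/eqP; rewrite /ratX -!tofracXn tofrac_eq => /eqP /(congr1 (size : {poly K} -> nat)).
by rewrite !size_polyXn => -[].
Qed.

Lemma ratX_expz_inj (m n : int) : ratX ^ m = ratX ^ n -> m = n.
Proof.
have h (k : int) : ratX ^ k = 1 -> k = 0.
  case: k => k h; first by congr Posz; apply: ratX_exp_inj; rewrite expr0.
  have {}h : ratX ^+ k.+1 = 1 by apply: invr_inj; rewrite invr1; exact: h.
  by have /ratX_exp_inj : ratX ^+ k.+1 = ratX ^+ 0 by rewrite expr0.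
move=> mn; apply/eqP; rewrite -subr_eq0; apply/eqP/h.
by rewrite expfzDr ?ratX_neq0 // mn -expfzDr ?ratX_neq0 // subrr expr0z.
Qed.

Local Notation X0 := (sfan K o20).
Local Notation Y0 := (sfan_tr K o20).

Lemma Y0X0 : Y0 * X0 = 1. Proof. by rewrite sfan_trK. Qed.

(** The preliminary dilation leaves a complementary corner, in which [dil_conj] realizes any further
    dilation as a conjugation. The price is that index 0 lifts only the dilated unit ([ind_eq0]). *)
Definition kdet (u u' : Sig K) : ratfun := sdet to_ratfun ratX ratX^-1 (dil X0 Y0 u) (dil X0 Y0 u').

Lemma kdetM u u' v v' : inverses u u' -> inverses v v' ->
  kdet (u * v) (v' * u') = kdet u u' * kdet v v'.
Proof.
move=> uu vv; rewrite /kdet -(dilM _ _ Y0X0) -(dilM _ _ Y0X0).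
by apply: (sdetM _ ratXK); apply: inverses_dil Y0X0 _.
Qed.

Lemma kdet_field u u' : inverses u u' -> exists n : int, kdet u u' = ratX ^ n /\
  (n = 0 -> exists g g', inverses g g' /\ sig g = dil X0 Y0 u).
Proof.
move=> /(inverses_dil Y0X0); rewrite /kdet.
move: (dil _ _ u) (dil _ _ u') => v v' vv.
have [T TE] := sig_surj v; have [S SE] := sig_surj v'; rewrite -TE -SE in vv *.
rewrite sdetE //; last exact: ratXK.
have [r [r' [-> h]]] := gdet_field to_ratfun ratX_neq0 vv.
exists (r%:Z - r'%:Z); split.
  by rewrite expfzDr ?ratX_neq0 // -exprz_inv.
by move/eqP; rewrite subr_eq0 => /eqP[rr']; apply: h.
Qed.

(* [0] when [u] is not a unit *)
Definition ind (u : Sig K) : int :=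
  if pselect (exists n u', inverses u u' /\ kdet u u' = ratX ^ n) is left ex
  then projT1 (cid ex) else 0.

Lemma ind_unique u u' n : inverses u u' -> kdet u u' = ratX ^ n -> ind u = n.
Proof.
move=> uu uE; rewrite /ind; case: pselect => [ex|[]]; last by exists n, u'.
case: cid => m /= [u'' [uu'' uE']]; apply: ratX_expz_inj.
by rewrite -uE -uE' (inverses_unique uu uu'').
Qed.

Lemma indE u u' : inverses u u' -> kdet u u' = ratX ^ ind u.
Proof. by move=> uu; have [n [nE _]] := kdet_field uu; rewrite (ind_unique uu nE). Qed.

Lemma indM u u' v v' : inverses u u' -> inverses v v' -> ind (u * v) = ind u + ind v.
Proof.
move=> uu vv; apply: (ind_unique (inversesM uu vv)).
by rewrite kdetM // !indE // -expfzDr // ratX_neq0.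
Qed.

Lemma ind1 : ind 1 = 0.
Proof. by apply: (addrI (ind 1)); rewrite addr0 -(indM (inverses1 _) (inverses1 _)) mulr1. Qed.

Lemma indV u u' : inverses u u' -> ind u' = - ind u.
Proof.
move=> uu; apply/eqP; rewrite -addr_eq0 addrC -(indM uu (inverses_sym uu)) uu.1.
by rewrite ind1.
Qed.

(** After the dilation built into [kdet], dilating by [x] and [y] is a conjugation, invisible to a
    multiplicative invariant with commutative values. *)
Lemma ind_dil x y u u' : y * x = 1 -> inverses u u' -> ind (dil x y u) = ind u.
Proof.
move=> yx uu; apply: (ind_unique (inverses_dil yx uu)); rewrite -(indE uu) /kdet.
have [V [V' [VV VE]]] := dil_conj (sfan_is_fan K 1) yx; rewrite !VE.
have [uX u'X] := inverses_dil Y0X0 uu.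
have h1 := inversesM VV (conj uX u'X).
have -> : V * dil X0 Y0 u' * V' = V * (dil X0 Y0 u' * V') by rewrite mulrA.
rewrite (sdetM _ ratXK h1 (inverses_sym VV)) (sdetM _ ratXK VV (conj uX u'X)).
by rewrite mulrAC (sdetV _ ratXK VV) mul1r.
Qed.

Lemma ind_lift T S : inverses T S -> ind (sig T) = 0.
Proof.
move=> TS; apply: (ind_unique (inverses_map (@sig K) TS)); rewrite /kdet.
rewrite -!sig_dil sdet_lift ?ratXK //.
by apply: inverses_dil => //; exact: fan_trK.
Qed.

Lemma ind_eq0 u u' : inverses u u' -> ind u = 0 ->
  exists g g', inverses g g' /\ sig g = dil X0 Y0 u.
Proof.
by move=> uu u0; have [n [nE]] := kdet_field uu; apply; rewrite -(ind_unique uu nE).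
Qed.

Definition shiftr : Gam K := shift_mx K^o leqnSn.
Definition shiftl : Gam K := shift_tr K^o leqnSn.

Lemma shiftlr : shiftl * shiftr = 1.
Proof.
apply: gammaP => i j; rewrite (@gam_mul1 _ _ _ i j i.+1) => [|r /negPf ri]; last first.
  by rewrite /= ri mul0r.
by rewrite /= eqxx mul1r.
Qed.

Lemma shiftrl : shiftr * shiftl = 1 - unit00 K.
Proof.
apply: gammaP => i j; rewrite (@gam_mul1 _ _ _ i j i.-1) => [|r ri]; last first.
  by rewrite /= (_ : i == r.+1 = false) ?mul0r //; apply: contra_neqF ri => /eqP ->.
rewrite gamBE gam1E /=; case: i => [|i] /=; first by case: j => [|j]; rewrite mul0r ?subrr // subr0.
by rewrite eqxx mul1r subr0 eq_sym.
Qed.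

Lemma ind_shift : inverses (sig shiftr) (sig shiftl) /\ ind (sig shiftr) = - 1.
Proof.
have SS : inverses (sig shiftr) (sig shiftl).
  split; rewrite -sigM ?shiftlr // shiftrl sigB sig1.
  suff -> : sig (unit00 K) = 0 by rewrite subr0.
  apply/sig_eq0/MinftyP; exists 1%N => i j /=.
  by case/orP; case: i => //; case: j => // *; rewrite andbF.
split=> //; apply: (ind_unique SS); rewrite /kdet -!sig_dil.
rewrite sdetE; first last.
- by rewrite !map_dil; exact: inverses_dil Y0X0 SS.
- exact: ratXK.
have YX : fan_tr K o20 * fan K o20 = 1 by rewrite fan_trK.
apply: (gdet_shift ratXK); rewrite -map_gammaM dilM //.
  by rewrite shiftlr dil1 map_gamma1.
have -> : dil (fan K o20) (fan_tr K o20) (shiftr * shiftl) = 1 - unit00 K.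
  rewrite shiftrl /dil mulrBr mulr1 mulrBl fan_unit00 unit00_fan_tr.
  by rewrite addrC addrA subrK.
by rewrite map_gammaB map_gamma1 map_unit00.
Qed.

Lemma ind_surj n : exists u u', inverses u u' /\ ind u = n.
Proof.
have [SS indS] := ind_shift.
have pos (k : nat) : exists u u', inverses u u' /\ ind u = - k%:Z.
  elim: k => [|k [u [u' [uu uk]]]]; first by exists 1, 1; rewrite ind1; split=> //; exact: inverses1.
  exists (u * sig shiftr), (sig shiftl * u'); split; first exact: inversesM.
  by rewrite (indM uu SS) uk indS -opprD addrC -intS.
case: n => k.
  have [u [u' [uu uk]]] := pos k; exists u', u; split; first exact: inverses_sym.
  by rewrite (indV uu) uk opprK.
by have [u [u' [uu uk]]] := pos k.+1; exists u, u'.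
Qed.

(* The determinant of a polynomial loop is a unit of F[t], hence constant. *)
Lemma ind_homotopy (u u' : Sig {poly K}) : inverses u u' ->
  ind (map_sigma (horner_eval 0) u) = ind (map_sigma (horner_eval 1) u).
Proof.
move=> uu; pose f : {rmorphism {poly K} -> {poly ratfun}} := map_poly to_ratfun.
have lamK : ratX%:P * (ratX^-1)%:P = 1 by rewrite -polyCM ratXK.
pose v := dil (sfan {poly K} o20) (sfan_tr {poly K} o20) u.
pose v' := dil (sfan {poly K} o20) (sfan_tr {poly K} o20) u'.
have vv : inverses v v' by apply: inverses_dil; rewrite // sfan_trK.
have [c cE] : exists c, sdet f ratX%:P (ratX^-1)%:P v v' = c%:P.
  exact: poly_mul_eq1 (sdetV f lamK vv).
have evE (a : K) : ratX ^ ind (map_sigma (horner_eval a) u) = c.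
  rewrite -(indE (inverses_map (map_sigma (horner_eval a)) uu)) /kdet.
  rewrite -(map_sfan (horner_eval a) o20) -(map_sfan_tr (horner_eval a) o20) -!map_dil.
  pose h : {rmorphism {poly ratfun} -> ratfun} := horner_eval (to_ratfun a).
  pose g : {rmorphism {poly K} -> K} := horner_eval a.
  have hX b : h b%:P = b by rewrite /h /= /horner_eval hornerC.
  have hf x : h (f x) = to_ratfun (g x) by rewrite /h /g /= /horner_eval horner_map.
  have E := etrans (map_sdet lamK hf vv) (etrans (congr1 h cE) (hX c)).
  exact: etrans (f_equal2 (fun x y => sdet to_ratfun x y _ _) (esym (hX _)) (esym (hX _))) E.
exact: ratX_expz_inj (etrans (evE 0) (esym (evE 1))).
Qed.

End FredholmIndex.

(** * Lifting and absorbing idempotents *)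

Section PolyRows.
Variable K : fieldType.
Implicit Types d : {poly K}.

(** [d] is a gcd of the entries, found as a nonzero combination of them of least size: the remainder
    of an entry by [d] is again a combination, hence 0. The coefficients [c] of the combination
    witness that z / d is unimodular. *)
Lemma poly_row_primitive n (z : 'rV[{poly K}]_n) : z != 0 ->
  exists d z' (c : 'cV_n), [/\ d != 0, z = d *: z' & z' *m c = 1%:M].
Proof.
move=> z0; pose val (c : 'cV[{poly K}]_n) := (z *m c) 0 0.
pose P m := `[< exists c, val c != 0 /\ size (val c) = m >].
have val_delta j : val (delta_mx j 0) = z 0 j.
  rewrite /val mxE (bigD1 j) //= big1 => [|k kj]; last by rewrite mxE (negPf kj) mulr0.
  by rewrite mxE !eqxx mulr1 addr0.
have exP : exists m, P m.
  have [j zj] : exists j, z 0 j != 0.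
    apply: contrapT => h; move/eqP: z0; apply; apply/rowP => j; rewrite mxE.
    by apply/eqP; apply: contrapT => zj; apply: h; exists j; apply/negP.
  by exists (size (z 0 j)); apply/asboolP; exists (delta_mx j 0); rewrite val_delta.
case: (ex_minnP exP) => m /asboolP[c [c0 cm]] m_min; set d := val c in c0 cm.
have dvd j : z 0 j = z 0 j %/ d * d.
  have {1}-> : z 0 j = z 0 j %/ d * d + z 0 j %% d by exact: divp_eq.
  suff -> : z 0 j %% d = 0 by rewrite addr0.
  apply/eqP; apply: contrapT => /negP r0.
  have rE : val (delta_mx j 0 - (z 0 j %/ d) *: c) = z 0 j %% d.
    rewrite /val mulmxBr -scalemxAr mxE [X in X + _]val_delta mxE [in X in _ - X]mxE -/(val c) -/d.
    by rewrite {1}(divp_eq (z 0 j) d) addrC addKr.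
  have : (m <= size (z 0 j %% d)%R)%N.
    by apply: m_min; apply/asboolP; exists (delta_mx j 0 - (z 0 j %/ d) *: c); rewrite rE.
  by rewrite -cm leqNgt ltn_modp c0.
exists d, (\row_j (z 0 j %/ d)), c; split=> //.
  by apply/rowP => j; rewrite !mxE mulrC -dvd.
apply/matrixP => i j; rewrite !ord1 [RHS]mxE eqxx; apply: (mulfI c0); rewrite mulr1.
rewrite mxE mulr_sumr -[RHS]/(val c) /val [RHS]mxE; apply: eq_bigr => k _.
by rewrite mxE mulrA [_ * (_ %/ _)]mulrC -dvd.
Qed.

Lemma scalemx_eq0 m n (d : {poly K}) (A : 'M_(m, n)) : d != 0 -> d *: A = 0 -> A = 0.
Proof.
move=> d0 /matrixP dA; apply/matrixP => i j; have /eqP := dA i j.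
by rewrite !mxE mulf_eq0 (negPf d0) => /eqP.
Qed.

(* The saturation of the column space of [x] is a direct summand: descend on the
   rank of [q] at 0, removing from [q] a primitive row [z' = z' q] with [z' x = 0]. *)
Lemma poly_saturation N (x : 'M[{poly K}]_N) : exists q : 'M_N,
  [/\ q *m q = q, q *m x = x & forall y : 'rV_N, y *m x = 0 -> y *m q = 0].
Proof.
suff: forall n (q : 'M_N), (\rank (map_mx (horner_eval 0) q) <= n)%N -> q *m q = q -> q *m x = x ->
  exists q : 'M_N, [/\ q *m q = q, q *m x = x & forall y : 'rV_N, y *m x = 0 -> y *m q = 0].
  by move=> /(_ N 1%:M (rank_leq_row _)); apply; rewrite mul1mx.
elim=> [|n IH] q rq qq qx.
all: have [h|] := pselect (forall y : 'rV_N, y *m x = 0 -> y *m q = 0); first by exists q.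
all: move=> /existsNP[y /not_implyP[yx /eqP yq]].
all: have [d [z [c [d0 zE zc]]]] := poly_row_primitive yq.
all: have zq : z *m q = z by
  apply/eqP; rewrite -subr_eq0; apply/eqP/(scalemx_eq0 d0);
  rewrite scalerBr scalemxAl -zE -mulmxA qq subrr.
all: pose Z := map_mx (horner_eval 0) z; pose Q := map_mx (horner_eval 0) q.
all: have ZQ : Z *m Q = Z by rewrite -map_mxM zq.
all: have Z0 : Z != 0 by
  apply/eqP => Z0; have := congr1 (map_mx (horner_eval 0)) zc;
  rewrite map_mxM -/Z Z0 mul0mx map_mx1 => /matrixP/(_ 0 0)/eqP; rewrite !mxE eq_sym oner_eq0.
  (* Rank 0 is impossible, as [Z] is nonzero and fixed by [Q]. *)
  by move: rq; rewrite leqn0 mxrank_eq0 -/Q => /eqP Q0; rewrite -ZQ Q0 mulmx0 eqxx in Z0.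
have zx : z *m x = 0.
  by apply: (scalemx_eq0 d0); rewrite scalemxAl -zE -mulmxA qx.
pose q1 := q - q *m c *m z.
have zq1 : z *m q1 = 0 by rewrite mulmxBr !mulmxA zq zc mul1mx subrr.
have q1q : q1 *m q = q1 by rewrite mulmxBl qq -(mulmxA (q *m c)) zq.
have q1c : q1 *m c = 0 by rewrite mulmxBl -(mulmxA (q *m c)) zc mulmx1 subrr.
have q1q1 : q1 *m q1 = q1 by rewrite {2}/q1 mulmxBr 2!mulmxA q1q q1c mul0mx subr0.
apply: (IH q1) => //; last by rewrite mulmxBl qx -(mulmxA (q *m c)) zx mulmx0 subr0.
pose Q1 := map_mx (horner_eval 0) q1.
(* The rank at 0 drops strictly: [Z] lies in the row space of [Q], but in that of the idempotent
   [Q1] it would be fixed by [Q1], which kills it. *)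
rewrite -ltnS; apply: leq_trans rq; apply: rank_ltmx; rewrite ltmxE -/Q -/Q1; apply/andP; split.
  by apply/submxP; exists Q1; rewrite -map_mxM q1q.
apply/negP => QQ1; have /submxP[w ZE] : (Z <= Q1)%MS.
  by apply: submx_trans QQ1; apply/submxP; exists Z; rewrite ZQ.
have : Z *m Q1 = 0 by rewrite -map_mxM zq1 map_mx0.
by rewrite {1}ZE -mulmxA -map_mxM q1q1 -/Q1 -ZE => /eqP; rewrite (negPf Z0).
Qed.

End PolyRows.

(** [q] generates the left annihilator of x = a^2 - a. Since [a] commutes with x it preserves this
    annihilator, so qaq = qa, and then (qa)^2 - qa = qx = 0. *)
Lemma compress_idem (B : nzRingType) (a q : B) : q * q = q -> q * (a * a - a) = 0 ->
  (forall b, b * (a * a - a) = 0 -> b * q = b) ->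
  (q * a * q) * (q * a * q) = q * a * q.
Proof.
move=> qq qx hq; set x := a * a - a in qx hq.
have ax : a * x = x * a by rewrite /x mulrBr mulrBl mulrA.
have qaq : q * a * q = q * a by apply: hq; rewrite -mulrA ax mulrA qx mul0r.
rewrite qaq mulrA qaq -mulrA; apply/eqP; rewrite -subr_eq0 -mulrBr; exact/eqP.
Qed.

(** The defect x = a^2 - a of a lift is a finite matrix over K[t]. Its column space need not be a
    direct summand, but the saturation is; compressing [a] by the projection 1 - q that kills it,
    extended by 1, changes [a] by a finite matrix and makes it idempotent. *)
Lemma lift_idem (K : fieldType) (p : Sig {poly K}) : p * p = p ->
  exists P, P * P = P /\ sig P = p.
Proof.
have [a <-] := sig_surj p; rewrite -sigM => /sigP/MinftyP[N xN].
move: (a * a - a) (@compress_idem (Gam {poly K}) a) xN => x compress xN.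
have [q [qq qx q_sat]] := poly_saturation (corner_mx N x).
pose Q := block_gam (1%:M - q).
have QN : fin_pert N Q by exact: block_gam_pert.
have QE (i j : 'I_N) : Q i j = (i == j)%:R - q i j.
  by have /matrixP/(_ i j) := block_gam_corner (1%:M - q); rewrite !mxE.
have sigQ : sig Q = 1 by apply/fin_pertP; exists N.
exists (Q * a * Q); split; last by rewrite !sigM sigQ mulr1 mul1r.
apply: compress.
- have [h1 h2] := fin_pertM QN QN; apply: (fin_pert_inj h1 QN).
  rewrite h2 !block_gam_corner mulmxBr mulmx1 mulmxBl mul1mx qq subrr subr0 //.
- apply: gammaP => i j; have [iN|Ni] := ltnP i N; last first.
    rewrite gam_mul0 // => k; have [<-|ik] := eqVneq i k; first by rewrite xN ?Ni ?mulr0.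
    by rewrite QN ?Ni // (negPf ik) mul0r.
  have [jN|Nj] := ltnP j N; last by rewrite gam_mul0 // => k; rewrite xN ?Nj ?orbT ?mulr0.
  rewrite (@gam_mul_ord _ _ _ _ _ N) => [|k Nk]; last by rewrite xN ?Nk ?mulr0.
  have /matrixP/(_ (Ordinal iN) (Ordinal jN)) : (1%:M - q) *m corner_mx N x = 0.
    by rewrite mulmxBl mul1mx qx subrr.
  rewrite -(block_gam_corner (1%:M - q)) !mxE => h; rewrite -[RHS]h.
  by apply: eq_bigr => k _; rewrite !mxE.
- move=> b bx; apply: gammaP => i j; have [jN|Nj] := ltnP j N; last first.
    rewrite (@gam_mul1 _ _ _ i j j) => [|k kj]; last first.
      by rewrite QN ?Nj ?orbT // (negPf kj) mulr0.
    by rewrite QN ?Nj ?orbT // eqxx mulr1.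
  rewrite (@gam_mul_ord _ _ _ _ _ N) => [|k Nk]; last first.
    by rewrite QN ?Nk // gtn_eqF ?mulr0 // (leq_trans jN).
  pose y : 'rV[{poly K}]_N := \row_k b i k.
  have /q_sat/rowP/(_ (Ordinal jN)) : y *m corner_mx N x = 0.
    apply/rowP => k; rewrite !mxE; transitivity ((b * x) i k); last by rewrite bx.
    rewrite (@gam_mul_ord _ _ _ _ _ N) => [|r Nr]; last by rewrite xN ?Nr ?mulr0.
    by apply: eq_bigr => r _; rewrite !mxE.
  rewrite !mxE => yq.
  under eq_bigr => k _ do rewrite (QE k (Ordinal jN)) mulrBr.
  rewrite sumrB (bigD1 (Ordinal jN)) //= eqxx mulr1 big1 => [|k kj]; last first.
    by rewrite (negPf kj) mulr0.
  rewrite addr0 -[RHS]subr0 -[in RHS]yq; congr (_ - _).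
  by apply: eq_bigr => k _; rewrite !mxE.
Qed.

Lemma fan2_conjM (B : nzRingType) (x1 x2 y1 y2 a a' b b' : B) :
  y1 * x1 = 1 -> y1 * x2 = 0 -> y2 * x1 = 0 -> y2 * x2 = 1 ->
  (x1 * a * y1 + x2 * b * y2) * (x1 * a' * y1 + x2 * b' * y2) =
  x1 * (a * a') * y1 + x2 * (b * b') * y2.
Proof.
move=> h11 h12 h21 h22.
have e (x y z w u v : B) : (x * u * y) * (z * v * w) = x * u * (y * z) * (v * w).
  by rewrite !mulrA.
by rewrite mulrDl !mulrDr !e h11 h12 h21 h22 !mulr0 !mul0r !mulr1 addr0 add0r !mulrA.
Qed.

(** With + for direct sums, A = P + A gives P + 1 = P + A + (1 - A) = A + (1 - A) = 1. The first map
    inserts the new copy of [P] in front; the second shifts the copies inside [A] and fixes 1 -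
    A. *)
Lemma swindle (B : nzRingType) (x1 x2 y1 y2 P A : B) :
  y1 * x1 = 1 -> y1 * x2 = 0 -> y2 * x1 = 0 -> y2 * x2 = 1 ->
  P * P = P -> A * A = A -> A = x1 * P * y1 + x2 * A * y2 ->
  exists s1 s2 t1 t2 : B,
  [/\ t1 * s1 = P, t1 * s2 = 0, t2 * s1 = 0, t2 * s2 = 1 & s1 * t1 + s2 * t2 = 1].
Proof.
move=> h11 h12 h21 h22 PP AA AE.
have y1A : y1 * A = P * y1.
  by rewrite {1}AE mulrDr !mulrA h11 h12 mul1r !mul0r addr0.
have y2A : y2 * A = A * y2.
  by rewrite {1}AE mulrDr !mulrA h21 h22 mul1r !mul0r add0r.
have Ax1 : A * x1 = x1 * P.
  by rewrite {1}AE mulrDl -!mulrA h11 h21 !mulr1 !mulr0 addr0.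
have Ax2 : A * x2 = x2 * A.
  by rewrite {1}AE mulrDl -!mulrA h12 h22 !mulr1 !mulr0 add0r.
pose A' := 1 - A.
have AA' : A * A' = 0 by rewrite mulrBr mulr1 AA subrr.
have A'A : A' * A = 0 by rewrite mulrBl mul1r AA subrr.
have A'A' : A' * A' = A' by rewrite {2}/A' mulrBr mulr1 A'A subr0.
have A'D : A + A' = 1 by rewrite addrC subrK.
have y1A' : y1 * A' = (1 - P) * y1 by rewrite mulrBr mulr1 mulrBl mul1r y1A.
have A'x1 : A' * x1 = x1 * (1 - P) by rewrite mulrBr mulr1 mulrBl mul1r Ax1.
have y2A' : y2 * A' = A' * y2 by rewrite mulrBr mulr1 mulrBl mul1r y2A.
have A'x2 : A' * x2 = x2 * A' by rewrite mulrBr mulr1 mulrBl mul1r Ax2.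
have P1 : P * (1 - P) = 0 by rewrite mulrBr mulr1 PP subrr.
have P2 : (1 - P) * P = 0 by rewrite mulrBl mul1r PP subrr.
exists (x1 * P), (x2 * A + A'), (P * y1), (A * y2 + A').
move: A' AA' A'A A'A' A'D y1A' A'x1 y2A' A'x2 => A' AA' A'A A'A' A'D y1A' A'x1 y2A' A'x2.
split.
- by rewrite mulrA -[P * y1 * x1]mulrA h11 mulr1.
- rewrite mulrDr (mulrA (P * y1)) -(mulrA P y1 x2) h12 mulr0 mul0r add0r.
  by rewrite -mulrA y1A' mulrA P1 mul0r.
- rewrite mulrDl (mulrA (A * y2)) -(mulrA A y2) h21 mulr0 mul0r add0r.
  by rewrite mulrA A'x1 -mulrA P2 mulr0.
- rewrite mulrDl !mulrDr A'A' (mulrA (A * y2)) -(mulrA A y2) h22 mulr1 AA.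
  rewrite -(mulrA A y2 A') y2A' (mulrA A A' y2) AA' mul0r addr0.
  by rewrite (mulrA A' x2) A'x2 -mulrA A'A mulr0 add0r.
- rewrite mulrDl !mulrDr A'A' (mulrA (x1 * P)) -(mulrA x1 P) PP.
  rewrite (mulrA (x2 * A)) -(mulrA x2 A A) AA -(mulrA x2 A A') AA' mulr0 addr0.
  by rewrite (mulrA A' A) A'A mul0r add0r addrA -AE.
Qed.

(** * Countable direct sums of a matrix *)

Section InfiniteSum.
Variable R : comNzRingType.
Implicit Types (a A : Gam R).

Local Notation X0 := (fan R o20).
Local Notation X1 := (fan R o21).
Local Notation Y0 := (fan_tr R o20).
Local Notation Y1 := (fan_tr R o21).

Lemma fan_conjE k (i i' j j' : 'I_k.+1) a m n :
  (fan R i * a * fan_tr R j) (k.+1 * m + i')%N (k.+1 * n + j')%N =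
  if (i == i') && (j == j') then a m n else 0.
Proof.
have aE r c : (fan R i * a) (k.+1 * r + i')%N c = if i == i' then a r c else 0.
  rewrite (@gam_mul1 _ _ _ _ c r) => [|s /negPf sr] /=.
    by rewrite eq_fan_idx eqxx /= eq_sym; case: eqP => _; rewrite ?mul1r ?mul0r.
  by rewrite eq_fan_idx eq_sym sr mul0r.
rewrite (@gam_mul1 _ _ _ _ _ n) => [|s /negPf sn].
  rewrite aE /= eq_fan_idx eqxx /= [j' == j]eq_sym.
  by case: eqP => _; case: eqP => _; rewrite ?mulr1 ?mulr0 ?mul0r.
by rewrite /= eq_fan_idx eq_sym sn mulr0.
Qed.

(** Writing i + 1 = 2^v (2k + 1) identifies indices with pairs (v, k), the number of a copy and the
    position in it. The isometry m -> 2m enumerates copy 0 and m -> 2m + 1 moves each copy to the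
    next, whence the recursion [isumE]. *)
Definition val2 i := logn 2 i.+1.
Definition idx2 i := ((i.+1 %/ 2 ^ val2 i)./2)%N.

Lemma val2_even m : val2 (2 * m) = 0%N.
Proof. by rewrite /val2 logn_coprime // coprime2n /= oddM. Qed.
Lemma idx2_even m : idx2 (2 * m) = m.
Proof. by rewrite /idx2 val2_even divn1 mul2n /= uphalf_double. Qed.
Lemma double_succ m : ((2 * m + 1).+1 = 2 * m.+1)%N.
Proof. by rewrite addn1 mulnS. Qed.
Lemma val2_odd m : val2 (2 * m + 1) = (val2 m).+1.
Proof. by rewrite /val2 double_succ lognM // lognn. Qed.
Lemma idx2_odd m : idx2 (2 * m + 1) = idx2 m.
Proof. by rewrite /idx2 val2_odd double_succ expnS divnMl. Qed.

Lemma half_ind (P : nat -> Prop) : (forall m, P (2 * m)%N) ->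
  (forall m, P m -> P (2 * m + 1)%N) -> forall n, P n.
Proof.
move=> P0 P1; elim/ltn_ind => n IH; have nE := odd_double_half n.
rewrite -nE; case: (odd n) nE => nE; last by rewrite add0n -mul2n.
by rewrite add1n -addn1 -mul2n; apply: P1; apply: IH; lia.
Qed.

Lemma lt_idx2 i : (i < 2 ^ val2 i * (2 * idx2 i).+1)%N.
Proof.
elim/half_ind: i => m; first by rewrite val2_even idx2_even mul1n.
by rewrite val2_odd idx2_odd expnS -mulnA; lia.
Qed.

Definition isum_fun a i j : R^o := if val2 i == val2 j then a (idx2 i) (idx2 j) else 0.

Lemma isum_subproof a : rcfinite (isum_fun a).
Proof.
rewrite /isum_fun; apply/rcfiniteP; split=> i.
- have [N aN] := gamma_row a (idx2 i); exists (2 ^ val2 i * (2 * N).+1)%N => j ij.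
  case: eqP => // vE; apply: aN; rewrite leqNgt; apply/negP => jN.
  have := lt_idx2 j; rewrite -vE ltnNge => /negP; apply; apply: leq_trans ij.
  by rewrite leq_mul2l; lia.
- have [N aN] := gamma_col a (idx2 i); exists (2 ^ val2 i * (2 * N).+1)%N => j ij.
  case: eqP => // vE; apply: aN; rewrite leqNgt; apply/negP => jN.
  have := lt_idx2 j; rewrite vE ltnNge => /negP; apply; apply: leq_trans ij.
  by rewrite leq_mul2l; lia.
Qed.

(* the block diagonal sum of countably many copies of [a], on the partition of
   the indices according to the 2-adic valuation of their successor *)
Definition isum a : Gam R := MkGamma (isum_subproof a).

Lemma gam_half_ext a A : (forall (i j : 'I_2) m n,
  a (2 * m + i)%N (2 * n + j)%N = A (2 * m + i)%N (2 * n + j)%N) -> a = A.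
Proof.
move=> aA; apply: gammaP => i j.
have E n : n = (2 * (n %/ 2) + Ordinal (ltn_pmod n (isT : 0 < 2)))%N by rewrite mulnC -divn_eq.
by rewrite (E i) (E j) aA.
Qed.

Lemma isumE a : isum a = X0 * a * Y0 + X1 * isum a * Y1.
Proof.
apply: gam_half_ext => i j m n; rewrite gaddE !fan_conjE /= /isum_fun.
case: i => -[|[|//]] i2; case: j => -[|[|//]] j2 /=;
  rewrite ?addn0 ?val2_even ?val2_odd ?idx2_even ?idx2_odd ?addr0 ?add0r //.
Qed.

(** The difference C of two solutions satisfies C = X1 C Y1: its even rows vanish, and row 2m + 1
    vanishes with row m. Multiplicativity and unitality of [isum] follow without looking at
    entries. *)
Lemma isum_unique a A : A = X0 * a * Y0 + X1 * A * Y1 -> A = isum a.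
Proof.
move=> AE; apply/eqP; rewrite -subr_eq0; apply/eqP; set C := A - isum a.
have CE : C = X1 * C * Y1.
  by rewrite mulrBr mulrBl /C {1}AE {1}isumE opprD addrACA subrr add0r.
apply: gammaP => i; elim/half_ind: i => [m|m IH] j.
all: have E n : n = (2 * (n %/ 2) + Ordinal (ltn_pmod n (isT : 0 < 2)))%N by rewrite mulnC -divn_eq.
  by rewrite CE -[(2 * m)%N]addn0 (E j) (@fan_conjE 1 _ o20).
by rewrite CE (E j) (@fan_conjE 1 _ o21); case: ifP => // _; exact: IH.
Qed.

Lemma isumM a b : isum (a * b) = isum a * isum b.
Proof.
apply/esym/isum_unique; rewrite {1}[isum a]isumE {1}[isum b]isumE.
by apply: fan2_conjM; rewrite fan_trK.
Qed.

Lemma isum1 : isum 1 = 1.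
Proof.
apply/esym/isum_unique; have [_] := fan_is_fan R 1.
rewrite !big_ord_recl big_ord0 addr0 !mulr1 => <-.
by congr (_ * _ + _ * _); congr (fan R _) || congr (fan_tr R _); apply: val_inj.
Qed.

(* The Eilenberg swindle, with [isum P] as the infinite sum. *)
Lemma absorb_idem P : P * P = P -> exists s1 s2 t1 t2 : Gam R,
  [/\ t1 * s1 = P, t1 * s2 = 0, t2 * s1 = 0, t2 * s2 = 1 & s1 * t1 + s2 * t2 = 1].
Proof.
move=> PP; have AA : isum P * isum P = isum P by rewrite -isumM PP.
have AE := isumE P.
by apply: (@swindle (Gam R) X0 X1 Y0 Y1 P (isum P)) => //; exact: fan_trK.
Qed.

End InfiniteSum.

(** Products of factors 1 + n with n^2 = 0, recorded together with the inverse product. Each factor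
    is joined to 1 by the polynomial path 1 + tn through units. *)
Inductive elementary (B : nzRingType) : B -> B -> Prop :=
  | elementary1 : elementary 1 1
  | elementary_step n u u' : n * n = 0 -> elementary u u' ->
      elementary ((1 + n) * u) (u' * (1 - n)).

(** * Units of index zero *)

Section Elementary.
Variable B : nzRingType.
Implicit Types (u v n a x y : B).

Lemma nilp_inverses n : n * n = 0 -> inverses (1 + n) (1 - n).
Proof.
by move=> nn; split; rewrite !mulrDl !mulrDr ?mulrN ?mulNr nn ?oppr0 ?mul1r ?mulr1 addr0 ?subrK ?addrK.
Qed.

Lemma elementary_inverses u u' : elementary u u' -> inverses u u'.
Proof.
elim=> [|n {}u {}u' nn _ uu]; first exact: inverses1.
exact: inversesM (nilp_inverses nn) uu.
Qed.

Lemma elementaryM u u' v v' : elementary u u' -> elementary v v' ->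
  elementary (u * v) (v' * u').
Proof.
move=> uu vv; elim: uu => [|n {}u {}u' nn _ IH]; first by rewrite mul1r mulr1.
by rewrite -mulrA [v' * _]mulrA; apply: elementary_step.
Qed.

Lemma elementary_nilp n : n * n = 0 -> elementary (1 + n) (1 - n).
Proof.
move=> nn; rewrite -[1 + n]mulr1 -[1 - n]mul1r.
by apply: elementary_step => //; exact: elementary1.
Qed.

Lemma elementary_eq u u' v v' : u = v -> inverses v v' -> elementary u u' -> elementary v v'.
Proof.
move=> <- uv uu; rewrite -(inverses_unique (elementary_inverses uu) uv); exact: uu.
Qed.

Section TwoCorners.
Variables x y z w : B.
Hypotheses (yx : y * x = 1) (wz : w * z = 1) (yz : y * z = 0) (wx : w * x = 0).

Variable q : B.
Hypothesis qE0 : q = 1 - x * y - z * w.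
(** The 2 by 2 matrices on the orthogonal corners xy and zw, completed by 1 on the complement
    [q]. *)
Let E a b c d := x * (a * y + b * w) + z * (c * y + d * w) + q.

Let yq : y * q = 0.
Proof. by rewrite qE0 !mulrBr mulr1 !mulrA yx yz mul1r mul0r subrr subr0. Qed.
Let wq : w * q = 0.
Proof. by rewrite qE0 !mulrBr mulr1 !mulrA wx wz mul1r mul0r subr0 subrr. Qed.
Let qx : q * x = 0.
Proof. by rewrite qE0 !mulrBl mul1r -!mulrA yx wx mulr1 mulr0 subrr subr0. Qed.
Let qz : q * z = 0.
Proof. by rewrite qE0 !mulrBl mul1r -!mulrA yz wz mulr1 mulr0 subr0 subrr. Qed.
Let qq : q * q = q.
Proof. by rewrite {1}qE0 !mulrBl mul1r -!mulrA yq wq !mulr0 !subr0. Qed.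

Let yE a b c d : y * E a b c d = a * y + b * w.
Proof. by rewrite /E !mulrDr !mulrA yx yz yq !mul1r !mul0r !addr0 -?mulrA. Qed.
Let wE a b c d : w * E a b c d = c * y + d * w.
Proof. by rewrite /E !mulrDr !mulrA wx wz wq !mul1r !mul0r !add0r addr0 -?mulrA. Qed.
Let qE a b c d : q * E a b c d = q.
Proof. by rewrite /E !mulrDr !mulrA qx qz qq !mul0r !add0r. Qed.

Let EM a b c d a' b' c' d' : E a b c d * E a' b' c' d' =
  E (a * a' + b * c') (a * b' + b * d') (c * a' + d * c') (c * b' + d * d').
Proof.
rewrite {1}/E !mulrDl -!mulrA !mulrDl -!mulrA yE wE qE /E; congr (x * _ + z * _ + q).
  by rewrite !mulrDr !mulrA !mulrDl addrACA.
by rewrite !mulrDr !mulrA !mulrDl addrACA.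
Qed.

Let E1 : E 1 0 0 1 = 1.
Proof. by rewrite /E qE0 -[1 - _ - _]addrA -opprD !mul1r !mul0r addr0 add0r [LHS]addrC subrK. Qed.

Let nil_xw b : x * b * w * (x * b * w) = 0.
Proof. by rewrite -!mulrA [w * (x * _)]mulrA wx mul0r !mulr0. Qed.
Let nil_zy b : z * b * y * (z * b * y) = 0.
Proof. by rewrite -!mulrA [y * (z * _)]mulrA yz mul0r !mulr0. Qed.

Let E_xw b : E 1 b 0 1 = 1 + x * b * w.
Proof.
by rewrite -[in RHS]E1 /E !mul1r !mul0r !addr0 !add0r mulrDr -mulrA -!addrA; congr (_ + _); rewrite [LHS]addrC -!addrA.
Qed.
Let E_zy b : E 1 0 b 1 = 1 + z * b * y.
Proof.
by rewrite -[in RHS]E1 /E !mul1r !mul0r !addr0 !add0r mulrDr -mulrA -!addrA; congr (_ + _); rewrite [LHS]addrC -!addrA.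
Qed.

Let rotation a a' : inverses a a' -> exists r', elementary (E 0 a (- a') 0) r'.
Proof.
move=> [aa' a'a].
have h1 := elementary_nilp (nil_xw a); have h2 := elementary_nilp (nil_zy (- a')).
have := elementaryM h1 (elementaryM h2 h1); rewrite -E_xw -E_zy.
rewrite (EM 1 0) !(mulr0, mul0r, mulr1, mul1r, addr0, add0r) mulNr a'a addNr.
rewrite EM !(mulr0, mul0r, mulr1, mul1r, addr0, add0r) mulrN aa' subrr.
by move=> h; eexists; exact: h.
Qed.

Let dil_x a : dil x y a = E a 0 0 1.
Proof. by rewrite /dil /E qE0 !mul0r mul1r addr0 add0r mulrA -addrA; congr (_ + _); rewrite addrC subrK. Qed.
Let dil_z a : dil z w a = E 1 0 0 a.
Proof.
rewrite /dil /E qE0 !mul0r mul1r addr0 add0r mulrA [x * y + _]addrC -addrA; congr (_ + _).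
by rewrite addrA [x * y + _]addrC subrK.
Qed.

(** diag(a, a^-1) is the rotation of [a] times the rotation of -1. *)
Lemma dil_elementary_aux a a' : inverses a a' ->
  elementary (dil x y a * dil z w a') (dil z w a * dil x y a').
Proof.
move=> aa; have [r1' h1] := rotation aa.
have [r2' h2] : exists r', elementary (E 0 (-1) 1 0) r'.
  have [|r' h] := @rotation (-1) (-1); first by split; rewrite mulrNN mulr1.
  by exists r'; rewrite opprK in h.
apply: elementary_eq (elementaryM h1 h2).
  rewrite dil_x dil_z !EM !(mulr0, mul0r, mulr1, mul1r, addr0, add0r).
  by rewrite mulrNN mulr1.
exact: inversesM (inverses_dil yx aa) (inverses_dil wz (inverses_sym aa)).
Qed.

End TwoCorners.

Lemma dil_elementary x y z w a a' : y * x = 1 -> w * z = 1 -> y * z = 0 -> w * x = 0 ->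
  inverses a a' -> elementary (dil x y a * dil z w a') (dil z w a * dil x y a').
Proof. by move=> *; exact: dil_elementary_aux. Qed.

(** The corner zw, orthogonal to both others, is an intermediary: [a] at the new corner against its
    inverse at zw, and [a] at zw against its inverse at the old corner, are both elementary. The old
    and the new corner may overlap. *)
Lemma dil_elementary_move x y z w a a' : y * x = 1 -> w * z = 1 -> y * z = 0 -> w * x = 0 ->
  forall t s : B, s * t = 1 -> s * z = 0 -> w * t = 0 -> inverses a a' ->
  elementary (dil x y a) (dil x y a') -> elementary (dil t s a) (dil t s a').
Proof.
move=> yx wz yz wx t s st sz wt aa ea.
have h1 := dil_elementary st wz sz wt aa.
have h2 := dil_elementary wz yx wx yz aa.
have := elementaryM h1 (elementaryM h2 ea); apply: elementary_eq; last exact: inverses_dil.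
rewrite -[_ * _ * dil x y a]mulrA dilM // aa.2 dil1 mulr1.
by rewrite -mulrA dilM // aa.2 dil1 mulr1.
Qed.

Lemma dil_comp x y z w a : dil x y (dil z w a) = dil (x * z) (w * y) a.
Proof.
rewrite /dil mulrDr mulrDl mulrBr mulrBl mulr1 !mulrA -addrA; congr (_ + _).
by rewrite addrC addrA subrK.
Qed.

End Elementary.

Lemma map_elementary (B C : nzRingType) (f : {rmorphism B -> C}) u u' :
  elementary u u' -> elementary (f u) (f u').
Proof.
elim=> [|n {}u {}u' nn _ IH]; first by rewrite rmorph1; exact: elementary1.
rewrite !rmorphM rmorphD rmorphB rmorph1; apply: elementary_step => //.
by rewrite -rmorphM nn rmorph0.
Qed.

(* K_1 of an infinite sum ring vanishes: diag(g, 1) = G diag(1, G^-1) where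
   G = diag(g, G). *)
Lemma swindle_elementary (B : nzRingType) (x0 x1 y0 y1 g g' G G' : B) :
  y0 * x0 = 1 -> y0 * x1 = 0 -> y1 * x0 = 0 -> y1 * x1 = 1 -> x0 * y0 + x1 * y1 = 1 ->
  inverses g g' -> inverses G G' -> G = x0 * g * y0 + x1 * G * y1 ->
  elementary (dil x0 y0 (dil x0 y0 g)) (dil x0 y0 (dil x0 y0 g')).
Proof.
move=> h00 h01 h10 h11 xy gg GG GE.
have dE a : dil x0 y0 a = x0 * a * y0 + x1 * 1 * y1.
  by rewrite mulr1 /dil -xy; congr (_ + _); rewrite addrAC subrr add0r.
have d1E a : dil x1 y1 a = x0 * 1 * y0 + x1 * a * y1.
  by rewrite mulr1 /dil -xy addrK addrC.
have gE : dil x0 y0 g = G * dil x1 y1 G'.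
  by rewrite {1}GE d1E fan2_conjM // mulr1 GG.1 dE.
have i1 : (y1 * y0) * (x0 * x1) = 1 by rewrite mulrA -(mulrA y1) h00 mulr1.
have i2 : y1 * (x0 * x1) = 0 by rewrite mulrA h10 mul0r.
have i3 : (y1 * y0) * x1 = 0 by rewrite -mulrA h01 mulr0.
have h1 := dil_elementary h00 h11 h01 h10 GG.
have h2 := dil_elementary h11 i1 i2 i3 GG.
apply: elementary_eq (elementaryM h1 h2); last exact/inverses_dil/inverses_dil.
rewrite gE -(dilM _ _ h00) dil_comp mulrA -(mulrA _ (dil x1 y1 G')) dilM // GG.2 dil1 mulr1.
by [].
Qed.

Section LiftElementary.
Variable R : comNzRingType.
Local Notation X0 := (fan R o20).
Local Notation X1 := (fan R o21).
Local Notation Y0 := (fan_tr R o20).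
Local Notation Y1 := (fan_tr R o21).

Lemma lift_elementary g g' : inverses g g' ->
  elementary (dil X0 Y0 (dil X0 Y0 g)) (dil X0 Y0 (dil X0 Y0 g')).
Proof.
move=> gg; have GG : inverses (isum g) (isum g').
  by rewrite /inverses -!isumM gg.1 gg.2 isum1.
apply: (swindle_elementary (x1 := X1) (y1 := Y1)) gg GG (isumE g); rewrite ?fan_trK //.
have [_] := fan_is_fan R 1; rewrite !big_ord_recl big_ord0 addr0 => <-.
by congr (_ * _ + _ * _); congr (fan R _) || congr (fan_tr R _); apply: val_inj.
Qed.

End LiftElementary.

Section IndexElementary.
Variable K : fieldType.
Local Notation X0 := (sfan K o20).
Local Notation X1 := (sfan K o21).
Local Notation Y0 := (sfan_tr K o20).
Local Notation Y1 := (sfan_tr K o21).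

(** Index 0 lifts the dilation of [u] to a unit of Gamma, which becomes elementary after two more
    dilations. The resulting corner, that of the cube of [X0], is exchanged for the corner of [X0]
    through the orthogonal corner of [X1]. *)
Lemma ind0_elementary u u' : inverses u u' -> ind u = 0 ->
  elementary (dil X0 Y0 u) (dil X0 Y0 u').
Proof.
move=> uu u0; have [g [g' [gg gE]]] := ind_eq0 uu u0.
have : elementary (sig _) (sig _) := map_elementary (@sig K) (lift_elementary gg).
rewrite !sig_dil -/(sfan K o20) -/(sfan_tr K o20).
have Y0X0 : Y0 * X0 = 1 by rewrite sfan_trK.
have Y1X1 : Y1 * X1 = 1 by rewrite sfan_trK.
have Y0X1 : Y0 * X1 = 0 by rewrite sfan_trK.
have Y1X0 : Y1 * X0 = 0 by rewrite sfan_trK.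
have -> : sig g' = dil X0 Y0 u'.
  apply: (inverses_unique (inverses_map (@sig K) gg)).
  by rewrite [X in inverses X]gE; exact: inverses_dil.
rewrite gE !dil_comp; set x := X0 * _ * _; set y := Y0 * (_ * _).
have yx : y * x = 1.
  by rewrite /x /y -!mulrA [Y0 * (X0 * _)]mulrA Y0X0 mul1r [Y0 * (X0 * _)]mulrA Y0X0 mul1r.
have Y1x : Y1 * x = 0 by rewrite /x -mulrA mulrA Y1X0 mul0r.
have yX1 : y * X1 = 0 by rewrite /y -!mulrA Y0X1 !mulr0.
by apply: (dil_elementary_move yx Y1X1 yX1 Y1x).
Qed.

End IndexElementary.

(** * Leavitt families and their index *)

Section Families.
Variable E : digraph.

Inductive lgen := GVtx of vtx E | GEdge of edg E | GGhost of edg E.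

(** The images of the generators under a homomorphism from L(E), stripped of scalars: families can
    be pushed along mere ring morphisms, for instance from Sigma over K[t] to Sigma over K. *)
Record leavitt_family (B : nzRingType) (f : lgen -> B) : Prop := LeavittFamily {
  lf_vv : forall v w, f (GVtx v) * f (GVtx w) = if v == w then f (GVtx v) else 0;
  lf_se : forall e, f (GVtx (src e)) * f (GEdge e) = f (GEdge e);
  lf_er : forall e, f (GEdge e) * f (GVtx (rng e)) = f (GEdge e);
  lf_rg : forall e, f (GVtx (rng e)) * f (GGhost e) = f (GGhost e);
  lf_gs : forall e, f (GGhost e) * f (GVtx (src e)) = f (GGhost e);
  lf_ge : forall e e', f (GGhost e) * f (GEdge e') = if e == e' then f (GVtx (rng e)) else 0;
  lf_ck2 : forall v, is_reg v ->
    f (GVtx v) = \sum_(e | src e == v) f (GEdge e) * f (GGhost e)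
}.

Lemma lf_vtx (B : nzRingType) (f : lgen -> B) v : leavitt_family f ->
  f (GVtx v) * f (GVtx v) = f (GVtx v).
Proof. by move=> fF; rewrite lf_vv // eqxx. Qed.

Lemma lf_additive (B C : nzRingType) (f : lgen -> B) (F : B -> C) :
  F 0 = 0 -> {morph F : a b / a + b} -> leavitt_family f ->
  (forall g g', F (f g * f g') = F (f g) * F (f g')) -> leavitt_family (F \o f).
Proof.
move=> F0 FD fF FM; split=> /=.
- by move=> v w; rewrite -FM lf_vv //; case: eqP.
- by move=> e; rewrite -FM lf_se.
- by move=> e; rewrite -FM lf_er.
- by move=> e; rewrite -FM lf_rg.
- by move=> e; rewrite -FM lf_gs.
- by move=> e e'; rewrite -FM lf_ge //; case: eqP.
- by move=> v rv; rewrite lf_ck2 // (big_morph F FD F0); apply: eq_bigr => e _; rewrite FM.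
Qed.

Lemma lf_map (B C : nzRingType) (F : {rmorphism B -> C}) (f : lgen -> B) :
  leavitt_family f -> leavitt_family (F \o f).
Proof.
by move=> fF; apply: lf_additive => //; [exact: rmorph0|exact: rmorphD|move=> *; exact: rmorphM].
Qed.

Definition lf_sum (B : nzRingType) (x1 x2 y1 y2 : B) (f f' : lgen -> B) (g : lgen) : B :=
  x1 * f g * y1 + x2 * f' g * y2.

Lemma leavitt_family_sum (B : nzRingType) (x1 x2 y1 y2 : B) (f f' : lgen -> B) :
  y1 * x1 = 1 -> y1 * x2 = 0 -> y2 * x1 = 0 -> y2 * x2 = 1 ->
  leavitt_family f -> leavitt_family f' -> leavitt_family (lf_sum x1 x2 y1 y2 f f').
Proof.
move=> h11 h12 h21 h22 fF fF'; split; rewrite /lf_sum.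
- move=> v w; rewrite fan2_conjM // !lf_vv //.
  by case: eqP; rewrite // !mulr0 !mul0r addr0.
- by move=> e; rewrite fan2_conjM // !lf_se.
- by move=> e; rewrite fan2_conjM // !lf_er.
- by move=> e; rewrite fan2_conjM // !lf_rg.
- by move=> e; rewrite fan2_conjM // !lf_gs.
- move=> e e'; rewrite fan2_conjM // !lf_ge //.
  by case: eqP; rewrite // !mulr0 !mul0r addr0.
- move=> v rv; rewrite !lf_ck2 // !mulr_sumr !mulr_suml -big_split.
  by apply: eq_bigr => e _; rewrite fan2_conjM.
Qed.

Definition lf_twist (B : nzRingType) (u u' : vtx E -> B) (f : lgen -> B) (g : lgen) : B :=
  match g with
  | GVtx v => f (GVtx v)
  | GEdge e => u (src e) * f (GEdge e)
  | GGhost e => f (GGhost e) * u' (src e)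
  end.

Definition corner_units (B : nzRingType) (q u u' : vtx E -> B) : Prop :=
  forall v, [/\ u v * u' v = q v, u' v * u v = q v, q v * u v = u v & u' v * q v = u' v].

(** The units cancel in the products of a ghost edge and an edge, and they conjugate the sum over
    the edges leaving v, which is the unit f(v) of the corner they live in. *)
Lemma leavitt_family_twist (B : nzRingType) (u u' : vtx E -> B) (f : lgen -> B) :
  leavitt_family f -> corner_units (fun v => f (GVtx v)) u u' ->
  leavitt_family (lf_twist u u' f).
Proof.
move=> fF uu; split=> /=.
- exact: lf_vv.
- by move=> e; have [_ _ qu _] := uu (src e); rewrite mulrA qu.
- by move=> e; rewrite -mulrA lf_er.
- by move=> e; rewrite mulrA lf_rg.
- by move=> e; have [_ _ _ qu] := uu (src e); rewrite -mulrA qu.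
- move=> e e'; rewrite -mulrA [u' _ * _]mulrA.
  have [se|se] := eqVneq (src e) (src e').
    by have [_ u'u _ _] := uu (src e'); rewrite se u'u lf_se // lf_ge.
  rewrite (_ : e == e' = false); last by apply: contra_neqF se => /eqP ->.
  have [_ _ _ qu'] := uu (src e); have [_ _ qu _] := uu (src e').
  by rewrite -qu' -qu -!mulrA [f (GVtx _) * (f (GVtx _) * _)]mulrA lf_vv // (negPf se) mul0r !mulr0.
- move=> v rv; have [uu' _ qu _] := uu v.
  transitivity (u v * f (GVtx v) * u' v).
    have [h1 h2 h3 h4] := uu v.
    by rewrite -[in RHS]h2 !mulrA h1 -mulrA h1 lf_vtx.
  rewrite lf_ck2 // mulr_sumr mulr_suml; apply: eq_bigr => e /eqP <-.
  by rewrite !mulrA.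
Qed.

(** A Murray-von Neumann equivalence of each f(v) with 1. Two of them differ by one unit of [B] per
    vertex ([trivialization_change]). *)
Definition trivialization (B : nzRingType) (f : lgen -> B) (s t : vtx E -> B) : Prop :=
  (forall v, s v * t v = 1) /\ (forall v, t v * s v = f (GVtx v)).

Lemma trivialization_change (B : nzRingType) (f : lgen -> B) s t s' t' :
  trivialization f s t -> trivialization f s' t' ->
  let w v := s' v * t v in let w' v := s v * t' v in
  [/\ forall v, inverses (w v) (w' v), forall v, s' v = w v * s v &
      forall v, t' v = t v * w' v].
Proof.
move=> [st ts] [st' ts'] w w'; split=> v.
- split; rewrite /w /w' mulrA.
    by rewrite -(mulrA _ (t v)) ts -ts' !mulrA st' mul1r st'.
  by rewrite -(mulrA _ (t' v)) ts' -ts !mulrA st mul1r st.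
- by rewrite /w -mulrA ts -ts' mulrA st' mul1r.
- by rewrite /w' mulrA ts -ts' -mulrA st' mulr1.
Qed.

Definition vfan (B : nzRingType) v (a b : edg E -> B) : Prop :=
  (forall e e', src e == v -> src e' == v -> b e * a e' = (e == e')%:R) /\
  \sum_(e | src e == v) a e * b e = 1.

Section VFan.
Variables (B : nzRingType) (v : vtx E).
Implicit Types a b c d : edg E -> B.

Lemma vfan_mul a b c d : vfan v a b ->
  (\sum_(e | src e == v) c e * b e) * (\sum_(e | src e == v) a e * d e) =
  \sum_(e | src e == v) c e * d e.
Proof.
case=> ba _; rewrite mulr_suml; apply: eq_bigr => e ev.
rewrite mulr_sumr (bigD1 e) //= big1 => [|e' /andP[e'v e'e]]; last first.
  by rewrite mulrA -[c e * b e * a e']mulrA ba // eq_sym (negPf e'e) mulr0 mul0r.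
by rewrite addr0 mulrA -[c e * b e * a e]mulrA ba // eqxx mulr1.
Qed.

Lemma vfan_pick a b c e : vfan v a b -> src e == v ->
  (\sum_(e' | src e' == v) c e' * b e') * a e = c e.
Proof.
case=> ba _ ev; rewrite mulr_suml (bigD1 e) //= -mulrA ba // eqxx mulr1.
by rewrite big1 ?addr0 // => e' /andP[e'v e'e]; rewrite -mulrA ba // (negPf e'e) mulr0.
Qed.

Lemma vfan_pickl a b d e : vfan v a b -> src e == v ->
  b e * (\sum_(e' | src e' == v) a e' * d e') = d e.
Proof.
case=> ba _ ev; rewrite mulr_sumr (bigD1 e) //= mulrA ba // eqxx mul1r.
rewrite big1 ?addr0 // => e' /andP[e'v e'e].
by rewrite mulrA ba // eq_sym (negPf e'e) mul0r.
Qed.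

Lemma vfan_inverses a b c d : vfan v a b -> vfan v c d ->
  inverses (\sum_(e | src e == v) a e * d e) (\sum_(e | src e == v) c e * b e).
Proof.
by move=> ab cd; split; rewrite (vfan_mul _ _ cd, vfan_mul _ _ ab); [case: ab|case: cd].
Qed.

Lemma vfan_sum2 a b (x1 x2 y1 y2 : B) :
  y1 * x1 = 1 -> y1 * x2 = 0 -> y2 * x1 = 0 -> y2 * x2 = 1 -> x1 * y1 + x2 * y2 = 1 ->
  vfan v a b ->
  vfan v (fun e => x1 * a e * y1 + x2 * a e * y2) (fun e => x1 * b e * y1 + x2 * b e * y2).
Proof.
move=> h11 h12 h21 h22 xy [ba ab]; split=> [e e' ev ev'|].
  rewrite fan2_conjM // ba //; case: (e == e'); first by rewrite !mulr1.
  by rewrite !mulr0 !mul0r addr0.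
under eq_bigr do rewrite fan2_conjM //.
by rewrite big_split /= -!mulr_suml -!mulr_sumr ab !mulr1.
Qed.

End VFan.

Lemma map_vfan (B C : nzRingType) (F : {rmorphism B -> C}) v a b :
  vfan v a b -> vfan v (F \o a) (F \o b).
Proof.
case=> ba ab; split=> [e e' ev ev'|] /=; first by rewrite -rmorphM ba // rmorph_nat.
by rewrite -(rmorph1 F) -ab rmorph_sum; apply: eq_bigr => e _; rewrite rmorphM.
Qed.

(** In the coordinates of a trivialization the vertex idempotents become 1, so the relations at [v]
    say that the edges leaving it form a complete system of isometries. *)
Lemma triv_vfan (B : nzRingType) (f : lgen -> B) s t v :
  leavitt_family f -> trivialization f s t -> is_reg v ->
  vfan v (fun e => s (src e) * f (GEdge e) * t (rng e))
         (fun e => s (rng e) * f (GGhost e) * t (src e)).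
Proof.
move=> fF [st ts] rv.
have fst w : f (GVtx w) * t w = t w by rewrite -ts -mulrA st mulr1.
split=> [e e' /eqP ev /eqP ev'|].
  have fe : f (GVtx v) * f (GEdge e') = f (GEdge e') by rewrite -ev' lf_se.
  rewrite -!mulrA (mulrA (t (src e))) ev ev' ts (mulrA (f (GVtx v))) fe.
  rewrite (mulrA (f (GGhost e))) lf_ge //; have [<-|_] := eqVneq e e'.
    by rewrite fst st.
  by rewrite mul0r mulr0.
transitivity (s v * f (GVtx v) * t v); last by rewrite -mulrA fst st.
rewrite lf_ck2 // mulr_sumr mulr_suml; apply: eq_bigr => e /eqP ev.
by rewrite -!mulrA (mulrA (t (rng e))) ts (mulrA (f (GVtx _))) lf_rg // ev.
Qed.

Section EdgeFan.
Variable R : comNzRingType.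

Definition out_edges (v : vtx E) : seq (edg E) := [seq e <- enum (edg E) | src e == v].

(** The shape [.-1.+1] fits [fan]; it is the number of edges leaving [v] as soon as there is one. *)
Definition edge_idx v (e : edg E) : 'I_(size (out_edges v)).-1.+1 :=
  inord (index e (out_edges v)).

Definition edge_in (e : edg E) : Gam R := fan R (edge_idx (src e) e).
Definition edge_out (e : edg E) : Gam R := fan_tr R (edge_idx (src e) e).

Lemma mem_out_edges v e : (e \in out_edges v) = (src e == v).
Proof. by rewrite mem_filter mem_enum andbT. Qed.

Lemma edge_idxK v e : src e == v -> edge_idx v e = index e (out_edges v) :> nat.
Proof.
move=> ev; rewrite inordK // prednK ?index_mem ?mem_out_edges //.
by case: (out_edges v) (mem_out_edges v e); rewrite ?ev.
Qed.

Lemma edge_fan v : is_reg v -> vfan v edge_in edge_out.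
Proof.
move=> rv; split=> [e e' /eqP ev /eqP ev'|].
  rewrite /edge_in /edge_out ev ev' fan_trK; congr (nat_of_bool _)%:R.
  apply/eqP/eqP => [|-> //] /(congr1 val) /=.
  rewrite !edge_idxK ?ev ?ev' // => /index_inj -> //;
  by rewrite mem_out_edges ?ev ?ev'.
have [e0 e0v] : exists e, e \in out_edges v.
  by case/existsP: rv => e1 e1v; exists e1; rewrite mem_out_edges.
have kE : (size (out_edges v)).-1.+1 = size (out_edges v).
  by rewrite prednK //; case: (out_edges v) e0v.
rewrite -[RHS](fan_sum R (size (out_edges v)).-1).
transitivity (\sum_(e <- out_edges v) fan R (edge_idx v e) * fan_tr R (edge_idx v e)).
  rewrite big_filter big_enum_cond; apply: eq_bigr => e /eqP ev.
  by rewrite /edge_in /edge_out ev.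
rewrite (big_nth e0) big_mkord (reindex (cast_ord kE)) /=; last first.
  by exists (cast_ord (esym kE)) => i _; rewrite ?cast_ordK ?cast_ordKV.
apply: eq_bigr => i _.
suff -> : edge_idx v (nth e0 (out_edges v) i) = i by [].
have iv : (i < size (out_edges v))%N by rewrite -[X in (_ < X)%N]kE.
apply: val_inj; rewrite /= edge_idxK; last by rewrite -mem_out_edges mem_nth.
by rewrite index_uniq // filter_uniq // enum_uniq.
Qed.

End EdgeFan.
End Families.

(** * Vertex units and their indices *)

Section VertexUnits.
Variables (E : digraph) (R : comNzRingType).
Implicit Types (f : lgen E -> Sig R) (s t : vtx E -> Sig R).

Definition sedge_in (e : edg E) : Sig R := sig (edge_in R e).
Definition sedge_out (e : edg E) : Sig R := sig (edge_out R e).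

Lemma sedge_fan v : is_reg v -> vfan v sedge_in sedge_out.
Proof. by move=> rv; exact: (map_vfan (@sig R) (edge_fan R rv)). Qed.

(** For [v] regular, the unit carrying the fixed isometries [sedge_in] at [v] to those given by the
    edges of [f] ([vertex_unit_pick]). *)
Definition vertex_unit f s t v : Sig R :=
  \sum_(e | src e == v) s (src e) * f (GEdge e) * t (rng e) * sedge_out e.
Definition vertex_unit' f s t v : Sig R :=
  \sum_(e | src e == v) sedge_in e * (s (rng e) * f (GGhost e) * t (src e)).

Lemma vertex_unitK f s t v : leavitt_family f -> trivialization f s t -> is_reg v ->
  inverses (vertex_unit f s t v) (vertex_unit' f s t v).
Proof. by move=> fF st rv; exact: vfan_inverses (triv_vfan fF st rv) (sedge_fan rv). Qed.

Lemma vertex_unit_pick f s t e : leavitt_family f -> trivialization f s t ->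
  vertex_unit f s t (src e) * sedge_in e = s (src e) * f (GEdge e) * t (rng e).
Proof.
move=> fF st; have re : is_reg (src e) by apply/existsP; exists e.
by rewrite /vertex_unit (vfan_pick _ (sedge_fan re)).
Qed.

End VertexUnits.

Section MapVertexUnits.
Variables (E : digraph) (R R' : comNzRingType) (F : {rmorphism R -> R'}).

Lemma map_sedge_in (e : edg E) : map_sigma F (sedge_in R e) = sedge_in R' e.
Proof. by rewrite /sedge_in map_sigmaE map_gamma_fan. Qed.
Lemma map_sedge_out (e : edg E) : map_sigma F (sedge_out R e) = sedge_out R' e.
Proof. by rewrite /sedge_out map_sigmaE map_gamma_fan_tr. Qed.

Lemma map_vertex_unit (f : lgen E -> Sig R) s t v : map_sigma F (vertex_unit f s t v) =
  vertex_unit (map_sigma F \o f) (map_sigma F \o s) (map_sigma F \o t) v.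
Proof.
rewrite /vertex_unit raddf_sum; apply: eq_bigr => e _.
by rewrite -map_sedge_out [LHS](rmorphM (map_sigma F)) !(rmorphM (map_sigma F)).
Qed.

End MapVertexUnits.

Section VertexIndex.
Variables (E : digraph) (K : fieldType).
Implicit Types (f : lgen E -> Sig K) (s t : vtx E -> Sig K).

Section DiagonalIndex.
Variables (v : vtx E) (c d : edg E -> Sig K).
Hypothesis cd : vfan v c d.

Let diag (w : edg E -> Sig K) := \sum_(e | src e == v) c e * w e * d e.

Let diagM w w' : diag w * diag w' = diag (fun e => w e * w' e).
Proof.
rewrite /diag; under [X in _ * X]eq_bigr do rewrite -mulrA.
by rewrite (vfan_mul (fun e => c e * w e) (fun e => w' e * d e) cd); apply: eq_bigr => e _; rewrite !mulrA.
Qed.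

Let diag_dil x w : src x == v -> dil (c x) (d x) w = diag (fun e => if e == x then w else 1).
Proof.
move=> xv; have [_ cd1] := cd; rewrite /diag /dil (bigD1 x) //= eqxx; congr (_ + _).
rewrite -cd1 [X in X - _](bigD1 x) //= [LHS]addrC addKr.
by apply: eq_bigr => e /andP[_ /negPf ->]; rewrite cd1 mulr1.
Qed.

(** A diagonal unit is a product of commuting dilations, one per edge, and a dilation has the index
    of its entry. *)
Lemma ind_diag w w' : (forall e, inverses (w e) (w' e)) ->
  inverses (diag w) (diag w') /\ ind (diag w) = \sum_(e | src e == v) ind (w e).
Proof.
move=> ww; have diag1 : diag (fun=> 1) = 1.
  by have [_ cd1] := cd; rewrite -[RHS]cd1; apply: eq_bigr => e _; rewrite mulr1.
(* The induction is on the set [r] of edges whose entries are already in place, the other entries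
   being 1. *)
pose on (r : seq (edg E)) (u : edg E -> Sig K) e := if e \in r then u e else 1.
have ind_on r : uniq r -> all (fun e => src e == v) r ->
    inverses (diag (on r w)) (diag (on r w')) /\ ind (diag (on r w)) = \sum_(e <- r) ind (w e).
  elim: r => [_ _|x r IH /= /andP[xr ur] /andP[xv rv]].
    have on0 u : diag (on [::] u) = 1 by exact: diag1.
    by rewrite big_nil !on0 ind1; split=> //; exact: inverses1.
  have [ri rind] := IH ur rv.
  have onl u e : on (x :: r) u e = (if e == x then u x else 1) * on r u e.
    by rewrite /on inE; have [->|ex] := eqVneq e x; rewrite ?(negPf xr) ?mulr1 //= mul1r.
  have onr u e : on (x :: r) u e = on r u e * (if e == x then u x else 1).
    by rewrite /on inE; have [->|ex] := eqVneq e x; rewrite ?(negPf xr) ?mul1r //= mulr1.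
  have onE u : diag (on (x :: r) u) = dil (c x) (d x) (u x) * diag (on r u).
    by rewrite (diag_dil _ xv) diagM; apply: eq_bigr => e _; rewrite onl.
  have onE' u : diag (on (x :: r) u) = diag (on r u) * dil (c x) (d x) (u x).
    by rewrite (diag_dil _ xv) diagM; apply: eq_bigr => e _; rewrite onr.
  have dc : d x * c x = 1 by have [->] := cd; rewrite ?eqxx.
  have xi := inverses_dil dc (ww x).
  rewrite big_cons onE onE'; split; first exact: inversesM.
  by rewrite (indM xi ri) (ind_dil dc (ww x)) rind.
have onT u : diag (on (out_edges v) u) = diag u.
  by apply: eq_bigr => e ev; rewrite /on mem_out_edges ev.
have uo : uniq (out_edges v) by rewrite filter_uniq // enum_uniq.
have ao : all (fun e => src e == v) (out_edges v).
  by apply/allP => e; rewrite mem_out_edges.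
have [] := ind_on _ uo ao; rewrite !onT => di ->; split=> //.
by rewrite big_filter big_enum_cond.
Qed.

End DiagonalIndex.

Definition vertex_index f s t : {ffun reg_vtx E -> int} :=
  [ffun v => ind (vertex_unit f s t (val v))].

Lemma vertex_indexE f s t v (rv : is_reg v) :
  vertex_index f s t (exist _ v rv) = ind (vertex_unit f s t v).
Proof. exact: ffunE. Qed.

Lemma I_minus_AE (x : {ffun vtx E -> int}) (v : reg_vtx E) :
  I_minus_A x v = x (val v) - \sum_(e | src e == val v) x (rng e).
Proof.
rewrite ffunE; under eq_bigr do rewrite mulrBl.
rewrite sumrB; congr (_ - _).
  rewrite (bigD1 (val v)) //= /identity_reg eqxx mul1r big1 ?addr0 // => w.
  by rewrite eq_sym => /negPf ->; rewrite mul0r.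
rewrite [RHS](partition_big (@rng E) xpredT) //=; apply: eq_bigr => w _.
rewrite (eq_bigr (fun=> x w)) => [|e /andP[_ /eqP -> //]].
rewrite sumr_const /incidence mulrC -mulr_natr; congr (_ * _).
by rewrite natz; congr Posz; apply: eq_card => e; exact: asboolb.
Qed.

(** The vertex unit at v is multiplied by w_v on the left and by the diagonal unit of the inverses
    of w_(r e) on the right. Its index changes by x_v minus the sum of the x_(r e), which is the row
    of I - A at v applied to x. *)
Lemma vertex_index_change f s t s' t' : leavitt_family f ->
  trivialization f s t -> trivialization f s' t' ->
  vertex_index f s' t' - vertex_index f s t = I_minus_A [ffun v => ind (s' v * t v)].
Proof.
move=> fF st st'; have [] := trivialization_change st st'.
set w := fun v => s' v * t v; set w' := fun v => s v * t' v => ww sE tE.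
apply/ffunP => -[v rv]; rewrite I_minus_AE !ffunE /=.
have uu := vertex_unitK fF st rv.
have [di dind] := ind_diag (sedge_fan K rv) (fun e => inverses_sym (ww (rng e))).
have -> : vertex_unit f s' t' v =
    w v * (vertex_unit f s t v * \sum_(e | src e == v) sedge_in K e * w' (rng e) * sedge_out K e).
  under eq_bigr => e _ do rewrite -mulrA.
  rewrite (vfan_mul _ (fun e => w' (rng e) * sedge_out K e) (sedge_fan K rv)) mulr_sumr.
  by apply: eq_bigr => e /eqP ev; rewrite sE tE ev !mulrA.
rewrite (indM (ww v) (inversesM uu di)) (indM uu di) dind addrA addrAC addrK; congr (_ + _).
rewrite -sumrN; apply: eq_bigr => e _; rewrite ffunE.
exact: indV (ww (rng e)).
Qed.

End VertexIndex.

(** * The standard family and stabilization by it *)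

Section StandardFamily.
Variables (E : digraph) (R : comNzRingType).

Definition vtx_idx (v : vtx E) : 'I_#|vtx E|.-1.+1 := inord (enum_rank v).
Definition vtx_in (v : vtx E) : Sig R := sfan R (vtx_idx v).
Definition vtx_out (v : vtx E) : Sig R := sfan_tr R (vtx_idx v).

Lemma vtx_outK v w : vtx_out v * vtx_in w = (v == w)%:R.
Proof.
rewrite /vtx_in /vtx_out sfan_trK; congr (nat_of_bool _)%:R.
have idxK u : vtx_idx u = enum_rank u :> nat.
  by rewrite inordK // prednK //; apply: leq_ltn_trans (ltn_ord (enum_rank u)).
apply/eqP/eqP => [/(congr1 val)|-> //]; rewrite /= !idxK => /val_inj.
exact: enum_rank_inj.
Qed.

(* Since this family lifts to Gamma, its vertex units are 1 and its class is 0. *)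
Definition std_family (g : lgen E) : Sig R :=
  match g with
  | GVtx v => vtx_in v * vtx_out v
  | GEdge e => vtx_in (src e) * sedge_in R e * vtx_out (rng e)
  | GGhost e => vtx_in (rng e) * sedge_out R e * vtx_out (src e)
  end.

Let outK v b : vtx_out v * (vtx_in v * b) = b.
Proof. by rewrite mulrA vtx_outK eqxx mul1r. Qed.

Lemma std_familyP : leavitt_family std_family.
Proof.
split=> /=.
- move=> v w; rewrite -mulrA (mulrA (vtx_out v)) vtx_outK; case: eqP => [<-|_].
    by rewrite mul1r.
  by rewrite mul0r mulr0.
- by move=> e; rewrite -!mulrA outK.
- by move=> e; rewrite -!mulrA outK.
- by move=> e; rewrite -!mulrA outK.
- by move=> e; rewrite -!mulrA outK.
- move=> e e'; rewrite -!mulrA (mulrA (vtx_out (src e))) vtx_outK.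
  have [se|se] := eqVneq (src e) (src e'); last first.
    rewrite mul0r !mulr0 (_ : e == e' = false) //.
    by apply: contra_neqF se => /eqP ->.
  have re : is_reg (src e) by apply/existsP; exists e.
  have [se' _] := sedge_fan R re; rewrite mul1r (mulrA (sedge_out R e)) se' ?se //.
  by have [->|_] := eqVneq e e'; rewrite ?mul1r // mul0r mulr0.
- move=> v rv; have [_ sv] := sedge_fan R rv.
  transitivity (vtx_in v * (\sum_(e | src e == v) sedge_in R e * sedge_out R e) * vtx_out v).
    by rewrite sv mulr1.
  rewrite mulr_sumr mulr_suml; apply: eq_bigr => e /eqP ev.
  by rewrite ev -!mulrA outK.
Qed.

Lemma std_trivialization : trivialization std_family vtx_out vtx_in.
Proof. by split=> v //; rewrite vtx_outK eqxx. Qed.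

Lemma std_vertex_unit v : is_reg v -> vertex_unit std_family vtx_out vtx_in v = 1.
Proof.
move=> rv; have [_ <-] := sedge_fan R rv; apply: eq_bigr => e _.
by rewrite /= -!mulrA outK (mulrA (vtx_out _)) vtx_outK eqxx mul1r.
Qed.

End StandardFamily.

Lemma map_std_family (E : digraph) (R R' : comNzRingType) (F : {rmorphism R -> R'}) (g : lgen E) :
  map_sigma F (std_family R g) = std_family R' g.
Proof.
have FM := map_sigmaM F.
case: g => [v|e|e]; rewrite /std_family /vtx_in /vtx_out.
- by rewrite FM map_sfan map_sfan_tr.
- by rewrite !FM map_sfan map_sfan_tr map_sedge_in.
- by rewrite !FM map_sfan map_sfan_tr map_sedge_out.
Qed.

Record iso_pair_rel (B : nzRingType) (x1 x2 y1 y2 : B) : Prop := IsoPairRel {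
  ipr11 : y1 * x1 = 1; ipr12 : y1 * x2 = 0; ipr21 : y2 * x1 = 0; ipr22 : y2 * x2 = 1
}.

Lemma map_iso_pair_rel (B C : nzRingType) (F : {rmorphism B -> C}) x1 x2 y1 y2 :
  iso_pair_rel x1 x2 y1 y2 -> iso_pair_rel (F x1) (F x2) (F y1) (F y2).
Proof.
move=> [h11 h12 h21 h22]; split; rewrite -rmorphM.
- by rewrite h11 rmorph1.
- by rewrite h12 rmorph0.
- by rewrite h21 rmorph0.
- by rewrite h22 rmorph1.
Qed.

Lemma map_trivialization (E : digraph) (B C : nzRingType) (F : {rmorphism B -> C})
    (f : lgen E -> B) s t :
  trivialization f s t -> trivialization (F \o f) (F \o s) (F \o t).
Proof. by case=> st ts; split=> v /=; rewrite -rmorphM ?st ?ts ?rmorph1. Qed.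

Lemma map_lf_sum (E : digraph) (B C : nzRingType) (F : {rmorphism B -> C})
    (x1 x2 y1 y2 : B) (f f' : lgen E -> B) :
  F \o lf_sum x1 x2 y1 y2 f f' =1 lf_sum (F x1) (F x2) (F y1) (F y2) (F \o f) (F \o f').
Proof. by move=> g; rewrite /= /lf_sum rmorphD !rmorphM. Qed.

(** The idempotent cd is equivalent to 1, and 1 absorbs [p] through the maps s and t; composing, the
    sum of [p] and cd is equivalent to 1. *)
Lemma absorb_trivialization (B : nzRingType) (x1 x2 y1 y2 p s1 s2 t1 t2 c d : B) :
  iso_pair_rel x1 x2 y1 y2 -> d * c = 1 ->
  [/\ t1 * s1 = p, t1 * s2 = 0, t2 * s1 = 0, t2 * s2 = 1 & s1 * t1 + s2 * t2 = 1] ->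
  (s1 * y1 + s2 * d * y2) * (x1 * t1 + x2 * c * t2) = 1 /\
  (x1 * t1 + x2 * c * t2) * (s1 * y1 + s2 * d * y2) = x1 * p * y1 + x2 * (c * d) * y2.
Proof.
move=> [h11 h12 h21 h22] dc [ts11 ts12 ts21 ts22 st]; split.
  rewrite mulrDl !mulrDr; rewrite -!mulrA !(mulrA y1) !(mulrA y2) h11 h12 h21 h22.
  by rewrite !mul0r !mulr0 addr0 add0r !mul1r (mulrA d) dc mul1r.
rewrite mulrDl !mulrDr -!mulrA !(mulrA t1) !(mulrA t2) ts11 ts12 ts21 ts22.
by rewrite !mul0r !mulr0 addr0 add0r !mul1r.
Qed.

Section Stabilization.
Variables (E : digraph) (K : fieldType).

(** Each f(v) lifts to an idempotent of Gamma, where 1 absorbs it; the vertex v of the standard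
    family supplies this 1. *)
Lemma poly_stable_trivialization (x1 x2 y1 y2 : Sig {poly K}) (f : lgen E -> Sig {poly K}) :
  iso_pair_rel x1 x2 y1 y2 -> leavitt_family f ->
  exists s t, trivialization (lf_sum x1 x2 y1 y2 f (std_family {poly K})) s t.
Proof.
move=> xy fF.
have h (v : vtx E) : exists st : Sig {poly K} * Sig {poly K}, st.1 * st.2 = 1 /\
    st.2 * st.1 = lf_sum x1 x2 y1 y2 f (std_family {poly K}) (GVtx v).
  have [P [PP PE]] := lift_idem (lf_vtx v fF).
  have [s1 [s2 [t1 [t2 [ts11 ts12 ts21 ts22 st]]]]] := absorb_idem PP.
  have dc : vtx_out {poly K} v * vtx_in {poly K} v = 1 by rewrite vtx_outK eqxx.
  have [] := @absorb_trivialization _ _ _ _ _ (f (GVtx v)) (sig s1) (sig s2) (sig t1) (sig t2) _ _ xy dc.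
    by split; rewrite -?sigM ?ts11 ?ts12 ?ts21 ?ts22 ?sig0 ?sig1 // -sigD st sig1.
  by move=> e1 e2; eexists (_, _); split; [exact: e1|exact: e2].
have [st hst] := choice h; exists (fun v => (st v).1), (fun v => (st v).2).
by split=> v; have [] := hst v.
Qed.

(** Extend [f] constantly to K[t], trivialize there, and evaluate at 0. *)
Lemma stable_trivialization (x1 x2 y1 y2 : Sig K) (f : lgen E -> Sig K) :
  iso_pair_rel x1 x2 y1 y2 -> leavitt_family f ->
  exists s t, trivialization (lf_sum x1 x2 y1 y2 f (std_family K)) s t.
Proof.
move=> xy fF; pose C := map_sigma (@polyC K); pose ev := map_sigma (horner_eval (0 : K)).
have evC x : ev (C x) = x.
  have [a <-] := sig_surj x; rewrite /ev /C !map_sigmaE; congr sig.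
  by apply: gammaP => i j /=; rewrite /horner_eval hornerC.
have [s [t st]] := poly_stable_trivialization (map_iso_pair_rel C xy) (lf_map C fF).
exists (ev \o s), (ev \o t); have := map_trivialization ev st.
congr trivialization; apply/funext => g.
transitivity (lf_sum (ev (C x1)) (ev (C x2)) (ev (C y1)) (ev (C y2)) (ev \o (C \o f))
    (ev \o std_family {poly K}) g); first exact: (map_lf_sum ev).
by rewrite /lf_sum /comp !evC /ev map_std_family.
Qed.

End Stabilization.

Lemma conj_sandwich (B : nzRingType) (r r' s p t : B) :
  s * (r' * r) = s -> p * (r' * r) = p -> s * r' * (r * p * r') * (r * t) = s * p * t.
Proof. by move=> sr pr; rewrite !mulrA -(mulrA s) sr -!(mulrA _ r' r) -(mulrA s) pr. Qed.

Lemma iso_pair_hop (B : nzRingType) (x1 x2 y1 y2 z1 z2 w1 w2 a a' b b' : B) :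
  iso_pair_rel x1 x2 y1 y2 ->
  (z1 * a * y1 + z2 * a' * y2) * (x1 * b * w1 + x2 * b' * w2) =
  z1 * (a * b) * w1 + z2 * (a' * b') * w2.
Proof.
move=> [h11 h12 h21 h22].
rewrite mulrDl !mulrDr -!mulrA !(mulrA y1) !(mulrA y2) h11 h12 h21 h22.
by rewrite !mul0r !mulr0 addr0 add0r !mul1r.
Qed.

Lemma iso_pair_hop3 (B : nzRingType) (x1 x2 y1 y2 X0 X1 Y0 Y1 u u' c a a' p p' b b' : B) :
  iso_pair_rel x1 x2 y1 y2 -> iso_pair_rel X0 X1 Y0 Y1 ->
  u * c = a * p * b -> u' * c = a' * p' * b' ->
  (X0 * a * y1 + X1 * a' * y2) * (x1 * p * y1 + x2 * p' * y2) * (x1 * b * Y0 + x2 * b' * Y1) =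
  (X0 * u * Y0 + X1 * u' * Y1) * (X0 * c * Y0 + X1 * c * Y1).
Proof.
move=> xy XY uc u'c; rewrite (iso_pair_hop _ _ _ _ _ _ _ _ xy).
by rewrite (iso_pair_hop _ _ _ _ _ _ _ _ xy) (iso_pair_hop _ _ _ _ _ _ _ _ XY) uc u'c.
Qed.

Lemma dil_pair (B : nzRingType) (X0 X1 Y0 Y1 a : B) : X0 * Y0 + X1 * Y1 = 1 ->
  dil X0 Y0 a = X0 * a * Y0 + X1 * 1 * Y1.
Proof. by move=> XY1; rewrite mulr1 /dil -XY1; congr (_ + _); rewrite addrAC subrr add0r. Qed.

Lemma dil_sum (B : nzRingType) (X0 X1 Y0 Y1 a b : B) :
  iso_pair_rel X0 X1 Y0 Y1 -> X0 * Y0 + X1 * Y1 = 1 ->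
  X0 * a * Y0 + X1 * b * Y1 = dil X0 Y0 a * dil X1 Y1 b.
Proof.
move=> XY XY1; rewrite (dil_pair _ XY1).
have -> : dil X1 Y1 b = X0 * 1 * Y0 + X1 * b * Y1.
  by rewrite mulr1 /dil -XY1 addrK addrC.
by rewrite (iso_pair_hop _ _ _ _ _ _ _ _ XY) mulr1 mul1r.
Qed.

(** The pair x, y of the sum need not be complete, so a second pair with X0 Y0 + X1 Y1 = 1
    reassembles two copies of 1 into 1. *)
Lemma trivialization_sum (E : digraph) (B : nzRingType) (x1 x2 y1 y2 X0 X1 Y0 Y1 : B)
    (f f' : lgen E -> B) s t s' t' :
  iso_pair_rel x1 x2 y1 y2 -> iso_pair_rel X0 X1 Y0 Y1 -> X0 * Y0 + X1 * Y1 = 1 ->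
  trivialization f s t -> trivialization f' s' t' ->
  trivialization (lf_sum x1 x2 y1 y2 f f') (fun w => X0 * s w * y1 + X1 * s' w * y2)
    (fun w => x1 * t w * Y0 + x2 * t' w * Y1).
Proof.
move=> xy XY XY1 [st1 ts1] [st2 ts2]; split=> v.
  by rewrite (iso_pair_hop _ _ _ _ _ _ _ _ xy) st1 st2 !mulr1.
by rewrite (iso_pair_hop _ _ _ _ _ _ _ _ XY) ts1 ts2.
Qed.

Lemma fan2_sum (R : comNzRingType) :
  fan R o20 * fan_tr R o20 + fan R o21 * fan_tr R o21 = 1.
Proof.
have [_] := fan_is_fan R 1; rewrite !big_ord_recl big_ord0 addr0 => <-.
by congr (_ * _ + _ * _); congr (fan R _) || congr (fan_tr R _); apply: val_inj.
Qed.

Lemma sfan2_sum (R : comNzRingType) :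
  sfan R o20 * sfan_tr R o20 + sfan R o21 * sfan_tr R o21 = 1.
Proof. by rewrite -!sigM -sigD fan2_sum sig1. Qed.

Lemma sfan2_iso_pair (R : comNzRingType) :
  iso_pair_rel (sfan R o20) (sfan R o21) (sfan_tr R o20) (sfan_tr R o21).
Proof. by split; rewrite sfan_trK. Qed.

Section FamilyIndex.
Variables (E : digraph) (K : fieldType).
Implicit Types (f : lgen E -> Sig K) (n m : {ffun reg_vtx E -> int}).

Definition coker_eq n m : Prop := exists x : {ffun vtx E -> int}, n - m = I_minus_A x.

Definition has_index f n : Prop := exists s t, trivialization f s t /\ n = vertex_index f s t.

Lemma has_index_unique f n m : leavitt_family f -> has_index f n -> has_index f m ->
  coker_eq n m.
Proof.
by move=> fF [s [t [st ->]]] [s' [t' [st' ->]]]; eexists; exact: vertex_index_change fF st' st.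
Qed.

Lemma std_has_index : has_index (std_family K) 0.
Proof.
exists (@vtx_out E K), (@vtx_in E K); split; first exact: std_trivialization.
apply/ffunP => -[v rv]; rewrite !ffunE /= std_vertex_unit //; exact: esym (ind1 K).
Qed.

Lemma has_index_conj f (r r' : Sig K) n :
  (forall g, r' * r * f g = f g) -> (forall g, f g * (r' * r) = f g) ->
  has_index f n -> has_index (fun g => r * f g * r') n.
Proof.
move=> rf fr [s [t [[st ts] ->]]].
have sE v : s v * (r' * r) = s v by rewrite -[s v]mul1r -(st v) -(mulrA (s v)) ts -mulrA fr.
have tE v : r' * r * t v = t v by rewrite -[t v]mulr1 -(st v) (mulrA (t v)) ts mulrA rf.
exists (fun v => s v * r'), (fun v => r * t v); split.
  split=> v; first by rewrite mulrA -(mulrA (s v)) sE st.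
  by rewrite -ts !mulrA.
apply/ffunP => v; rewrite [LHS]ffunE [RHS]ffunE; apply: (congr1 (@ind K)).
apply: eq_bigr => e _; apply: (congr1 (fun b => b * sedge_out K e)).
exact: esym (conj_sandwich _ (sE _) (fr _)).
Qed.

(** The last factor compares the doubled system of isometries at [v] with the single one; it comes
    from a unit of Gamma, so it has index 0 in [has_index_sum]. *)
Lemma vertex_unit_sum (x1 x2 y1 y2 : Sig K) (X0 X1 Y0 Y1 : Sig K) f f' s t s' t' v :
  iso_pair_rel x1 x2 y1 y2 -> iso_pair_rel X0 X1 Y0 Y1 ->
  leavitt_family f -> leavitt_family f' -> trivialization f s t -> trivialization f' s' t' ->
  is_reg v ->
  vertex_unit (lf_sum x1 x2 y1 y2 f f') (fun w => X0 * s w * y1 + X1 * s' w * y2)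
     (fun w => x1 * t w * Y0 + x2 * t' w * Y1) v =
  (X0 * vertex_unit f s t v * Y0 + X1 * vertex_unit f' s' t' v * Y1) *
  \sum_(e | src e == v) (X0 * sedge_in K e * Y0 + X1 * sedge_in K e * Y1) * sedge_out K e.
Proof.
move=> xy XY fF fF' st st' rv; rewrite mulr_sumr; apply: eq_bigr => e /eqP <-.
apply: (etrans (congr1 (fun b => b * sedge_out K e) _) (esym (mulrA _ _ _))).
exact: (iso_pair_hop3 xy XY (vertex_unit_pick e fF st) (vertex_unit_pick e fF' st')).
Qed.

Lemma ind_dil2_lift (X0 X1 Y0 Y1 a a' b b' c : Sig K) z z' : iso_pair_rel X0 X1 Y0 Y1 ->
  inverses a a' -> inverses b b' -> inverses z z' -> c = sig z ->
  ind (dil X0 Y0 a * dil X1 Y1 b * c) = ind a + ind b.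
Proof.
move=> [h11 _ _ h22] aa bb zz ->.
have d1 := inverses_dil h11 aa; have d2 := inverses_dil h22 bb.
have e1 := ind_dil h11 aa; have e2 := ind_dil h22 bb; have e3 := ind_lift zz.
have e4 := indM d1 d2; have e5 := indM (inversesM d1 d2) (inverses_map (@sig K) zz).
have e12 := etrans e4 (f_equal2 +%R e1 e2).
have e123 := etrans (f_equal2 +%R e12 e3) (addr0 _).
have e := etrans e5 e123.
exact: e.
Qed.

Lemma has_index_sum (x1 x2 y1 y2 : Sig K) f f' n n' : iso_pair_rel x1 x2 y1 y2 ->
  leavitt_family f -> leavitt_family f' -> has_index f n -> has_index f' n' ->
  has_index (lf_sum x1 x2 y1 y2 f f') (n + n').
Proof.
move=> xy fF fF' [s [t [st ->]]] [s' [t' [st' ->]]].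
pose X0 := sfan K o20; pose X1 := sfan K o21; pose Y0 := sfan_tr K o20; pose Y1 := sfan_tr K o21.
have XY : iso_pair_rel X0 X1 Y0 Y1 := sfan2_iso_pair K.
have XY1 : X0 * Y0 + X1 * Y1 = 1 := sfan2_sum K.
exists (fun w => X0 * s w * y1 + X1 * s' w * y2), (fun w => x1 * t w * Y0 + x2 * t' w * Y1).
split; first exact: trivialization_sum.
apply/ffunP => -[v rv].
suff vE : ind (vertex_unit (lf_sum x1 x2 y1 y2 f f') (fun w => X0 * s w * y1 + X1 * s' w * y2)
     (fun w => x1 * t w * Y0 + x2 * t' w * Y1) v) =
    ind (vertex_unit f s t v) + ind (vertex_unit f' s' t' v).
  have addE (a b : {ffun reg_vtx E -> int}) w : (a + b) w = a w + b w by rewrite ffunE.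
  apply: etrans (addE _ _ _) (etrans _ (esym (vertex_indexE _ _ _ rv))).
  exact: etrans (f_equal2 +%R (vertex_indexE _ _ _ rv) (vertex_indexE _ _ _ rv)) (esym vE).
have u1 := vertex_unitK fF st rv; have u2 := vertex_unitK fF' st' rv.
pose z := \sum_(e | src e == v) (fan K o20 * edge_in K e * fan_tr K o20 +
  fan K o21 * edge_in K e * fan_tr K o21) * edge_out K e.
have [z' zz] : exists z', inverses z z'.
  eexists; apply: vfan_inverses (edge_fan K rv).
  by apply: (vfan_sum2 (x1 := fan K o20) (x2 := fan K o21)) (fan2_sum K) (edge_fan K rv); exact: fan_trK.
have zE : \sum_(e | src e == v) (X0 * sedge_in K e * Y0 + X1 * sedge_in K e * Y1) * sedge_out K e =
    sig z.
  rewrite /z (big_morph _ (@sigD K) (@sig0 K)); apply: eq_bigr => e _.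
  by rewrite !sigM sigD !sigM.
have uE := vertex_unit_sum xy XY fF fF' st st' rv.
apply: etrans (congr1 (@ind K) (etrans uE (f_equal2 *%R (dil_sum _ _ XY XY1) (erefl _)))) _.
exact: ind_dil2_lift XY u1 u2 zz zE.
Qed.

(** A trivialization over K[t] evaluates to trivializations at 0 and 1 whose vertex units are the
    ends of one polynomial family of units, and so have equal indices. *)
Lemma has_index_homotopy (x1 x2 y1 y2 : Sig {poly K}) (f : lgen E -> Sig {poly K}) :
  iso_pair_rel x1 x2 y1 y2 -> leavitt_family f ->
  let ev a := map_sigma (horner_eval (a : K)) in
  exists n, forall a, (a = 0) \/ (a = 1) ->
    has_index (lf_sum (ev a x1) (ev a x2) (ev a y1) (ev a y2) (ev a \o f) (std_family K)) n.
Proof.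
move=> xy fF ev; have [s [t st]] := poly_stable_trivialization xy fF.
have [h11 h12 h21 h22] := xy.
have FF := leavitt_family_sum h11 h12 h21 h22 fF (std_familyP E {poly K}).
have evE a : ev a \o lf_sum x1 x2 y1 y2 f (std_family {poly K}) =
    lf_sum (ev a x1) (ev a x2) (ev a y1) (ev a y2) (ev a \o f) (std_family K).
  apply/funext => g; apply: (etrans (map_lf_sum (ev a) _ _ _ _ _ _ g)).
  have stdE : ev a (std_family {poly K} g) = std_family K g := map_std_family (horner_eval a) g.
  by apply: (congr1 (fun b => _ + _ * b * _)).
exists (vertex_index (ev 0 \o lf_sum x1 x2 y1 y2 f (std_family {poly K})) (ev 0 \o s) (ev 0 \o t)).
move=> a a01; exists (ev a \o s), (ev a \o t); rewrite -evE; split.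
  exact: (map_trivialization (ev a)) st.
case: a01 => ->; first exact: erefl.
apply/ffunP => -[v rv].
apply: etrans (vertex_indexE _ _ _ rv) (etrans _ (esym (vertex_indexE _ _ _ rv))).
apply: etrans (congr1 (@ind K) (esym (map_vertex_unit _ _ _ _ _))) _.
apply: etrans _ (congr1 (@ind K) (map_vertex_unit _ _ _ _ _)).
exact: ind_homotopy (vertex_unitK FF st rv).
Qed.

End FamilyIndex.

Lemma big_enum_filter (T : finType) (V : nmodType) (P : pred T) (F : T -> V) :
  \sum_(e | P e) F e = \sum_(e <- [seq e <- enum T | P e]) F e.
Proof. by rewrite big_filter big_enum_cond. Qed.

(** * Homomorphisms and homotopies *)

Section FamilyHom.
Variables (E : digraph) (K : comNzRingType).

Definition lgen_term (g : lgen E) : lterm K E :=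
  match g with GVtx v => LVtx K v | GEdge e => LEdge K e | GGhost e => LGhost K e end.

Definition lpa_gen (g : lgen E) : leavitt K E := to_leavitt (lgen_term g).

Lemma to_leavitt0 : to_leavitt (LZero K E) = 0. Proof. by []. Qed.
Lemma to_leavittD (t u : lterm K E) : to_leavitt (LAdd t u) = to_leavitt t + to_leavitt u.
Proof. exact: esym (laddE t u). Qed.
Lemma to_leavittZ c (t : lterm K E) : to_leavitt (LScale c t) = c *: to_leavitt t.
Proof. exact: esym (lscaleE c t). Qed.
Lemma to_leavittM (t u : lterm K E) : to_leavitt (LMul t u) = nmul (to_leavitt t) (to_leavitt u).
Proof. exact: esym (lmulE t u). Qed.

Lemma nhomD (A : nalgType K) (B : algType K) (F : nhom A B) a b : F (a + b) = F a + F b.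
Proof. exact: raddfD. Qed.
Lemma nhomZ (A : nalgType K) (B : algType K) (F : nhom A B) c a : F (c *: a) = c *: F a.
Proof. exact: linearZ. Qed.
Lemma nhom_0 (A : nalgType K) (B : algType K) (F : nhom A B) : F 0 = 0.
Proof. exact: raddf0. Qed.

Variable B : algType K.
Implicit Types (F G : nhom (leavitt K E) B) (f : lgen E -> B).

Fixpoint lterm_eval f (t : lterm K E) : B :=
  match t with
  | LVtx v => f (GVtx v)
  | LEdge e => f (GEdge e)
  | LGhost e => f (GGhost e)
  | LZero => 0
  | LAdd t u => lterm_eval f t + lterm_eval f u
  | LScale c t => c *: lterm_eval f t
  | LMul t u => lterm_eval f t * lterm_eval f u
  end.

Lemma lterm_eval_eq f t u : leavitt_family f -> lpa_eq t u -> lterm_eval f t = lterm_eval f u.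
Proof.
move=> fF; elim=> {t u} //=.
- by move=> t u w _ -> _ ->.
- by move=> t t' u u' _ -> _ ->.
- by move=> c t t' _ ->.
- by move=> t t' u u' _ -> _ ->.
- by move=> t u w; rewrite addrA.
- by move=> t u; rewrite addrC.
- by move=> t; rewrite add0r.
- by move=> t; rewrite scaleN1r addNr.
- by move=> c d t; rewrite scalerA.
- by move=> t; rewrite scale1r.
- by move=> c t u; rewrite scalerDr.
- by move=> c d t; rewrite scalerDl.
- by move=> t u w; rewrite mulrA.
- by move=> t u w; rewrite mulrDl.
- by move=> t u w; rewrite mulrDr.
- by move=> c t u; rewrite scalerAl.
- by move=> c t u; rewrite scalerAr.
- by move=> v w; rewrite lf_vv //; case: eqP.
- exact: lf_se.
- exact: lf_er.
- exact: lf_rg.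
- exact: lf_gs.
- by move=> e e'; rewrite lf_ge //; case: eqP.
- move=> v rv; rewrite lf_ck2 // /lsum_out big_enum_filter.
  by elim: [seq e <- _ | _] => [|e r IH] /=; rewrite ?big_nil // big_cons IH.
Qed.

Section FamilyNhom.
Variables (f : lgen E -> B) (fF : leavitt_family f).

Let eval (x : leavitt K E) : B := lterm_eval f (lrepr x).

Let evalE t : eval (to_leavitt t) = lterm_eval f t.
Proof. exact: lterm_eval_eq fF (lpa_repr t). Qed.

Let eval_linear : linear eval.
Proof.
move=> c x y; have [t ->] := to_leavitt_surj x; have [u ->] := to_leavitt_surj y.
have -> : c *: to_leavitt t + to_leavitt u = to_leavitt (LAdd (LScale c t) u).
  by rewrite to_leavittD to_leavittZ.
by rewrite !evalE.
Qed.

Let evalM x y : eval (nmul x y) = eval x * eval y.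
Proof.
have [t ->] := to_leavitt_surj x; have [u ->] := to_leavitt_surj y.
have -> : nmul (to_leavitt t) (to_leavitt u) = to_leavitt (LMul t u) by rewrite to_leavittM.
by rewrite !evalE.
Qed.

Definition family_nhom : nhom (leavitt K E) B := nhom_of eval_linear evalM.

Lemma family_nhomE g : family_nhom (lpa_gen g) = f g.
Proof. by rewrite [LHS]evalE; case: g. Qed.

End FamilyNhom.

Lemma nhom_lpa_ind F (P : B -> Prop) :
  P 0 -> (forall a b, P a -> P b -> P (a + b)) -> (forall c a, P a -> P (c *: a)) ->
  (forall a b, P a -> P b -> P (a * b)) -> (forall g, P (F (lpa_gen g))) -> forall x, P (F x).
Proof.
move=> P0 PD PZ PM Pg x; have [t ->] := to_leavitt_surj x.
elim: t => [v|e|e||t IHt u IHu|c t IH|t IHt u IHu].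
- exact: Pg (GVtx v).
- exact: Pg (GEdge e).
- exact: Pg (GGhost e).
- by rewrite to_leavitt0 nhom_0.
- by rewrite to_leavittD nhomD; exact: PD.
- by rewrite to_leavittZ nhomZ; exact: PZ.
- by rewrite to_leavittM nhomM; exact: PM.
Qed.

Lemma nhom_lpa_agree (C : algType K) (H : nhom (leavitt K E) C) (ev : C -> B) F :
  ev 0 = 0 -> {morph ev : a b / a + b} -> {morph ev : a b / a * b} ->
  (forall c, {morph ev : a / c *: a}) ->
  (forall g, ev (H (lpa_gen g)) = F (lpa_gen g)) -> forall x, ev (H x) = F x.
Proof.
move=> ev0 evD evM evZ HF x; have [t ->] := to_leavitt_surj x.
elim: t => [v|e|e||t IHt u IHu|c t IH|t IHt u IHu].
- exact: HF (GVtx v).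
- exact: HF (GEdge e).
- exact: HF (GGhost e).
- by rewrite to_leavitt0 !nhom_0 ?ev0.
- by rewrite to_leavittD !nhomD evD IHt IHu.
- by rewrite to_leavittZ !nhomZ evZ IH.
- by rewrite to_leavittM !nhomM evM IHt IHu.
Qed.

Lemma nhom_lpa_ext F G : (forall g, F (lpa_gen g) = G (lpa_gen g)) -> F = G.
Proof. by move=> FG; apply: nhomP; exact: (nhom_lpa_agree (ev := id)). Qed.

Definition nhom_family F : lgen E -> B := fun g => F (lpa_gen g).

Lemma nhom_familyP F : leavitt_family (nhom_family F).
Proof.
have rel t u : lpa_eq t u -> F (to_leavitt t) = F (to_leavitt u).
  by move=> /to_leavittP ->.
have relM t u : F (to_leavitt (LMul t u)) = F (to_leavitt t) * F (to_leavitt u).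
  by rewrite to_leavittM nhomM.
have F0 : F (to_leavitt (LZero K E)) = 0 by exact: nhom_0.
split; rewrite /nhom_family /lpa_gen /=.
- by move=> v w; rewrite -relM (rel _ _ (lpa_vv K v w)); case: eqP.
- by move=> e; rewrite -relM (rel _ _ (lpa_se K e)).
- by move=> e; rewrite -relM (rel _ _ (lpa_er K e)).
- by move=> e; rewrite -relM (rel _ _ (lpa_rg K e)).
- by move=> e; rewrite -relM (rel _ _ (lpa_gs K e)).
- by move=> e e'; rewrite -relM (rel _ _ (lpa_ge K e e')); case: eqP.
- move=> v rv; rewrite (rel _ _ (lpa_ck2 K rv)) /lsum_out big_enum_filter.
  elim: [seq e <- _ | _] => [|e r IH] /=; first by rewrite big_nil.
  by rewrite big_cons -IH -relM to_leavittD nhomD.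
Qed.

Lemma nhom_lpa_unitl F q : (forall g, q * F (lpa_gen g) = F (lpa_gen g)) ->
  forall x, q * F x = F x.
Proof.
move=> qF; apply: (nhom_lpa_ind (P := fun b => q * b = b)) => //.
- by rewrite mulr0.
- by move=> a b qa qb; rewrite mulrDr qa qb.
- by move=> c a qa; rewrite -scalerAr qa.
- by move=> a b qa _; rewrite mulrA qa.
Qed.

Lemma nhom_lpa_unitr F q : (forall g, F (lpa_gen g) * q = F (lpa_gen g)) ->
  forall x, F x * q = F x.
Proof.
move=> qF; apply: (nhom_lpa_ind (P := fun b => b * q = b)) => //.
- by rewrite mul0r.
- by move=> a b qa qb; rewrite mulrDl qa qb.
- by move=> c a qa; rewrite -scalerAl qa.
- by move=> a b _ qb; rewrite -mulrA qb.
Qed.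

End FamilyHom.

(** * Homotopies between twisted homomorphisms *)

Section TrivTwist.
Variables (E : digraph) (B : nzRingType) (s t : vtx E -> B).
Implicit Types (f : lgen E -> B) (w : vtx E -> B).

Definition triv_twist (w w' : vtx E -> B) f : lgen E -> B :=
  lf_twist (fun v => t v * w v * s v) (fun v => t v * w' v * s v) f.

Lemma triv_corner_units f w w' : trivialization f s t -> (forall v, inverses (w v) (w' v)) ->
  corner_units (fun v => f (GVtx v)) (fun v => t v * w v * s v) (fun v => t v * w' v * s v).
Proof.
move=> [st ts] ww v; have [ww' w'w] := ww v.
have mulE a b : t v * a * s v * (t v * b * s v) = t v * (a * b) * s v.
  by rewrite -!mulrA (mulrA (s v)) st mul1r.
by split; rewrite -?ts ?mulE ?ww' ?w'w ?mulr1 //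
  -?mulrA ?(mulrA (s v)) ?st ?mul1r ?mulr1.
Qed.

Lemma triv_twist_family f w w' : leavitt_family f -> trivialization f s t ->
  (forall v, inverses (w v) (w' v)) -> leavitt_family (triv_twist w w' f).
Proof. by move=> fF st ww; apply: leavitt_family_twist fF (triv_corner_units st ww). Qed.

End TrivTwist.

Section TwistHomotopy.
Variables (E : digraph) (K : comNzRingType) (B : algType K) (s t : vtx E -> B).
Implicit Types (F G : nhom (leavitt K E) B) (w n : vtx E -> B).

(** Quantifying over all [F] trivialized by [s] and [t] makes the relation stable under products: a
    twist leaves the vertices alone, so the twisted homomorphism has the same trivialization. *)
Definition twist_homotopic w w' : Prop :=
  (forall v, inverses (w v) (w' v)) /\
  forall F G, trivialization (nhom_family F) s t ->
    (forall g, G (lpa_gen K g) = triv_twist s t w w' (nhom_family F) g) -> homotopic F G.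

Lemma twist_homotopic1 : twist_homotopic (fun=> 1) (fun=> 1).
Proof.
split=> [v|F G [st ts] FG]; first exact: inverses1.
suff -> : G = F by exact: homotopic_refl.
apply: nhom_lpa_ext => g; rewrite FG; have fF := nhom_familyP F.
case: g => [v|e|e] //=; rewrite mulr1 ts; first by rewrite lf_se.
by rewrite lf_gs.
Qed.

Lemma twist_homotopicM w1 w1' w2 w2' : twist_homotopic w1 w1' -> twist_homotopic w2 w2' ->
  twist_homotopic (fun v => w1 v * w2 v) (fun v => w2' v * w1' v).
Proof.
move=> [ww1 h1] [ww2 h2]; split=> [v|F G FT FG]; first exact: inversesM.
have fF := nhom_familyP F; have gF := triv_twist_family fF FT ww2.
have [st ts] := FT.
apply: (homotopic_trans (h2 F (family_nhom gF) FT (family_nhomE gF))).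
apply: h1 => [|g].
  by split=> // v; rewrite /nhom_family family_nhomE ts.
rewrite FG; case: g => [v|e|e] /=; rewrite /nhom_family !family_nhomE //=.
  by rewrite -!mulrA (mulrA (s _) (t _)) st mul1r.
by rewrite -!mulrA (mulrA (s _) (t _)) st mul1r.
Qed.

(* The homotopy is the twist by [1 + n 'X]. *)
Lemma twist_homotopic_nilp n : (forall v, n v * n v = 0) ->
  twist_homotopic (fun v => 1 + n v) (fun v => 1 - n v).
Proof.
move=> nn; split=> [v|F G [st ts] FG]; first exact: nilp_inverses.
pose C (b : B) : poly_alg B := b%:P.
have CM a b : C (a * b) = C a * C b by exact: polyCM.
pose N v := C (n v) * poly_algX B.
have NN v : N v * N v = 0.
  rewrite /N mulrA -(mulrA _ _ (C _)) poly_alg_commX !mulrA.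
  by rewrite -CM nn !mul0r.
have HT : trivialization (nhom_family (nhom_const F)) (C \o s) (C \o t).
  by split=> v /=; rewrite -CM ?st // ts.
have HF := triv_twist_family (nhom_familyP (nhom_const F)) HT (fun v => nilp_inverses (NN v)).
pose ev (r : B) (b : poly_alg B) : B := (b : {poly B}).[r].
have evH r (G' : nhom (leavitt K E) B) : {morph ev r : a b / a * b} ->
    (forall g, G' (lpa_gen K g) =
      triv_twist s t (fun v => 1 + n v * r) (fun v => 1 - n v * r) (nhom_family F) g) ->
    forall x, ev r (family_nhom HF x) = G' x.
  move=> evM GE.
  have evC b : ev r (C b) = b by exact: hornerC.
  have evN v : ev r (N v) = n v * r by rewrite evM evC; congr (_ * _); exact: hornerX.
  have evD : {morph ev r : a b / a + b} by move=> a b; exact: hornerD.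
  have evB a b : ev r (a - b) = ev r a - ev r b by rewrite /ev hornerD hornerN.
  have ev1 : ev r 1 = 1 by exact: hornerC.
  apply: nhom_lpa_agree => //; first exact: horner0.
    by move=> c a; rewrite /ev poly_algZ hornerZ -scalerAl mul1r.
  have FE g : ev r (nhom_family (nhom_const F) g) = nhom_family F g by exact: evC.
  move=> g; rewrite family_nhomE GE; case: g => [v|e|e] /=; first exact: FE.
    by rewrite !evM evD ev1 evN !evC.
  by rewrite !evM evB ev1 evN !evC.
have fF := nhom_familyP F.
apply: rst_step; exists (family_nhom HF); split; apply: evH.
- exact: horner0M.
- move=> [v|e|e] //=; rewrite mulr0 ?addr0 ?subr0 mulr1 ts; first by rewrite lf_se.
  by rewrite lf_gs.
- exact: horner1M.
- by move=> g; rewrite FG; case: g => [v|e|e] //=; rewrite mulr1.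
Qed.

Lemma twist_homotopic_at x (w w' : B) : elementary w w' ->
  twist_homotopic (fun v => if v == x then w else 1) (fun v => if v == x then w' else 1).
Proof.
elim=> {w w'} [|m w w' mm _ IH].
  have := @twist_homotopic1; congr twist_homotopic; apply/funext => v; by rewrite if_same.
pose n v := if v == x then m else 0.
have nn v : n v * n v = 0 by rewrite /n; case: eqP; rewrite ?mul0r.
have := twist_homotopicM (twist_homotopic_nilp nn) IH; congr twist_homotopic; apply/funext => v.
  by rewrite /n; case: eqP => _ //; rewrite addr0 mulr1.
by rewrite /n; case: eqP => _ //; rewrite subr0 mulr1.
Qed.

(** The elementary words at different vertices may differ in length, so the vertices are treated one
    at a time. *)
Lemma twist_homotopic_elementary w w' : (forall v, elementary (w v) (w' v)) ->
  twist_homotopic w w'.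
Proof.
move=> ww.
pose on (r : seq (vtx E)) (u : vtx E -> B) v := if v \in r then u v else 1.
have onT r : uniq r -> twist_homotopic (on r w) (on r w').
  elim: r => [_|x r IH /= /andP[xr ur]]; first exact: twist_homotopic1.
  have := twist_homotopicM (twist_homotopic_at x (ww x)) (IH ur).
  congr twist_homotopic; apply/funext => v; rewrite /on inE; have [->|] := eqVneq v x;
    by rewrite ?(negPf xr) ?mulr1 ?mul1r.
have := onT (enum (vtx E)) (enum_uniq _); congr twist_homotopic; apply/funext => v;
  by rewrite /on mem_enum.
Qed.

End TwistHomotopy.

(** * From polynomials over matrices to Sigma with polynomial coefficients *)

Section HomotopicIota2.
Variables (K : comNzRingType) (A : nalgType K) (B : algType K).

Section PolyCorner.
Variable H : nhom A (poly_alg B).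

Let E00 : 'M[B]_2 := delta_mx 0 0.
Let lift (a : A) : {poly 'M[B]_2} := map_poly (@scalar_mx B 2) (H a : {poly B}).
(** The corner inclusion applied to coefficients. As it is not unital, it is written as [E00] times
    the image under the unital morphism [scalar_mx], which [map_poly] extends. *)
Let poly_corner (a : A) : poly_alg (mx2_alg B) := E00%:P * lift a.

Let E00E : corner 1 = E00. Proof. by rewrite /corner scale1r. Qed.

Let E00M (b : B) : E00 * b%:M = corner b.
Proof.
by have := corner_scalar 1 b 1; rewrite E00E !mul1r => <-.
Qed.

Let ME00 (b : B) : (b%:M : 'M[B]_2) * E00 = corner b.
Proof.
by have := corner_scalar b 1 1; rewrite E00E !mulr1 => <-.
Qed.

Let E00_lift a : E00%:P * lift a = lift a * E00%:P.
Proof. by apply/polyP => i; rewrite coefCM coefMC coef_map E00M ME00. Qed.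

Let E00_idem : E00 * E00 = E00.
Proof. by rewrite -E00E -[LHS]cornerM mul1r. Qed.

Let scalar_lin c : (c%:A : mx2_alg B) = (c%:A : B)%:M.
Proof. by rewrite mx2_algZ; exact: scalemx1. Qed.

Let poly_corner_linear : linear poly_corner.
Proof.
pose S : {rmorphism {poly B} -> {poly 'M[B]_2}} := map_poly (@scalar_mx B 2).
move=> c x y; rewrite /poly_corner /lift -![map_poly _ _]/(S _) nhomLE poly_algZ.
transitivity (E00%:P * S (c%:A%:P * H x + H y)).
  by congr (_ * S (_ + _)); exact: esym (mul_polyC _ _).
rewrite rmorphD mulrDr rmorphM; congr (_ + _).
by rewrite -mul_polyC [S _%:P]map_polyC /= scalar_lin !mulrA -!polyCM E00M ME00.
Qed.

Let poly_cornerM x y : poly_corner (nmul x y) = poly_corner x * poly_corner y.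
Proof.
rewrite /poly_corner -[RHS]mulrA (mulrA (lift x)) -E00_lift !mulrA -polyCM E00_idem -mulrA.
by congr (_ * _); rewrite /lift nhomM; exact: rmorphM.
Qed.

Definition nhom_poly_corner : nhom A (poly_alg (mx2_alg B)) :=
  nhom_of poly_corner_linear poly_cornerM.

Lemma nhom_poly_cornerE (r : bool) a :
  (nhom_poly_corner a : {poly 'M[B]_2}).[r%:R] = corner ((H a : {poly B}).[r%:R]).
Proof.
rewrite -[nhom_poly_corner a]/(poly_corner a) /poly_corner hornerCM.
by rewrite -(rmorph_nat (@scalar_mx B 2)) horner_map /= E00M.
Qed.

End PolyCorner.

Lemma homotopic_iota2 (f g : nhom A B) : homotopic f g -> M2_homotopic f g.
Proof.
elim=> {f g} [f g [H [H0 H1]]|f|f g _|f g h _ + _]; last first.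
- exact: homotopic_trans.
- exact: homotopic_sym.
- exact: homotopic_refl.
apply: rst_step; exists (nhom_poly_corner H); split=> a.
  by rewrite (nhom_poly_cornerE H false) H0.
by rewrite (nhom_poly_cornerE H true) H1.
Qed.

End HomotopicIota2.

Section PolySpread.
Variables (A B C : nzRingType) (J : {rmorphism A -> B}) (i : {rmorphism B -> C}) (u : C).
Hypothesis iu : forall b, u * i b = i b * u.

Let iJu : commr_rmorph (i \o J) u. Proof. by move=> a; exact: iu. Qed.

(** Used from M_2 Sigma(K) to Sigma(K[t]) with [u] the scalar t: a homotopy, polynomial over the
    matrices, becomes a family over Sigma with polynomial coefficients, where idempotents lift. *)
Definition poly_spread : {poly A} -> C := horner_morph iJu.
HB.instance Definition _ := GRing.RMorphism.on poly_spread.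

Lemma ev_poly_spread (ev : {rmorphism C -> B}) (r : bool) q :
  (forall b, ev (i b) = b) -> ev u = r%:R -> ev (poly_spread q) = J q.[r%:R].
Proof.
move=> evi evu; rewrite /poly_spread /horner_morph -horner_map evu -map_poly_comp.
rewrite -(rmorph_nat J) -horner_map; congr horner; apply: eq_map_poly => a /=; exact: evi.
Qed.

End PolySpread.

Lemma blk_corner00 (B : nzRingType) (z w : 'I_2 -> B) (b : B) :
  blk z w (b *: delta_mx 0 0) = z o20 * b * w o20.
Proof.
have <- : (0 : 'I_2) = o20 by exact: val_inj.
rewrite /blk !big_ord_recl !big_ord0 !mxE /= !mulr1 !mulr0 !mul0r !addr0 mulr0 addr0.
by rewrite mulrA.
Qed.

Section BlockMorphism.
Variable R : comNzRingType.

Definition sblk (M : mx2_alg (Sigma R^o)) : Sig R := blk (@sfan R 1) (@sfan_tr R 1) M.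

Lemma sblk_is_zmod_morphism : zmod_morphism sblk.
Proof. by move=> M N; rewrite /sblk -blkN -blkD. Qed.
Lemma sblk_is_monoid_morphism : monoid_morphism sblk.
Proof. by split=> [|M N]; [exact: (blk1 (sfan_is_fan R 1))|exact: (blkM _ _ (sfan_is_fan R 1))]. Qed.
HB.instance Definition _ := GRing.isZmodMorphism.Build (mx2_alg (Sigma R^o)) (Sig R) sblk
  sblk_is_zmod_morphism.
HB.instance Definition _ := GRing.isMonoidMorphism.Build (mx2_alg (Sigma R^o)) (Sig R) sblk
  sblk_is_monoid_morphism.

Lemma sblk_corner (b : Sig R) : sblk (corner b) = sfan R o20 * b * sfan_tr R o20.
Proof.
exact: blk_corner00.
Qed.

End BlockMorphism.

Section EvalConst.
Variable K : fieldType.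
Implicit Types (a : K) (b : Sig K).

Lemma eval_map_const a b : map_sigma (horner_eval a) (map_sigma (@polyC K) b) = b.
Proof.
have [c <-] := sig_surj b; rewrite !map_sigmaE; apply: (congr1 (@sig K)).
by apply: gammaP => i j /=; rewrite /horner_eval hornerC.
Qed.

Definition sigX : Sig {poly K} := 'X%:A.

Lemma sigX_comm (c : Sig {poly K}) : sigX * c = c * sigX.
Proof. by rewrite /sigX mulr_algl mulr_algr. Qed.

Lemma eval_sigX (r : bool) : map_sigma (horner_eval (r%:R : K)) sigX = r%:R.
Proof.
rewrite /sigX -(sig1 {poly K}) -sigZ map_sigmaE map_gammaZ map_gamma1 sigZ sig1.
by apply: etrans (congr1 (fun c => c *: 1) (hornerX _)) _; exact: scaler_nat.
Qed.

End EvalConst.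

Lemma corner_hop (B : nzRingType) (x1 x2 y1 y2 X Y : B) : iso_pair_rel x1 x2 y1 y2 -> Y * X = 1 ->
  let r := x1 * X * y1 + x2 * 1 * y2 in
  let r' := x1 * Y * y1 + x2 * 1 * y2 in
  [/\ forall a a', r' * r * (x1 * a * y1 + x2 * a' * y2) = x1 * a * y1 + x2 * a' * y2,
      forall a a', (x1 * a * y1 + x2 * a' * y2) * (r' * r) = x1 * a * y1 + x2 * a' * y2 &
      forall a a', r * (x1 * a * y1 + x2 * a' * y2) * r' = x1 * (X * a * Y) * y1 + x2 * a' * y2].
Proof.
move=> xy YX r r'; rewrite /r /r'; split=> a a'; rewrite !(iso_pair_hop _ _ _ _ _ _ _ _ xy).
- by rewrite YX !mul1r.
- by rewrite YX !mulr1.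
- by rewrite !mul1r !mulr1.
Qed.

(** * The isomorphism *)

Section StableClass.
Variables (E : digraph) (K : fieldType) (p : iso_pair (Sigma K^o)).
Implicit Types (f : lgen E -> Sig K) (n m : {ffun reg_vtx E -> int}).

Lemma iso_pairP : iso_pair_rel (iso_x1 p) (iso_x2 p) (iso_y1 p) (iso_y2 p).
Proof. split; [exact: iso_y1x1|exact: iso_y1x2|exact: iso_y2x1|exact: iso_y2x2]. Qed.

Definition iso_sum f f' := lf_sum (iso_x1 p) (iso_x2 p) (iso_y1 p) (iso_y2 p) f f'.
Definition stabilize f := iso_sum f (std_family K).

Lemma iso_sum_family f f' : leavitt_family f -> leavitt_family f' ->
  leavitt_family (iso_sum f f').
Proof. by have [h11 h12 h21 h22] := iso_pairP; exact: leavitt_family_sum. Qed.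

Lemma stabilize_family f : leavitt_family f -> leavitt_family (stabilize f).
Proof. by move=> fF; exact: iso_sum_family (std_familyP E K). Qed.

Lemma stabilize_has_index f : leavitt_family f -> exists n, has_index (stabilize f) n.
Proof.
move=> fF; have [s [t st]] := stable_trivialization iso_pairP fF.
by exists (vertex_index (stabilize f) s t), s, t.
Qed.

Definition coker_pi n : Coker E := (\pi_(Coker E) n)%qT.

Lemma coker_piP n m : coker_pi n = coker_pi m <-> coker_eq n m.
Proof.
split=> [/eqP|nm].
  rewrite -Quotient.idealrBE => /asboolP; exact.
by apply/eqP; rewrite -Quotient.idealrBE; apply/asboolP; exact: nm.
Qed.

Lemma coker_piD n m : coker_pi (n + m) = coker_pi n + coker_pi m.
Proof. exact: Quotient.pi_add. Qed.

Lemma coker_pi_surj (y : Coker E) : exists n, y = coker_pi n.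
Proof. by exists (repr y); rewrite /coker_pi reprK. Qed.

(** The index vector depends on the trivialization, its class in the cokernel does not
    ([stable_classE]). For a family the default of [xget] is never reached, by
    [stabilize_has_index]. *)
Definition stable_class f : Coker E :=
  coker_pi (xget 0 [set n | has_index (stabilize f) n]%classic).

Lemma stable_classE f n : leavitt_family f -> has_index (stabilize f) n ->
  stable_class f = coker_pi n.
Proof.
move=> fF fn; apply/coker_piP; apply: (has_index_unique (stabilize_family fF) _ fn).
by apply: (xgetPex 0 (P := fun n => has_index (stabilize f) n)); exists n.
Qed.

Lemma stable_class_index f n : leavitt_family f -> has_index f n -> stable_class f = coker_pi n.
Proof.
move=> fF fn; apply: (stable_classE fF); rewrite -[n]addr0.
exact: has_index_sum iso_pairP fF (std_familyP E K) fn (std_has_index E K).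
Qed.

Lemma stable_class_sum f f' n n' : leavitt_family f -> leavitt_family f' ->
  has_index f n -> has_index f' n' -> stable_class (iso_sum f f') = coker_pi n + coker_pi n'.
Proof.
move=> fF fF' fn fn'; rewrite -coker_piD; apply: stable_class_index.
  exact: iso_sum_family.
exact: has_index_sum iso_pairP fF fF' fn fn'.
Qed.

Definition hom_class (F : nhom (leavitt K E) (Sigma K^o)) : Coker E :=
  stable_class (nhom_family F).

(** The chain of homotopies behind an M_2-homotopy passes through homomorphisms to M_2 Sigma that
    need not come from the corner, so the invariant is defined on all of these. *)
Definition hom2_class (F : nhom (leavitt K E) (mx2_alg (Sigma K^o))) : Coker E :=
  stable_class (@sblk K \o nhom_family F).

Lemma hom2_class_homotopic F G : homotopic F G -> hom2_class F = hom2_class G.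
Proof.
elim=> {F G} [F G [H [H0 H1]]|F|F G _ FG|F G L _ FG _ GL]; last first.
- exact: (etrans FG GL).
- exact: (esym FG).
- exact: erefl.
pose i := map_sigma (@polyC K).
have iX b : sigX K * i b = i b * sigX K by exact: sigX_comm.
pose Th := poly_spread (@sblk K) iX.
have [n hn] := has_index_homotopy (map_iso_pair_rel i iso_pairP) (lf_map Th (nhom_familyP H)).
have ThE (r : bool) (L : nhom (leavitt K E) (mx2_alg (Sigma K^o))) :
    (forall a, (H a : {poly (mx2_alg (Sigma K^o))}).[r%:R] = L a) ->
    hom2_class L = coker_pi n.
  move=> HL; apply: stable_classE; first exact: lf_map (nhom_familyP L).
  have r01 : (r%:R : K) = 0 \/ (r%:R : K) = 1 by case: (r); [right|left].
  have fE : map_sigma (horner_eval (r%:R : K)) \o (Th \o nhom_family H) = @sblk K \o nhom_family L.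
    apply/funext => g; apply: etrans _ (congr1 (@sblk K) (HL (lpa_gen K g))).
    exact: (ev_poly_spread _ iX _ (eval_map_const _) (eval_sigX K r)).
  by have := hn _ r01; rewrite fE !eval_map_const.
exact: etrans (ThE false F H0) (esym (ThE true G H1)).
Qed.

(** Under M_2 Sigma = Sigma the corner inclusion becomes conjugation by an isometry, and so does its
    stabilization; this preserves index vectors by [has_index_conj]. *)
Lemma hom2_class_iota2 F : hom2_class (iota2 F) = hom_class F.
Proof.
have fF := nhom_familyP F; have [n fn] := stabilize_has_index fF.
rewrite /hom_class (stable_classE fF fn); apply: stable_classE.
  exact: (lf_map (@sblk K) (nhom_familyP (iota2 F))).
have [Y0X0 _ _ _] := sfan2_iso_pair K.
have [h1 h2 h3] := corner_hop iso_pairP Y0X0.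
suff -> : stabilize (@sblk K \o nhom_family (iota2 F)) =
    (fun g => (iso_x1 p * sfan K o20 * iso_y1 p + iso_x2 p * 1 * iso_y2 p) *
      stabilize (nhom_family F) g *
      (iso_x1 p * sfan_tr K o20 * iso_y1 p + iso_x2 p * 1 * iso_y2 p)).
  by apply: has_index_conj fn => g; [exact: h1|exact: h2].
apply/funext => g; apply: etrans _ (esym (h3 _ _)).
exact: (congr1 (fun b => _ * b * _ + _) (sblk_corner (nhom_family F g))).
Qed.

Lemma hom_class_M2 F G : M2_homotopic F G -> hom_class F = hom_class G.
Proof. by move=> /hom2_class_homotopic; rewrite !hom2_class_iota2. Qed.

End StableClass.

Lemma subr_cross (V : zmodType) (a b c d : V) : a + d - (b + c) = a - b - (c - d).
Proof. by rewrite opprD opprB addrACA [d - c]addrC addrC. Qed.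

Section ExtInvariant.
Variables (E : digraph) (K : fieldType) (p : iso_pair (Sigma K^o)).
Implicit Types (F G : nhom (leavitt K E) (Sigma K^o)).

Definition std_nhom : nhom (leavitt K E) (Sigma K^o) := family_nhom (std_familyP E K).

Lemma nhom_family_std : nhom_family std_nhom = std_family K.
Proof. by apply/funext => g; exact: (family_nhomE (B := Sigma K^o) (std_familyP E K) g). Qed.

Lemma nhom_family_boxplus F G :
  nhom_family (boxplus p F G) = iso_sum p (nhom_family F) (nhom_family G).
Proof. exact: erefl. Qed.

Lemma nhom_family_stab F : nhom_family (boxplus p F std_nhom) = stabilize p (nhom_family F).
Proof. by rewrite nhom_family_boxplus nhom_family_std. Qed.

Lemma coker_pi0 : coker_pi 0 = 0 :> Coker E.
Proof. by apply: (addrI (coker_pi 0)); rewrite -coker_piD !addr0. Qed.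

(* Both sides are computed by [(F + h) + (G + h) = ((F + G) + h) + h], where [h] is
   the standard homomorphism. *)
Lemma hom_class_boxplus F G : hom_class p (boxplus p F G) = hom_class p F + hom_class p G.
Proof.
have fF := nhom_familyP F; have gF := nhom_familyP G; have sF := nhom_familyP std_nhom.
have bF := nhom_familyP (boxplus p F G).
have [n fn] := stabilize_has_index p fF; have [n' gn] := stabilize_has_index p gF.
have [m bm] := stabilize_has_index p bF.
have -> : hom_class p (boxplus p F G) =
    hom_class p (boxplus p (boxplus p (boxplus p F G) std_nhom) std_nhom).
  rewrite [in LHS]/hom_class (stable_classE bF bm) -[LHS]addr0 -[X in _ + X]coker_pi0.
  apply: esym; rewrite /hom_class nhom_family_boxplus nhom_family_stab.
  have sn : has_index (nhom_family std_nhom) 0.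
    by rewrite nhom_family_std; exact: std_has_index.
  exact: (stable_class_sum p (stabilize_family p bF) sF bm sn).
rewrite [in RHS]/hom_class (stable_classE fF fn) (stable_classE gF gn).
transitivity (hom_class p (boxplus p (boxplus p F std_nhom) (boxplus p G std_nhom))).
  apply: hom_class_M2; apply/M2_classP.
  have cD := @M2_classD _ (leavitt K E) _ p.
  apply: (etrans (esym (cD _ _))); apply: etrans _ (cD _ _).
  rewrite -!cD -addrA; exact: addrACA.
rewrite /hom_class nhom_family_boxplus !nhom_family_stab.
exact: (stable_class_sum p (stabilize_family p fF) (stabilize_family p gF) fn gn).
Qed.

Definition monoid_class (x : M2_monoid (leavitt K E) p) : Coker E := hom_class p (M2_repr x).

Lemma monoid_classE F : monoid_class (M2_class F) = hom_class p F.
Proof. by apply: hom_class_M2; apply/M2_classP; exact: M2_reprK. Qed.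

Lemma monoid_classD x y : monoid_class (x + y) = monoid_class x + monoid_class y.
Proof.
have [F ->] := M2_class_surj x; have [G ->] := M2_class_surj y.
apply: etrans (congr1 monoid_class (M2_classD p F G)) _.
by rewrite !monoid_classE hom_class_boxplus.
Qed.

Definition ext_class (x : Ext (leavitt K E) K^o p) : Coker E :=
  monoid_class (gc_repr x).1 - monoid_class (gc_repr x).2.

Lemma ext_classE a b : ext_class (gc_diff a b) = monoid_class a - monoid_class b.
Proof.
have /gc_diffP[k] := gc_reprK (gc_diff a b); rewrite /ext_class.
set u := gc_repr _ => /(congr1 monoid_class); rewrite !monoid_classD => /addIr h.
by apply/eqP; rewrite subr_eq addrAC -h addrK.
Qed.

Lemma ext_class_is_zmod_morphism : zmod_morphism ext_class.
Proof.
move=> x y; have [a [b ->]] := gc_diff_surj x; have [c [d ->]] := gc_diff_surj y.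
have -> : gc_diff a b - gc_diff c d = gc_diff (a + d) (b + c) :> Ext (leavitt K E) K^o p.
  by rewrite -[LHS]/(gc_add _ (gc_opp _)) gc_oppE gc_addE.
apply: etrans (ext_classE _ _) _.
apply: etrans (f_equal2 (fun u v => u - v) (monoid_classD a d) (monoid_classD b c)) _.
apply: etrans (subr_cross _ _ _ _) _.
exact: esym (f_equal2 (fun u v => u - v) (ext_classE a b) (ext_classE c d)).
Qed.

HB.instance Definition _ :=
  GRing.isZmodMorphism.Build (Ext (leavitt K E) K^o p) (Coker E) ext_class
    ext_class_is_zmod_morphism.

End ExtInvariant.

(** * Homomorphisms of equal class are stably homotopic *)

Section TwistAlgebra.
Variable B : nzRingType.

Lemma twist_edge (s t s' t' f g a c c' z : B) :
  g = t * s * g * (t' * s') -> f = f * (t' * s') ->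
  s * f * t' = c * z -> s * g * t' = c' * z -> a * c = c' -> t * a * s * f = g.
Proof.
move=> gE fE fc gc ac; rewrite fE.
transitivity (t * a * (s * f * t') * s'); first by rewrite !mulrA.
rewrite fc; transitivity (t * (a * c * z) * s'); first by rewrite !mulrA.
by rewrite ac -gc [RHS]gE !mulrA.
Qed.

Lemma twist_ghost (s t s' t' f g a c c' z : B) :
  g = t' * s' * g * (t * s) -> f = t' * s' * f ->
  s' * f * t = z * c -> s' * g * t = z * c' -> c * a = c' -> f * (t * a * s) = g.
Proof.
move=> gE fE fc gc ca; rewrite fE.
transitivity (t' * (s' * f * t) * a * s); first by rewrite !mulrA.
rewrite fc; transitivity (t' * (z * (c * a)) * s); first by rewrite !mulrA.
by rewrite ca -gc [RHS]gE !mulrA.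
Qed.

Variables (E : digraph) (x1 x2 y1 y2 X0 X1 Y0 Y1 : B) (f g h : lgen E -> B).
Variables (s t s' t' a a' : vtx E -> B).
Hypotheses (xy : iso_pair_rel x1 x2 y1 y2) (XY : iso_pair_rel X0 X1 Y0 Y1).
Hypothesis XY1 : X0 * Y0 + X1 * Y1 = 1.
Hypotheses (hF : leavitt_family h) (ht : trivialization h s' t').
Hypothesis fgv : forall v, g (GVtx v) = f (GVtx v).
Hypothesis fge : forall e, t (src e) * a (src e) * s (src e) * f (GEdge e) = g (GEdge e).
Hypothesis fgg : forall e, f (GGhost e) * (t (src e) * a' (src e) * s (src e)) = g (GGhost e).

Let hop := fun z1 z2 w1 w2 a a' b b' => @iso_pair_hop B x1 x2 y1 y2 z1 z2 w1 w2 a a' b b' xy.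
Let HOP := fun z1 z2 w1 w2 a a' b b' => @iso_pair_hop B X0 X1 Y0 Y1 z1 z2 w1 w2 a a' b b' XY.

(** The dilation of [a] acts as [a] on the first summand and as 1 on the second: [h] lends the
    complementary corner and is itself unchanged. *)
Lemma twist_lf_sum g0 : lf_sum x1 x2 y1 y2 g h g0 =
  triv_twist (fun w => X0 * s w * y1 + X1 * s' w * y2) (fun w => x1 * t w * Y0 + x2 * t' w * Y1)
    (fun v => dil X0 Y0 (a v)) (fun v => dil X0 Y0 (a' v)) (lf_sum x1 x2 y1 y2 f h) g0.
Proof.
have [st ts] := ht.
case: g0 => [v|e|e]; rewrite /= /lf_sum; first by rewrite fgv.
  by rewrite (dil_pair _ XY1) !HOP hop fge mulr1 ts lf_se.
by rewrite (dil_pair _ XY1) !HOP hop fgg mulr1 ts lf_gs.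
Qed.

End TwistAlgebra.

Section CancelConjugation.
Variables (E : digraph) (B : nzRingType) (f g : lgen E -> B) (s t s' t' : vtx E -> B).
Hypotheses (fF : leavitt_family f) (gF : leavitt_family g).
Hypotheses (fT : trivialization f s t) (gT : trivialization g s' t').

Lemma triv_delta (h : lgen E -> B) (r r' : vtx E -> B) v w :
  leavitt_family h -> trivialization h r r' -> r v * r' w = (v == w)%:R.
Proof.
move=> hF [rr r'r]; have [<-|vw] := eqVneq v w; first exact: rr.
rewrite -[r v]mul1r -(rr v) -[r' w]mulr1 -(rr w) -!mulrA (mulrA (r' v)) r'r.
by rewrite (mulrA (r' w)) r'r (mulrA (h _)) lf_vv // (negPf vw) mul0r mulr0.
Qed.

(** The partial isometry matching the vertices of [g] with those of [f]. *)
Definition triv_transfer (t s' : vtx E -> B) : B := \sum_v t v * s' v.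

Lemma triv_transferl v : s v * triv_transfer t s' = s' v.
Proof.
rewrite /triv_transfer mulr_sumr (bigD1 v) //= mulrA (triv_delta _ _ fF fT) eqxx mul1r.
rewrite big1 ?addr0 // => w wv.
by rewrite mulrA (triv_delta _ _ fF fT) eq_sym (negPf wv) mul0r.
Qed.

Lemma triv_transferr v : triv_transfer t s' * t' v = t v.
Proof.
rewrite /triv_transfer mulr_suml (bigD1 v) //= -mulrA (triv_delta _ _ gF gT) eqxx mulr1.
by rewrite big1 ?addr0 // => w wv; rewrite -mulrA (triv_delta _ _ gF gT) (negPf wv) mulr0.
Qed.

Lemma triv_transfer_mul :
  triv_transfer t' s * triv_transfer t s' = \sum_v g (GVtx v).
Proof.
have [_ ts'] := gT; rewrite [X in _ * X]/triv_transfer mulr_sumr; apply: eq_bigr => v _.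
rewrite -ts' mulrA; congr (_ * _); rewrite /triv_transfer mulr_suml (bigD1 v) //= -mulrA.
rewrite (triv_delta _ _ fF fT) eqxx mulr1.
by rewrite big1 ?addr0 // => w wv; rewrite -mulrA (triv_delta _ _ fF fT) (negPf wv) mulr0.
Qed.

End CancelConjugation.

Section FamilyUnit.
Variables (E : digraph) (B : nzRingType) (f : lgen E -> B).
Hypothesis fF : leavitt_family f.

Let unitl v b : f (GVtx v) * b = b -> (\sum_w f (GVtx w)) * b = b.
Proof.
move=> <-; rewrite mulrA mulr_suml (bigD1 v) //= lf_vtx // big1 ?addr0 // => w wv.
by rewrite lf_vv // (negPf wv).
Qed.

Let unitr v b : b * f (GVtx v) = b -> b * (\sum_w f (GVtx w)) = b.
Proof.
move=> <-; rewrite -mulrA mulr_sumr (bigD1 v) //= lf_vtx // big1 ?addr0 // => w wv.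
by rewrite lf_vv // eq_sym (negPf wv).
Qed.

Lemma lf_unitl g : (\sum_w f (GVtx w)) * f g = f g.
Proof.
by case: g => [v|e|e]; [apply: (unitl (v := v)); rewrite lf_vtx
  |apply: (unitl (v := src e)); rewrite lf_se|apply: (unitl (v := rng e)); rewrite lf_rg].
Qed.

Lemma lf_unitr g : f g * (\sum_w f (GVtx w)) = f g.
Proof.
by case: g => [v|e|e]; [apply: (unitr (v := v)); rewrite lf_vtx
  |apply: (unitr (v := rng e)); rewrite lf_er|apply: (unitr (v := src e)); rewrite lf_gs].
Qed.

End FamilyUnit.

Lemma triv_transfer_conj (E : digraph) (B : nzRingType) (f g : lgen E -> B) s t s' t' :
  leavitt_family f -> leavitt_family g -> trivialization f s t -> trivialization g s' t' ->
  let r := triv_transfer t s' in let r' := triv_transfer t' s in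
  trivialization (fun x => r * g x * r') s t /\
  forall v w b, s v * (r * b * r') * t w = s' v * b * t' w.
Proof.
move=> fF gF fT gT r r'; have [st ts] := fT; have [st' ts'] := gT.
have rt v : r * t' v = t v by exact: triv_transferr gF gT v.
have sr v : s' v * r' = s v by exact: triv_transferl gF gT v.
have rs v : s v * r = s' v by exact: triv_transferl fF fT v.
have tr v : r' * t v = t' v by exact: triv_transferr fF fT v.
split=> [|v w b]; first by split=> // v; rewrite -ts' mulrA rt -mulrA sr.
by rewrite !mulrA rs -mulrA tr.
Qed.

Section Realization.
Variables (E : digraph) (K : fieldType).
Implicit Types (f g : lgen E -> Sig K) (n m : {ffun reg_vtx E -> int}).

Lemma vertex_unit_twist f s t w w' v : trivialization f s t ->
  vertex_unit (triv_twist s t w w' f) s t v = w v * vertex_unit f s t v.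
Proof.
move=> [st _]; rewrite /vertex_unit mulr_sumr; apply: eq_bigr => e /eqP <-.
rewrite !mulrA st mul1r; exact: erefl.
Qed.

(** The vertex units of the standard family are 1; twisting it by units of the prescribed indices
    turns them into these units. *)
Lemma exists_family_index n : exists f, leavitt_family f /\ has_index f n.
Proof.
have hu (v : vtx E) : exists uu : Sig K * Sig K, inverses uu.1 uu.2 /\
    forall rv : is_reg v, ind uu.1 = n (exist _ v rv).
  case: (pselect (is_reg v)) => [rv|nv]; last first.
    exists (1, 1); split; first exact: inverses1.
    by move=> rv; case: (nv rv).
  have [u [u' [uu ui]]] := ind_surj K (n (exist _ v rv)); exists (u, u'); split=> // rv'.
  by rewrite (bool_irrelevance rv' rv).
have [w hw] := choice hu; have ww v : inverses (w v).1 (w v).2 by have [] := hw v.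
have sT := std_trivialization E K; have sF := std_familyP E K.
pose f := triv_twist (@vtx_out E K) (@vtx_in E K) (fun v => (w v).1) (fun v => (w v).2) (std_family K).
exists f; split; first exact: (triv_twist_family sF sT ww).
exists (@vtx_out E K), (@vtx_in E K); split; first by case: sT => st ts; split.
apply/ffunP => -[v rv]; have [_ wi] := hw v; rewrite -wi.
apply: etrans _ (esym (vertex_indexE _ _ _ rv)); apply: (congr1 (@ind K)).
apply: etrans _ (esym (vertex_unit_twist _ _ _ sT)).
by rewrite std_vertex_unit // mulr1.
Qed.

(** Units of every index exist, so every vector x is realized by a change of trivialization. *)
Lemma has_index_coker_eq f n m : leavitt_family f -> has_index f m -> coker_eq n m ->
  has_index f n.
Proof.
move=> fF [s [t [fT ->]]] [x nmx].
have [w hw] := choice (fun v => ind_surj K (x v)); have [w' {}hw] := choice hw.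
have wT : trivialization f (fun v => w v * s v) (fun v => t v * w' v).
  have [st ts] := fT; split=> v; have [[ww' w'w] _] := hw v.
    by rewrite mulrA -(mulrA (w v)) st mulr1.
  by rewrite mulrA -(mulrA (t v)) w'w mulr1.
exists (fun v => w v * s v), (fun v => t v * w' v); split=> //.
apply: (addIr (- vertex_index f s t)); rewrite nmx (vertex_index_change fF fT wT).
congr I_minus_A; apply/ffunP => v; rewrite ffunE; have [st _] := fT.
by rewrite -mulrA st mulr1; have [_ ->] := hw v.
Qed.

End Realization.

Lemma vertex_unit'_pick (E : digraph) (R : comNzRingType) (f : lgen E -> Sig R) s t e :
  sedge_out R e * vertex_unit' f s t (src e) = s (rng e) * f (GGhost e) * t (src e).
Proof.
have re : is_reg (src e) by apply/existsP; exists e.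
exact: (vfan_pickl _ (sedge_fan R re)).
Qed.

Lemma triv_edge (E : digraph) (B : nzRingType) (f : lgen E -> B) s t e :
  leavitt_family f -> trivialization f s t ->
  [/\ f (GEdge e) = t (src e) * s (src e) * f (GEdge e) * (t (rng e) * s (rng e)),
      f (GEdge e) = f (GEdge e) * (t (rng e) * s (rng e)) &
      f (GGhost e) = t (rng e) * s (rng e) * f (GGhost e) * (t (src e) * s (src e)) /\
      f (GGhost e) = t (rng e) * s (rng e) * f (GGhost e)].
Proof.
by move=> fF [_ ts]; rewrite !ts; split; rewrite ?lf_se ?lf_er ?lf_rg ?lf_gs.
Qed.

Section StableHomotopy.
Variables (E : digraph) (K : fieldType) (p : iso_pair (Sigma K^o)).
Implicit Types (F G : nhom (leavitt K E) (Sigma K^o)).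

(** [G] is the twist of [F] by the quotients of their vertex units, which have index 0. Adding the
    standard homomorphism replaces these quotients by their dilations, which are elementary. *)
Lemma homotopic_stabilize F G s t :
  trivialization (nhom_family F) s t -> trivialization (nhom_family G) s t ->
  (forall v, is_reg v -> ind (vertex_unit (nhom_family F) s t v) =
    ind (vertex_unit (nhom_family G) s t v)) ->
  homotopic (boxplus p F (std_nhom E K)) (boxplus p G (std_nhom E K)).
Proof.
move=> fT gT indE; have fF := nhom_familyP F; have gF := nhom_familyP G.
set f := nhom_family F in fT fF indE *; set g := nhom_family G in gT gF indE *.
pose cf v := vertex_unit f s t v; pose cf' v := vertex_unit' f s t v.
pose cg v := vertex_unit g s t v; pose cg' v := vertex_unit' g s t v.
have cfK v : is_reg v -> inverses (cf v) (cf' v) by exact: vertex_unitK.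
have cgK v : is_reg v -> inverses (cg v) (cg' v) by exact: vertex_unitK.
(* A sink has no edge to twist, hence the value 1. *)
pose a v := if is_reg v then cg v * cf' v else 1.
pose a' v := if is_reg v then cf v * cg' v else 1.
have aK v : inverses (a v) (a' v).
  rewrite /a /a'; case: ifP => rv; last exact: inverses1.
  exact: inversesM (cgK v rv) (inverses_sym (cfK v rv)).
have ind_a v : ind (a v) = 0.
  rewrite /a; case: ifP => rv; last exact: ind1.
  apply: etrans (indM (cgK v rv) (inverses_sym (cfK v rv))) _.
  apply: etrans (congr1 (fun b => _ + b) (indV (cfK v rv))) _.
  by apply/eqP; rewrite subr_eq0; apply/eqP/esym; exact: indE.
have el v := ind0_elementary (aK v) (ind_a v).
have xy := iso_pairP p; have XY := sfan2_iso_pair K; have XY1 := sfan2_sum K.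
have hF := std_familyP E K; have hT := std_trivialization E K.
have [_ tw] := twist_homotopic_elementary (K := K) (B := Sigma K^o)
  (fun w => sfan K o20 * s w * iso_y1 p + sfan K o21 * vtx_out K w * iso_y2 p)
  (fun w => iso_x1 p * t w * sfan_tr K o20 + iso_x2 p * vtx_in K w * sfan_tr K o21) el.
have [st ts] := fT; have [_ tsg] := gT.
apply: tw; first by rewrite nhom_family_stab; exact: trivialization_sum.
move=> g0; rewrite nhom_family_stab.
rewrite -[LHS]/(nhom_family (boxplus p G (std_nhom E K)) g0) nhom_family_stab.
apply: (twist_lf_sum xy XY XY1 hF hT) => [v|e|e].
- exact: etrans (esym (tsg v)) (ts v).
- have re : is_reg (src e) by apply/existsP; exists e.
  have ac : a (src e) * cf (src e) = cg (src e).
    by rewrite /a re -mulrA; have [_ ->] := cfK _ re; rewrite mulr1.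
  have [_ fE _] := triv_edge e fF fT; have [gE _ _] := triv_edge e gF gT.
  have fv : s (src e) * f (GEdge e) * t (rng e) = cf (src e) * sedge_in K e.
    exact: esym (vertex_unit_pick e fF fT).
  have gv : s (src e) * g (GEdge e) * t (rng e) = cg (src e) * sedge_in K e.
    exact: esym (vertex_unit_pick e gF gT).
  exact: (twist_edge gE fE fv gv ac).
- have re : is_reg (src e) by apply/existsP; exists e.
  have ca : cf' (src e) * a' (src e) = cg' (src e).
    by rewrite /a' re mulrA; have [_ ->] := cfK _ re; rewrite mul1r.
  have [_ _ [_ fE]] := triv_edge e fF fT; have [_ _ [gE _]] := triv_edge e gF gT.
  have fv : s (rng e) * f (GGhost e) * t (src e) = sedge_out K e * cf' (src e).
    exact: esym (vertex_unit'_pick f s t e).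
  have gv : s (rng e) * g (GGhost e) * t (src e) = sedge_out K e * cg' (src e).
    exact: esym (vertex_unit'_pick g s t e).
  exact: (twist_ghost gE fE fv gv ca).
Qed.

End StableHomotopy.

Lemma subr_eq_cross (V : zmodType) (a b c d : V) : a - b = c - d -> a + d = c + b.
Proof. by move=> /eqP; rewrite subr_eq addrAC => /eqP ->; rewrite subrK addrC. Qed.

Section Injectivity.
Variables (E : digraph) (K : fieldType) (p : iso_pair (Sigma K^o)).
Implicit Types (F G : nhom (leavitt K E) (Sigma K^o)).

(** Equal indices may come with unrelated trivializations. Conjugating [G] by a partial isometry,
    which is an M_2-homotopy, gives it the trivialization of [F] and keeps its vertex units. *)
Lemma M2_homotopic_stabilize F G n :
  has_index (nhom_family F) n -> has_index (nhom_family G) n ->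
  M2_homotopic (boxplus p F (std_nhom E K)) (boxplus p G (std_nhom E K)).
Proof.
move=> [s [t [fT fn]]] [s' [t' [gT gn]]].
have fF := nhom_familyP F; have gF := nhom_familyP G.
have [cT cE] := triv_transfer_conj fF gF fT gT.
have rr := triv_transfer_mul fF fT gT.
set r := triv_transfer t s' in cT cE rr; set r' := triv_transfer t' s in cT cE rr.
have rG a : r' * r * G a = G a.
  by apply: nhom_lpa_unitl => g; rewrite rr; exact: (lf_unitl gF g).
have Gr a : G a * (r' * r) = G a.
  by apply: nhom_lpa_unitr => g; rewrite rr; exact: (lf_unitr gF g).
have GrG a b : G a * (r' * r) * G b = G a * G b by rewrite Gr.
have GG' : M2_homotopic G (nhom_conj GrG) by apply: (corner_conj rG Gr) => a.
apply: (homotopic_trans _ (homotopic_sym (boxplus_M2 p GG' (homotopic_refl (iota2 (std_nhom E K)))))).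
apply: homotopic_iota2; apply: (homotopic_stabilize (G := nhom_conj GrG) p fT cT) => v rv.
have vE := congr1 (fun x : {ffun reg_vtx E -> int} => x (exist _ v rv)) (etrans (esym fn) gn).
have {}vE := etrans (esym (vertex_indexE _ _ _ rv)) (etrans vE (vertex_indexE _ _ _ rv)).
apply: etrans vE _; apply: (congr1 (@ind K)); apply: eq_bigr => e _.
by apply: (congr1 (fun b => b * sedge_out K e)); exact: esym (cE _ _ _).
Qed.

(** The standard class is added once for index vectors to exist, and once more for
    [M2_homotopic_stabilize]. *)
Lemma hom_class_cancel F G : hom_class p F = hom_class p G ->
  exists k : M2_monoid (leavitt K E) p,
    (M2_class F : M2_monoid (leavitt K E) p) + k = (M2_class G : M2_monoid (leavitt K E) p) + k.
Proof.
have fF := nhom_familyP F; have gF := nhom_familyP G.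
have [n fn] := stabilize_has_index p fF; have [m gm] := stabilize_has_index p gF.
rewrite /hom_class (stable_classE fF fn) (stable_classE gF gm) => /coker_piP nm.
have gn := has_index_coker_eq (stabilize_family p gF) gm nm.
have h := M2_homotopic_stabilize (F := boxplus p F (std_nhom E K))
  (G := boxplus p G (std_nhom E K)) (n := n).
rewrite !nhom_family_stab in h; have {h} := h fn gn.
move=> /M2_classP h; pose k : M2_monoid (leavitt K E) p := M2_class (std_nhom E K).
have cD := @M2_classD _ (leavitt K E) _ p.
have cDD L : (M2_class L : M2_monoid (leavitt K E) p) + (k + k) =
    M2_class (boxplus p (boxplus p L (std_nhom E K)) (std_nhom E K)).
  by rewrite -cD -cD addrA.
by exists (k + k); apply: etrans (cDD F) (etrans h (esym (cDD G))).
Qed.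

Lemma monoid_class0 : monoid_class (0 : M2_monoid (leavitt K E) p) = 0.
Proof.
apply: (addIr (monoid_class (0 : M2_monoid (leavitt K E) p))).
by apply: etrans (esym (monoid_classD 0 0)) _; rewrite !add0r.
Qed.

Lemma ext_class_bijective : bijective (@ext_class E K p).
Proof.
have inj : injective (@ext_class E K p).
  move=> x y; have [a [b ->]] := gc_diff_surj x; have [c [d ->]] := gc_diff_surj y.
  rewrite !ext_classE => h; apply/gc_diffP.
  have {h} : monoid_class (a + d) = monoid_class (c + b).
    apply: etrans (monoid_classD a d) (etrans _ (esym (monoid_classD c b))).
    exact: subr_eq_cross h.
  have [F FE] := M2_class_surj (a + d); have [G GE] := M2_class_surj (c + b).
  rewrite FE GE !monoid_classE => /hom_class_cancel; exact.
have surj (y : Coker E) : exists x : Ext (leavitt K E) K^o p, ext_class x = y.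
  have [n ->] := coker_pi_surj y; have [f [fF fn]] := exists_family_index K n.
  exists (gc_diff (M2_class (family_nhom (B := Sigma K^o) fF) : M2_monoid (leavitt K E) p) 0).
  rewrite ext_classE monoid_class0 subr0 monoid_classE; apply: stable_class_index.
    exact: nhom_familyP.
  have -> // : nhom_family (family_nhom (B := Sigma K^o) fF) = f.
  by apply/funext => g; exact: (family_nhomE (B := Sigma K^o) fF g).
have [g gK] := choice surj; exists g; last exact: gK.
by move=> x; apply: inj; exact: gK.
Qed.

End Injectivity.

Theorem corollary7p3 (K : fieldType) (E : digraph)
  (simpleLE : simple_algebra (leavitt K E))
  (p : iso_pair (Sigma K^o)) :
  exists phi : {additive Ext (leavitt K E) K^o p -> Coker E}, bijective phi.
Proof. by exists (@ext_class E K p); exact: ext_class_bijective. Qed.
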